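(* Let $q,r\ge 0$ with $q+r\geq 2$ and let $\Gamma$ be a nonelementary subgroup of $G=\mathrm{PSL}(2,\mathbb{C})^q\times\mathrm{PSL}(2,\mathbb{R})^r$. Then: (1) the projective limit set $P_\Gamma$ is convex, in the sense that whenever $(x_1:\dots:x_{q+r})$ and $(y_1:\dots:y_{q+r})$ are points of $P_\Gamma$ with all $x_i,y_i>0$, the points $(x_1+\lambda y_1:\dots:x_{q+r}+\lambda y_{q+r})$, $\lambda>0$, all lie in $P_\Gamma$; (2) the closure of $P_\Gamma$ in $\mathbb{RP}^{q+r-1}$ equals the limit cone of $\Gamma$; (3) in particular the limit cone of $\Gamma$ is convex.
   Context: $G=\mathrm{PSL}(2,\mathbb{C})^q\times\mathrm{PSL}(2,\mathbb{R})^r$ acts componentwise by isometries on $X=(\mathbb{H}^3)^q\times(\mathbb{H}^2)^r$ (product metric); $p_i$ denotes the $i$-th coordinate projection, $i=1,\dots,q+r$. Elements of $\mathrm{PSL}(2,\mathbb{C})$ are elliptic, parabolic or loxodromic in the usual sense; hyperbolic means loxodromic with real trace. For $g\in\mathrm{PSL}(2,\mathbb{C})$, $\ell(g)$ is its translation length if $g$ is loxodromic and $0$ otherwise. An element $g=(g_1,\dots,g_{q+r})\in G$ is elliptic (resp. parabolic, loxodromic, hyperbolic) if all $g_i$ are, and mixed otherwise. A subgroup of $\mathrm{PSL}(2,\mathbb{C})$ is elementary if it has a finite orbit in $\mathbb{H}^3\cup\partial\mathbb{H}^3$, nonelementary otherwise. A subgroup $\Gamma\le G$ is nonelementary if every $p_i(\Gamma)$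 is nonelementary and for every mixed $g\in\Gamma$ each component $g_i$ is loxodromic or elliptic of infinite order. $\partial X$ is the geometric boundary (asymptote classes of unit-speed geodesic rays, cone topology). The limit set is $\mathcal{L}_\Gamma=\overline{\Gamma x}\cap\partial X$ ($x\in X$ arbitrary). A ray $\gamma$ is regular if all $p_i\circ\gamma$ are nonconstant; the regular boundary is identified with $(\partial\mathbb{H}^3)^q\times(\partial\mathbb{H}^2)^r\times\mathbb{RP}^{q+r-1}_+$, $[\gamma]\mapsto\big((p_i\circ\gamma)(+\infty)\big)_i\times\big(\|(p_1\circ\gamma)'\|:\dots:\|(p_{q+r}\circ\gamma)'\|\big)$, where $\mathbb{RP}^{q+r-1}_+=\{(w_1:\dots:w_{q+r}):w_i>0\ \forall i\}$. $\mathcal{L}^{reg}_\Gamma$ is $\mathcal{L}_\Gamma$ intersected with the regular boundary, and $P_\Gamma$ (projective limit set) is its projection to $\mathbb{RP}^{q+r-1}_+$. The limit cone of $\Gamma$ is the smallest closed cone in $\mathbb{R}^{q+r}$ containing all vectors $(\ell(g_1),\dots,\ell(g_{q+r}))$, $g\in\Gamma$ (equivalently, the smallest closed cone in the diagonal Cartan subspace containing $\log\lambda(\Gamma)$, $\lambda(g)$ the diagonal form of the hyperbolic Jordan component of $g$), identified with its image in $\mathbb{RP}^{q+r-1}$. *)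

(* Defs.v *)
From Stdlib Require Import Reals List.
Open Scope R_scope.

Record Cx := mkC { re : R; im : R }.
Definition C0 := mkC 0 0.
Definition C1 := mkC 1 0.
Definition cadd (z w : Cx) := mkC (re z + re w) (im z + im w).
Definition copp (z : Cx) := mkC (- re z) (- im z).
Definition csub (z w : Cx) := cadd z (copp w).
Definition cmul (z w : Cx) :=
  mkC (re z * re w - im z * im w) (re z * im w + im z * re w).
Definition cconj (z : Cx) := mkC (re z) (- im z).
Definition cnorm2 (z : Cx) := re z * re z + im z * im z.
Definition cscal (a : R) (z : Cx) := mkC (a * re z) (a * im z).
Definition cdiv (z w : Cx) := cscal (/ cnorm2 w) (cmul z (cconj w)).

Record mat2 := mkM { ma : Cx; mb : Cx; mc : Cx; md : Cx }.
Definition mI := mkM C1 C0 C0 C1.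
Definition mnegI := mkM (copp C1) C0 C0 (copp C1).
Definition mmul (g h : mat2) :=
  mkM (cadd (cmul (ma g) (ma h)) (cmul (mb g) (mc h)))
      (cadd (cmul (ma g) (mb h)) (cmul (mb g) (md h)))
      (cadd (cmul (mc g) (ma h)) (cmul (md g) (mc h)))
      (cadd (cmul (mc g) (mb h)) (cmul (md g) (md h))).
Definition mneg (g : mat2) := mkM (copp (ma g)) (copp (mb g)) (copp (mc g)) (copp (md g)).
(* inverse of a determinant-one matrix *)
Definition minv (g : mat2) := mkM (md g) (copp (mb g)) (copp (mc g)) (ma g).
Fixpoint mpow (g : mat2) (k : nat) : mat2 :=
  match k with O => mI | S k' => mmul g (mpow g k') end.
Definition mdet (g : mat2) := csub (cmul (ma g) (md g)) (cmul (mb g) (mc g)).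
Definition mtr (g : mat2) := cadd (ma g) (md g).
Definition real_mat (g : mat2) :=
  im (ma g) = 0 /\ im (mb g) = 0 /\ im (mc g) = 0 /\ im (md g) = 0.

(* classification of (the class in PSL(2,C) of) g in SL(2,C), via the trace;
   the identity counts as elliptic *)
Definition elliptic (g : mat2) :=
  (im (mtr g) = 0 /\ Rabs (re (mtr g)) < 2) \/ g = mI \/ g = mnegI.
Definition parabolic (g : mat2) :=
  im (mtr g) = 0 /\ Rabs (re (mtr g)) = 2 /\ g <> mI /\ g <> mnegI.
Definition loxodromic (g : mat2) :=
  ~ (im (mtr g) = 0 /\ Rabs (re (mtr g)) <= 2).
Definition elliptic_inf_order (g : mat2) :=
  elliptic g /\ forall k : nat, (1 <= k)%nat -> mpow g k <> mI /\ mpow g k <> mnegI.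

(* a point (z,t) with z in C, t > 0 ; H^2 is the totally geodesic plane im z = 0 *)
Definition H3pt := (Cx * R)%type.
Definition inH3 (p : H3pt) := 0 < snd p.
Definition acosh (u : R) := ln (u + sqrt (u * u - 1)).
Definition d3 (p p' : H3pt) : R :=
  acosh (1 + (cnorm2 (csub (fst p) (fst p')) + (snd p - snd p') * (snd p - snd p'))
             / (2 * snd p * snd p')).
(* Poincare extension of the Moebius action *)
Definition act3 (g : mat2) (p : H3pt) : H3pt :=
  let z := fst p in let t := snd p in
  let czd := cadd (cmul (mc g) z) (md g) in
  let D := cnorm2 czd + cnorm2 (mc g) * (t * t) in
  (cscal (/ D) (cadd (cmul (cadd (cmul (ma g) z) (mb g)) (cconj czd))
                     (cscal (t * t) (cmul (ma g) (cconj (mc g))))),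
   t / D).

Inductive H3bar := Inner (z : Cx) (t : R) | Bd (z : Cx) | Inf.
Definition validH3bar (p : H3bar) :=
  match p with Inner _ t => 0 < t | _ => True end.
Definition act3bar (g : mat2) (p : H3bar) : H3bar :=
  match p with
  | Inner z t => let q := act3 g (z, t) in Inner (fst q) (snd q)
  | Bd z => let w := cadd (cmul (mc g) z) (md g) in
            if Req_EM_T (cnorm2 w) 0 then Inf
            else Bd (cdiv (cadd (cmul (ma g) z) (mb g)) w)
  | Inf => if Req_EM_T (cnorm2 (mc g)) 0 then Inf else Bd (cdiv (ma g) (mc g))
  end.

(* a subgroup H of PSL(2,C), given by a set of lifts, is elementary iff it has a
   finite orbit in H^3 u dH^3 *)
Definition elementary (H : mat2 -> Prop) :=
  exists p : H3bar, validH3bar p /\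
    exists L : list H3bar, forall h, H h -> In (act3bar h p) L.

(* An element of G is represented by a lift g : nat -> mat2 (components i < q+r);
   factor i < q is PSL(2,C), factor i >= q is PSL(2,R). *)
Definition inG (q r : nat) (g : nat -> mat2) :=
  forall i, (i < q + r)%nat -> mdet (g i) = C1 /\ ((q <= i)%nat -> real_mat (g i)).
Definition gmul (g h : nat -> mat2) := fun i => mmul (g i) (h i).
Definition ginv (g : nat -> mat2) := fun i => minv (g i).
Definition gone : nat -> mat2 := fun _ => mI.

(* Gamma is (the full preimage in the lifts of) a subgroup of G *)
Definition is_subgroup (q r : nat) (Gam : (nat -> mat2) -> Prop) :=
  (forall g, Gam g -> inG q r g) /\
  Gam gone /\
  (forall g h, Gam g -> Gam h -> Gam (gmul g h)) /\
  (forall g, Gam g -> Gam (ginv g)) /\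
  (forall g (s : nat -> bool), Gam g ->
     Gam (fun i => if s i then mneg (g i) else g i)).

Definition proj (Gam : (nat -> mat2) -> Prop) (i : nat) : mat2 -> Prop :=
  fun h => exists g, Gam g /\ g i = h.

Definition g_elliptic (n : nat) (g : nat -> mat2) := forall i, (i < n)%nat -> elliptic (g i).
Definition g_parabolic (n : nat) (g : nat -> mat2) := forall i, (i < n)%nat -> parabolic (g i).
Definition g_loxodromic (n : nat) (g : nat -> mat2) := forall i, (i < n)%nat -> loxodromic (g i).
Definition g_mixed (n : nat) (g : nat -> mat2) :=
  ~ g_elliptic n g /\ ~ g_parabolic n g /\ ~ g_loxodromic n g.

Definition nonelementary (q r : nat) (Gam : (nat -> mat2) -> Prop) :=
  (forall i, (i < q + r)%nat -> ~ elementary (proj Gam i)) /\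
  (forall g, Gam g -> g_mixed (q + r) g ->
     forall i, (i < q + r)%nat -> loxodromic (g i) \/ elliptic_inf_order (g i)).

(* points of X = (H^3)^q x (H^2)^r with the product metric *)
Definition Xpt := nat -> H3pt.
Definition inX (q r : nat) (x : Xpt) :=
  forall i, (i < q + r)%nat -> inH3 (x i) /\ ((q <= i)%nat -> im (fst (x i)) = 0).
Fixpoint sumR (n : nat) (f : nat -> R) : R :=
  match n with O => 0 | S k => sumR k f + f k end.
Definition dX (n : nat) (x y : Xpt) : R :=
  sqrt (sumR n (fun i => d3 (x i) (y i) * d3 (x i) (y i))).
Definition actX (g : nat -> mat2) (x : Xpt) : Xpt := fun i => act3 (g i) (x i).
Definition base : Xpt := fun _ => (C0, 1).

Definition ray_from_base (q r : nat) (gam : R -> Xpt) :=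
  gam 0 = base /\
  (forall s, 0 <= s -> inX q r (gam s)) /\
  (forall s s', 0 <= s -> 0 <= s' -> dX (q + r) (gam s) (gam s') = Rabs (s - s')).
Definition regular_ray (n : nat) (gam : R -> Xpt) :=
  forall i, (i < n)%nat -> exists s, 0 <= s /\ gam s i <> gam 0 i.
(* speed ||(p_i o gam)'|| of the i-th component (a constant-speed geodesic) *)
Definition comp_speed (gam : R -> Xpt) (i : nat) : R := d3 (gam 0 i) (gam 1 i).

(* basic cone-topology neighbourhood U(gam, R, eps) (basepoint o), restricted to X *)
Definition in_cone_nbhd (q r : nat) (gam : R -> Xpt) (Rr eps : R) (x : Xpt) :=
  Rr < dX (q + r) base x /\
  forall y, inX q r y -> dX (q + r) base y = Rr ->
    dX (q + r) y x = dX (q + r) base x - Rr -> dX (q + r) y (gam Rr) < eps.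

Definition in_limit_set (q r : nat) (Gam : (nat -> mat2) -> Prop) (gam : R -> Xpt) :=
  ray_from_base q r gam /\
  forall Rr eps, 0 < Rr -> 0 < eps ->
    exists g, Gam g /\ in_cone_nbhd q r gam Rr eps (actX g base).

(* projective limit set, as a (scale-invariant) set of positive vectors *)
Definition proj_limit_set (q r : nat) (Gam : (nat -> mat2) -> Prop) (w : nat -> R) :=
  (forall i, (i < q + r)%nat -> 0 < w i) /\
  exists gam, in_limit_set q r Gam gam /\ regular_ray (q + r) gam /\
    exists c, 0 < c /\ forall i, (i < q + r)%nat -> w i = c * comp_speed gam i.

Definition vnorm (n : nat) (v : nat -> R) := sqrt (sumR n (fun i => v i * v i)).
Definition vdist (n : nat) (u v : nat -> R) := vnorm n (fun i => u i - v i).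
Definition nonzero_vec (n : nat) (v : nat -> R) := exists i, (i < n)%nat /\ v i <> 0.
Definition proj_dist (n : nat) (u v : nat -> R) :=
  Rmin (vdist n (fun i => u i / vnorm n u) (fun i => v i / vnorm n v))
       (vdist n (fun i => u i / vnorm n u) (fun i => - v i / vnorm n v)).
Definition in_proj_closure (n : nat) (P : (nat -> R) -> Prop) (v : nat -> R) :=
  forall eps, 0 < eps -> exists w, P w /\ nonzero_vec n w /\ proj_dist n w v < eps.

Definition closed_set (n : nat) (C : (nat -> R) -> Prop) :=
  forall v, (forall eps, 0 < eps -> exists u, C u /\ vdist n u v < eps) -> C v.
Definition is_cone (C : (nat -> R) -> Prop) :=
  forall v t, C v -> 0 <= t -> C (fun i => t * v i).

Definition is_inf (E : R -> Prop) (l : R) :=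
  (forall x, E x -> l <= x) /\ (forall l', (forall x, E x -> l' <= x) -> l' <= l).
Definition transl_length (g : mat2) (l : R) :=
  (loxodromic g /\ is_inf (fun x => exists p, inH3 p /\ x = d3 p (act3 g p)) l) \/
  (~ loxodromic g /\ l = 0).

Definition limit_cone (q r : nat) (Gam : (nat -> mat2) -> Prop) (v : nat -> R) :=
  forall C, closed_set (q + r) C -> is_cone C ->
    (forall g u, Gam g -> (forall i, (i < q + r)%nat -> transl_length (g i) (u i)) -> C u) ->
    C v.

(* Main.v *)
(** Write [mn g] for the squared Frobenius norm of [g] in SL(2,C) and [cartan g] for the displacement
    of the base point, so that [2 cosh (cartan g) = mn g].  All three statements are read off from the
    asymptotic cone [K] of the vectors [(cartan (g i))_i], [g] in [Gam]: the limits of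
    [cartan (g_k) / T_k] with [T_k -> oo].

    The key is a transversality statement: for nonzero matrices [M i] some [f] in [Gam] has
    [tr (M i * f i) <> 0] in all factors at once.  It is proved one factor at a time, replacing [f] by
    [g^k f] with [g] loxodromic in the new factor; in the other factors [k |-> tr (M g^k f)] either
    has at most one zero or is periodic up to sign.  By compactness [f] may be taken in a bounded set
    and the traces bounded below, so up to a bounded error the translation length of [g f] is
    [cartan g], and [cartan (g f h)] is [cartan g + cartan h].  Hence [K] equals the limit cone and is
    convex.  Every factor contains a loxodromic element, so [K] contains a positive vector; [K] is
    therefore the closure of its positive part, which is the projective limit set by compactness of
    the unit tangent spheres. *)

From Stdlib Require Import Reals List Lra Lia Classical ClassicalEpsilon FunctionalExtensionality.
From Coquelicot Require Import Coquelicot.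
Require Import Defs.
Open Scope R_scope.


(** The hypotheses control each factor separately, whereas transversality is wanted in all factors
    for one and the same element. An element that is loxodromic in the new factor may be elliptic in
    the old ones, so its powers need not attract anything there; therefore transversality is phrased
    as the nonvanishing of the linear forms [f |-> tr (M i * f i)], a condition that survives under
    powers, and not by fixed points in general position. Every error has to be an additive constant
    independent of [g], because division by [T] is what removes it. For the length of [g f] the
    upper bound is submultiplicativity of [mn], and the lower one is that a trace is at most twice
    the spectral radius, so a trace bounded below by a fixed multiple of the norm suffices. For
    [g f h], an entry of the product is the trace of [f] against a rank-one matrix built from [g]
    and [h]; this is why the matrices [M i] may be singular. The facts about single matrices all
    come from Cayley-Hamilton. The sign of a lift is harmless, since [mn] and the squared modulus of
    a trace do not see it. *)

Lemma Cx_eq (z w : Cx) : re z = re w -> im z = im w -> z = w.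
Proof. destruct z, w; simpl; intros -> ->; reflexivity. Qed.

(** * The complex field: squared modulus, square roots, quadratic equations *)

Definition cinv (z : Cx) : Cx := cdiv C1 z.

Lemma cnorm2_ge0 z : 0 <= cnorm2 z.
Proof. unfold cnorm2; nra. Qed.

Lemma cnorm2_eq0 z : cnorm2 z = 0 -> z = C0.
Proof. intros H; apply Cx_eq; unfold cnorm2 in H; simpl; nra. Qed.

Lemma cnorm2_gt0 z : z <> C0 -> 0 < cnorm2 z.
Proof.
  intros H; destruct (cnorm2_ge0 z) as [h|h]; auto.
  exfalso; apply H, cnorm2_eq0; auto.
Qed.

Lemma Cx_field_theory : field_theory C0 C1 cadd cmul csub copp cdiv cinv (@eq Cx).
Proof.
  constructor.
  - constructor; intros; apply Cx_eq; simpl; ring.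
  - intro H; injection H; lra.
  - intros p q; apply Cx_eq; simpl; ring.
  - intros p Hp; assert (h := cnorm2_gt0 p Hp); unfold cinv, cdiv.
    apply Cx_eq; simpl; unfold cnorm2 in *; field; lra.
Qed.
Add Field Cx_field : Cx_field_theory.

Lemma cnorm2_mul z w : cnorm2 (cmul z w) = cnorm2 z * cnorm2 w.
Proof. unfold cnorm2; simpl; ring. Qed.

Lemma cnorm2_scal a z : cnorm2 (cscal a z) = a * a * cnorm2 z.
Proof. unfold cnorm2; simpl; ring. Qed.

Lemma cnorm2_C0 : cnorm2 C0 = 0.
Proof. unfold cnorm2; simpl; ring. Qed.

Lemma cnorm2_C1 : cnorm2 C1 = 1.
Proof. unfold cnorm2; simpl; ring. Qed.

Lemma cnorm2_add z w : cnorm2 (cadd z w) <= 2 * (cnorm2 z + cnorm2 w).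
Proof.
  unfold cnorm2; simpl.
  assert (h1 := Rle_0_sqr (re z - re w)); assert (h2 := Rle_0_sqr (im z - im w)).
  unfold Rsqr in *; lra.
Qed.

(** Cauchy-Schwarz in C^2 through Lagrange's identity: the defect is a squared modulus. *)
Lemma cnorm2_dot a b x y :
  cnorm2 (cadd (cmul a x) (cmul b y)) <= (cnorm2 a + cnorm2 b) * (cnorm2 x + cnorm2 y).
Proof.
  assert (h := cnorm2_ge0 (csub (cmul a (cconj y)) (cmul b (cconj x)))).
  assert (e : (cnorm2 a + cnorm2 b) * (cnorm2 x + cnorm2 y) - cnorm2 (cadd (cmul a x) (cmul b y))
    = cnorm2 (csub (cmul a (cconj y)) (cmul b (cconj x)))) by (unfold cnorm2; simpl; ring).
  lra.
Qed.

Lemma cmul_eq0 z w : cmul z w = C0 -> z = C0 \/ w = C0.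
Proof.
  intros H. assert (h : cnorm2 z * cnorm2 w = 0) by now rewrite <- cnorm2_mul, H, cnorm2_C0.
  destruct (Rmult_integral _ _ h); [left|right]; now apply cnorm2_eq0.
Qed.

Lemma cmul_neq0 z w : z <> C0 -> w <> C0 -> cmul z w <> C0.
Proof. intros hz hw h; destruct (cmul_eq0 _ _ h); auto. Qed.

Lemma C1_neq0 : C1 <> C0.
Proof. intro H; injection H; lra. Qed.

Lemma cdiv_eq0 z w : w <> C0 -> cdiv z w = C0 -> z = C0.
Proof.
  intros hw h. replace z with (cmul (cdiv z w) w) by (field; auto). rewrite h; ring.
Qed.

(** Half-angle formulas: with [m] the modulus, the squares of the two parts of the root are
    [(m + x) / 2] and [(m - x) / 2], and the sign of [y] decides their relative sign. *)
Lemma csqrt_ex z : exists s, cmul s s = z.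
Proof.
  destruct z as [x y].
  set (m := sqrt (x * x + y * y)).
  assert (hm : m * m = x * x + y * y) by (apply sqrt_sqrt; nra).
  assert (hm0 : 0 <= m) by apply sqrt_pos.
  assert (hx : 0 <= (m + x) / 2 /\ 0 <= (m - x) / 2) by (split; nra).
  destruct hx as [h1 h2].
  set (a := sqrt ((m + x) / 2)). set (b := sqrt ((m - x) / 2)).
  assert (ha : a * a = (m + x) / 2) by (apply sqrt_sqrt; auto).
  assert (hb : b * b = (m - x) / 2) by (apply sqrt_sqrt; auto).
  assert (ha0 : 0 <= a) by apply sqrt_pos.
  assert (hb0 : 0 <= b) by apply sqrt_pos.
  assert (hab : (a * b) * (a * b) = y * y / 4) by (replace (a*b*(a*b)) with ((a*a)*(b*b)) by ring; rewrite ha, hb; nra).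
  assert (0 <= a * b) by nra.
  destruct (Rle_dec 0 y).
  - exists (mkC a b); apply Cx_eq; simpl; nra.
  - exists (mkC a (- b)); apply Cx_eq; simpl; nra.
Qed.

Lemma quadratic_roots (s p : Cx) : exists x y, cadd x y = s /\ cmul x y = p.
Proof.
  destruct (csqrt_ex (csub (cmul s s) (cscal 4 p))) as [d hd].
  assert (h1 := f_equal re hd); assert (h2 := f_equal im hd); simpl in h1, h2.
  exists (cscal (1/2) (cadd s d)), (cscal (1/2) (csub s d)).
  split; apply Cx_eq; simpl; lra.
Qed.

(** * Two-by-two matrices and the Frobenius norm *)

Definition mn (g : mat2) : R := cnorm2 (ma g) + cnorm2 (mb g) + cnorm2 (mc g) + cnorm2 (md g).
Definition mzero : mat2 := mkM C0 C0 C0 C0.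
Definition madd (g h : mat2) : mat2 :=
  mkM (cadd (ma g) (ma h)) (cadd (mb g) (mb h)) (cadd (mc g) (mc h)) (cadd (md g) (md h)).
Definition mscal (z : Cx) (g : mat2) : mat2 :=
  mkM (cmul z (ma g)) (cmul z (mb g)) (cmul z (mc g)) (cmul z (md g)).

Lemma mat2_eq (g h : mat2) :
  ma g = ma h -> mb g = mb h -> mc g = mc h -> md g = md h -> g = h.
Proof. destruct g, h; simpl; intros -> -> -> ->; reflexivity. Qed.

Ltac mring := intros; apply mat2_eq; simpl; ring.

Lemma mmul_assoc f g h : mmul f (mmul g h) = mmul (mmul f g) h.
Proof. mring. Qed.
Lemma mmul_1l g : mmul mI g = g.
Proof. mring. Qed.
Lemma mmul_1r g : mmul g mI = g.
Proof. mring. Qed.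
Lemma minv_mul g h : minv (mmul g h) = mmul (minv h) (minv g).
Proof. mring. Qed.
Lemma minv_minv g : minv (minv g) = g.
Proof. mring. Qed.
Lemma mmul_Vl g : mdet g = C1 -> mmul (minv g) g = mI.
Proof. unfold mdet; intros H; apply mat2_eq; simpl; rewrite <- ?H; ring. Qed.
Lemma mmul_Vr g : mdet g = C1 -> mmul g (minv g) = mI.
Proof. unfold mdet; intros H; apply mat2_eq; simpl; rewrite <- ?H; ring. Qed.
Lemma mdet_mul g h : mdet (mmul g h) = cmul (mdet g) (mdet h).
Proof. unfold mdet; simpl; ring. Qed.
Lemma mdet_inv g : mdet (minv g) = mdet g.
Proof. unfold mdet; simpl; ring. Qed.
Lemma mdet_I : mdet mI = C1.
Proof. unfold mdet; simpl; ring. Qed.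
Lemma mtr_mulC g h : mtr (mmul g h) = mtr (mmul h g).
Proof. unfold mtr; simpl; ring. Qed.
Lemma mdet_mul1 g h : mdet g = C1 -> mdet h = C1 -> mdet (mmul g h) = C1.
Proof. intros hg hh; rewrite mdet_mul, hg, hh; ring. Qed.
Lemma mdet_pow1 g k : mdet g = C1 -> mdet (mpow g k) = C1.
Proof. intros hg; induction k; simpl; [apply mdet_I | apply mdet_mul1; auto]. Qed.

Lemma mn_ge0 g : 0 <= mn g.
Proof.
  unfold mn; assert (h1 := cnorm2_ge0 (ma g)); assert (h2 := cnorm2_ge0 (mb g)).
  assert (h3 := cnorm2_ge0 (mc g)); assert (h4 := cnorm2_ge0 (md g)); lra.
Qed.

Lemma mn_eq0 g : mn g = 0 -> g = mzero.
Proof.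
  intros H; assert (h1 := cnorm2_ge0 (ma g)); assert (h2 := cnorm2_ge0 (mb g)).
  assert (h3 := cnorm2_ge0 (mc g)); assert (h4 := cnorm2_ge0 (md g)).
  unfold mn in H; apply mat2_eq; apply cnorm2_eq0; lra.
Qed.

Lemma mn_gt0 g : g <> mzero -> 0 < mn g.
Proof. intros H; destruct (mn_ge0 g) as [h|h]; auto. exfalso; apply H, mn_eq0; auto. Qed.

Lemma mn_mul g h : mn (mmul g h) <= mn g * mn h.
Proof.
  unfold mn; simpl.
  assert (h1 := cnorm2_dot (ma g) (mb g) (ma h) (mc h)).
  assert (h2 := cnorm2_dot (ma g) (mb g) (mb h) (md h)).
  assert (h3 := cnorm2_dot (mc g) (md g) (ma h) (mc h)).
  assert (h4 := cnorm2_dot (mc g) (md g) (mb h) (md h)).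
  nra.
Qed.

Lemma mn_scal z g : mn (mscal z g) = cnorm2 z * mn g.
Proof. unfold mn; simpl; rewrite !cnorm2_mul; ring. Qed.

Lemma mn_add g h : mn (madd g h) <= 2 * (mn g + mn h).
Proof.
  unfold mn; simpl.
  assert (h1 := cnorm2_add (ma g) (ma h)); assert (h2 := cnorm2_add (mb g) (mb h)).
  assert (h3 := cnorm2_add (mc g) (mc h)); assert (h4 := cnorm2_add (md g) (md h)); lra.
Qed.

(** [mn g - 2] equals |a - conj d|^2 + |b + conj c|^2 once [re (mdet g) = 1]; equality is the case
    of SU(2). *)
Lemma mn_ge2 g : mdet g = C1 -> 2 <= mn g.
Proof.
  intros H; assert (Hr : re (mdet g) = 1) by now rewrite H.
  unfold mn, mdet, cnorm2 in *; simpl in Hr.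
  destruct g as [[a1 a2] [b1 b2] [c1 c2] [d1 d2]]; simpl in *.
  assert (h1 := Rle_0_sqr (a1 - d1)); assert (h2 := Rle_0_sqr (a2 + d2)).
  assert (h3 := Rle_0_sqr (b1 + c1)); assert (h4 := Rle_0_sqr (b2 - c2)).
  unfold Rsqr in *; lra.
Qed.

(** * Commutants, and the traces of [g^k M] as a sequence in [k] *)

Definition scalar_mat (g : mat2) := mb g = C0 /\ mc g = C0 /\ ma g = md g.

(** A nonscalar 2x2 matrix has a cyclic vector, so its commutant consists of the polynomials in it.
    The coefficient [be] is read off at a nonzero off-diagonal entry of [d] or, if [d] is diagonal,
    from its two distinct diagonal entries. *)
Lemma commutant_nonscalar (d x : mat2) :
  ~ scalar_mat d -> mmul d x = mmul x d ->
  exists al be, x = madd (mscal al mI) (mscal be d).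
Proof.
  intros Hd Hc.
  assert (H1 := f_equal ma Hc); assert (H2 := f_equal mb Hc).
  assert (H3 := f_equal mc Hc); simpl in *.
  destruct (classic (mb d = C0)) as [eb|nb].
  - destruct (classic (mc d = C0)) as [ec|nc].
    + assert (na : csub (ma d) (md d) <> C0).
      { intro h; apply Hd; repeat split; auto.
        replace (ma d) with (cadd (csub (ma d) (md d)) (md d)) by ring; rewrite h; ring. }
      rewrite eb, ec in *.
      assert (xb : mb x = C0).
      { destruct (cmul_eq0 (csub (ma d) (md d)) (mb x)); auto; [|tauto].
        transitivity (csub (cadd (cmul (ma d) (mb x)) (cmul C0 (md x)))
           (cadd (cmul (ma x) C0) (cmul (mb x) (md d)))); [ring | rewrite H2; ring]. }
      assert (xc : mc x = C0).
      { destruct (cmul_eq0 (csub (ma d) (md d)) (mc x)); auto; [|tauto].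
        transitivity (csub (cadd (cmul (mc x) (ma d)) (cmul (md x) C0))
           (cadd (cmul C0 (ma x)) (cmul (md d) (mc x)))); [ring | rewrite H3; ring]. }
      set (be := cdiv (csub (ma x) (md x)) (csub (ma d) (md d))).
      exists (csub (ma x) (cmul be (ma d))), be.
      unfold be; apply mat2_eq; simpl; rewrite ?eb, ?ec, ?xb, ?xc; try ring; field; auto.
    + set (be := cdiv (mc x) (mc d)).
      exists (csub (ma x) (cmul be (ma d))), be.
      unfold be; apply mat2_eq; simpl.
      * ring.
      * rewrite eb in *.
        assert (cmul (mb x) (mc d) = C0).
        { transitivity (csub (cadd (cmul (ma x) (ma d)) (cmul (mb x) (mc d))) (cmul (ma d) (ma x))).
          ring. rewrite <- H1; ring. }
        destruct (cmul_eq0 _ _ H) as [e|e]; [rewrite e; ring|tauto].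
      * field; auto.
      * transitivity (cdiv (csub (cadd (cmul (mc x) (ma d)) (cmul (md x) (mc d))) (cmul (mc x) (ma d))) (mc d)).
        field; auto. rewrite <- H3. field; auto.
  - set (be := cdiv (mb x) (mb d)).
    exists (csub (ma x) (cmul be (ma d))), be.
    unfold be; apply mat2_eq; simpl.
    * ring.
    * field; auto.
    * transitivity (cdiv (csub (cadd (cmul (ma d) (ma x)) (cmul (mb d) (mc x))) (cmul (ma d) (ma x))) (mb d)).
      field; auto. rewrite H1; field; auto.
    * transitivity (cdiv (csub (cadd (cmul (ma d) (mb x)) (cmul (mb d) (md x))) (cmul (ma d) (mb x))) (mb d)).
      field; auto. rewrite H2; field; auto.
Qed.

Lemma mpow_add g a b : mpow g (a + b) = mmul (mpow g a) (mpow g b).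
Proof. induction a; simpl; [now rewrite mmul_1l | now rewrite IHa, mmul_assoc]. Qed.

Lemma mpow_comm g a b : mmul (mpow g a) (mpow g b) = mmul (mpow g b) (mpow g a).
Proof. now rewrite <- !mpow_add, Nat.add_comm. Qed.

Lemma mpow_mul g a b : mpow g (a * b) = mpow (mpow g a) b.
Proof.
  induction b; [now rewrite Nat.mul_0_r|].
  rewrite Nat.mul_succ_r, Nat.add_comm, mpow_add, IHb; reflexivity.
Qed.

Lemma comm_minv g x : mdet g = C1 -> mmul g x = mmul x g -> mmul x (minv g) = mmul (minv g) x.
Proof.
  intros hg H.
  transitivity (mmul (mmul (minv g) (mmul g x)) (minv g)).
  - now rewrite mmul_assoc, mmul_Vl, mmul_1l.
  - now rewrite H, <- !mmul_assoc, mmul_Vr, mmul_1r.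
Qed.

(* Two vanishing terms of [k |-> tr (g^k M)] kill the sequence: the powers of [g] all lie in the
   plane spanned by the corresponding two powers. *)
Lemma trace_pow_eventually_neq0 (g M : mat2) (k0 : nat) :
  mdet g = C1 -> (forall k, (1 <= k)%nat -> ~ scalar_mat (mpow g k)) ->
  mtr (mmul (mpow g k0) M) <> C0 ->
  exists L, forall k, (L <= k)%nat -> mtr (mmul (mpow g k) M) <> C0.
Proof.
  intros hg hns h0.
  destruct (classic (exists a, mtr (mmul (mpow g a) M) = C0)) as [[a ha]|hno].
  2: { exists 0%nat; intros k _ hk; apply hno; eauto. }
  exists (S a); intros b hb hz; apply h0.
  assert (hdet := mdet_pow1 g a hg).
  (* [x] is [g^(k0 - a)], written with an inverse because [k0 < a] is possible. *)
  set (x := mmul (mpow g k0) (minv (mpow g a))).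
  assert (hc : mmul (mpow g (b - a)) x = mmul x (mpow g (b - a))).
  { unfold x. rewrite mmul_assoc, mpow_comm, <- !mmul_assoc. f_equal.
    apply comm_minv; auto. apply mpow_comm. }
  destruct (commutant_nonscalar _ _ (hns (b - a)%nat ltac:(lia)) hc) as [al [be hx]].
  assert (hk : mpow g k0 = mmul x (mpow g a)).
  { unfold x; now rewrite <- mmul_assoc, mmul_Vl, mmul_1r. }
  rewrite hk, hx.
  transitivity (cadd (cmul al (mtr (mmul (mpow g a) M)))
                     (cmul be (mtr (mmul (mmul (mpow g (b - a)) (mpow g a)) M)))).
  - unfold mtr; simpl; ring.
  - rewrite <- mpow_add. replace (b - a + a)%nat with b by lia. rewrite ha, hz; ring.
Qed.

Lemma scalar_mul_trace s M : scalar_mat s -> mdet s = C1 ->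
  mtr M <> C0 -> mtr (mmul s M) <> C0.
Proof.
  intros (hb & hc & ha) hd hM h; apply hM.
  assert (hs : cmul (ma s) (ma s) = C1).
  { rewrite <- hd; unfold mdet; rewrite hb, <- ha; ring. }
  transitivity (cmul (ma s) (mtr (mmul s M))).
  - transitivity (cmul C1 (mtr M)); [ring|].
    rewrite <- hs; unfold mtr; simpl; rewrite hb, hc, <- ha; ring.
  - rewrite h; ring.
Qed.

Lemma scalar_mpow s k : scalar_mat s -> scalar_mat (mpow s k).
Proof.
  intros (hb & hc & ha); induction k as [|k (h1 & h2 & h3)]; unfold scalar_mat; simpl.
  - repeat split.
  - rewrite hb, hc, ha, h1, h2, h3; repeat split; ring.
Qed.

(** If some power [g^N] is scalar, its determinant makes it [I] or [-I], so along multiples of [N]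
    the trace changes only by a sign. Otherwise the trace vanishes for at most one exponent,
    [k0 = 0] being a nonzero value. *)
Lemma trace_pow_multiples_neq0 (g M : mat2) : mdet g = C1 -> mtr M <> C0 ->
  exists N L, (1 <= N)%nat /\ forall k, (L <= k)%nat -> mtr (mmul (mpow g (N * k)) M) <> C0.
Proof.
  intros hg hM.
  destruct (classic (exists N, (1 <= N)%nat /\ scalar_mat (mpow g N))) as [[N [hN hs]]|hno].
  - exists N, 0%nat; split; auto; intros k _.
    rewrite mpow_mul; apply scalar_mul_trace; auto.
    + now apply scalar_mpow.
    + now apply mdet_pow1, mdet_pow1.
  - destruct (trace_pow_eventually_neq0 g M 0 hg) as [L hL].
    + intros k hk hs; apply hno; eauto.
    + simpl; now rewrite mmul_1l.
    + exists 1%nat, L; split; auto; intros k hk. rewrite Nat.mul_1_l; auto.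
Qed.

(** * The boundary sphere and elementary subgroups *)

(** The boundary point with homogeneous coordinates [(x : y)]; in these the Moebius action is linear
    and needs no case distinction at infinity. *)
Definition bpt (x y : Cx) : H3bar :=
  if Req_EM_T (cnorm2 y) 0 then Inf else Bd (cdiv x y).

Lemma bpt_inf x : bpt x C0 = Inf.
Proof. unfold bpt; rewrite cnorm2_C0; destruct (Req_EM_T 0 0); tauto. Qed.

Lemma bpt_fin x y : y <> C0 -> bpt x y = Bd (cdiv x y).
Proof.
  intros hy; unfold bpt; destruct (Req_EM_T (cnorm2 y) 0) as [e|]; auto.
  exfalso; apply hy, cnorm2_eq0; auto.
Qed.

Lemma act3bar_bpt g x y : mdet g = C1 -> ~ (x = C0 /\ y = C0) ->
  act3bar g (bpt x y) = bpt (cadd (cmul (ma g) x) (cmul (mb g) y))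
                            (cadd (cmul (mc g) x) (cmul (md g) y)).
Proof.
  intros hg hxy; destruct (classic (y = C0)) as [->|hy].
  - assert (hx : x <> C0) by tauto. rewrite bpt_inf; simpl.
    replace (cadd (cmul (mc g) x) (cmul (md g) C0)) with (cmul (mc g) x) by ring.
    destruct (Req_EM_T (cnorm2 (mc g)) 0) as [e|e].
    + apply cnorm2_eq0 in e; rewrite e.
      replace (cmul C0 x) with C0 by ring. now rewrite bpt_inf.
    + assert (hc : mc g <> C0) by (intro h; apply e; rewrite h; apply cnorm2_C0).
      rewrite bpt_fin by (apply cmul_neq0; auto). f_equal; field; auto.
  - rewrite bpt_fin by auto; unfold act3bar.
    assert (e : cadd (cmul (mc g) (cdiv x y)) (md g) =
                cdiv (cadd (cmul (mc g) x) (cmul (md g) y)) y) by (field; auto).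
    destruct (Req_EM_T _ 0) as [h|h].
    + apply cnorm2_eq0 in h. rewrite e in h. apply cdiv_eq0 in h; auto. now rewrite h, bpt_inf.
    + assert (hw : cadd (cmul (mc g) x) (cmul (md g) y) <> C0).
      { intro h'; apply h; rewrite e, h'. replace (cdiv C0 y) with C0 by (field; auto).
        apply cnorm2_C0. }
      rewrite bpt_fin by auto. rewrite e. f_equal; field; auto.
Qed.

Lemma bpt_eq x y x' y' : ~ (x = C0 /\ y = C0) -> ~ (x' = C0 /\ y' = C0) ->
  cmul x y' = cmul y x' -> bpt x y = bpt x' y'.
Proof.
  intros h h' e; destruct (classic (y = C0)) as [->|hy].
  - assert (hx : x <> C0) by tauto.
    assert (y' = C0) as ->. { destruct (cmul_eq0 x y'); [rewrite e; ring|tauto|auto]. }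
    now rewrite !bpt_inf.
  - assert (hy' : y' <> C0).
    { intros ->. assert (hx : x' <> C0) by tauto.
      destruct (cmul_eq0 y x'); [rewrite <- e; ring|tauto|auto]. }
    rewrite !bpt_fin by auto. f_equal.
    transitivity (cdiv (cmul x y') (cmul y y')); [field; auto|]. rewrite e; field; auto.
Qed.

Lemma mul_vec_neq0 g x y : mdet g = C1 -> ~ (x = C0 /\ y = C0) ->
  ~ (cadd (cmul (ma g) x) (cmul (mb g) y) = C0 /\ cadd (cmul (mc g) x) (cmul (md g) y) = C0).
Proof.
  intros hg hxy [h1 h2]; apply hxy; split.
  - transitivity (cmul (mdet g) x); [rewrite hg; ring|].
    transitivity (csub (cmul (md g) (cadd (cmul (ma g) x) (cmul (mb g) y)))
                       (cmul (mb g) (cadd (cmul (mc g) x) (cmul (md g) y)))).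
    unfold mdet; ring. rewrite h1, h2; ring.
  - transitivity (cmul (mdet g) y); [rewrite hg; ring|].
    transitivity (csub (cmul (ma g) (cadd (cmul (mc g) x) (cmul (md g) y)))
                       (cmul (mc g) (cadd (cmul (ma g) x) (cmul (mb g) y)))).
    unfold mdet; ring. rewrite h1, h2; ring.
Qed.

Lemma validH3bar_bpt x y : validH3bar (bpt x y).
Proof. unfold bpt; destruct (Req_EM_T _ _); exact I. Qed.

Lemma nonzero_column M : M <> mzero -> exists x y, ~ (x = C0 /\ y = C0) /\
  ((x = ma M /\ y = mc M) \/ (x = mb M /\ y = md M)).
Proof.
  intros hM; destruct (classic (ma M = C0 /\ mc M = C0)) as [[h1 h2]|h].
  - exists (mb M), (md M); split; auto; intros [h3 h4]; apply hM, mat2_eq; auto.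
  - exists (ma M), (mc M); auto.
Qed.

Lemma nonzero_row M : M <> mzero -> exists x y, ~ (x = C0 /\ y = C0) /\
  ((x = ma M /\ y = mb M) \/ (x = mc M /\ y = md M)).
Proof.
  intros hM; destruct (classic (ma M = C0 /\ mb M = C0)) as [[h1 h2]|h].
  - exists (mc M), (md M); split; auto; intros [h3 h4]; apply hM, mat2_eq; auto.
  - exists (ma M), (mb M); auto.
Qed.

(** Each [h] carries the column [(x, y)] of [M] into the kernel of [M], which lies in the line of
    [(q, -p)] for a nonzero row [(p, q)]. The orbit of [(x : y)] is thus a single point. *)
Lemma elementary_of_sandwich (H : mat2 -> Prop) M :
  (forall h, H h -> mdet h = C1) -> M <> mzero ->
  (forall h, H h -> mmul M (mmul h M) = mzero) -> elementary H.
Proof.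
  intros hdet hM hz.
  destruct (nonzero_column M hM) as (x & y & hxy & hcol).
  destruct (nonzero_row M hM) as (p & q & hpq & hrow).
  exists (bpt x y); split; [apply validH3bar_bpt|].
  exists (bpt q (copp p) :: nil); intros h hh; left.
  rewrite act3bar_bpt by auto.
  apply bpt_eq.
  - intros [h1 h2]; apply hpq; split; auto.
    replace p with (copp (copp p)) by ring; rewrite h2; ring.
  - apply mul_vec_neq0; auto.
  - assert (e := hz h hh).
    assert (e1 := f_equal ma e); assert (e2 := f_equal mb e).
    assert (e3 := f_equal mc e); assert (e4 := f_equal md e); simpl in *.
    set (X := cadd (cmul (ma h) x) (cmul (mb h) y)).
    set (Y := cadd (cmul (mc h) x) (cmul (md h) y)).
    assert (e0 : cadd (cmul p X) (cmul q Y) = C0).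
    { unfold X, Y; destruct hcol as [[-> ->]|[-> ->]], hrow as [[-> ->]|[-> ->]]; auto. }
    transitivity (csub (cadd (cmul p X) (cmul q Y)) (cmul p X)); [ring|]. rewrite e0; ring.
Qed.

Lemma quadratic_form_zeros (A B C : Cx) : ~ (A = C0 /\ B = C0 /\ C = C0) ->
  exists x y L, ~ (x = C0 /\ y = C0) /\
    cadd (cadd (cmul A (cmul x x)) (cmul B (cmul x y))) (cmul C (cmul y y)) = C0 /\
    forall x' y', ~ (x' = C0 /\ y' = C0) ->
      cadd (cadd (cmul A (cmul x' x')) (cmul B (cmul x' y'))) (cmul C (cmul y' y')) = C0 ->
      In (bpt x' y') L.
Proof.
  intros hne; destruct (classic (A = C0)) as [->|hA].
  (* For [B = C0] the second entry is a junk value of the division; it does no harm, as [Inf] is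
     then the only zero. *)
  - exists C1, C0, (Inf :: Bd (cdiv (copp C) B) :: nil). split; [|split].
    + intros [h _]; apply C1_neq0; auto.
    + ring.
    + intros x y hxy e. destruct (classic (y = C0)) as [->|hy]; [left; now rewrite bpt_inf|].
      assert (e' : cadd (cmul B x) (cmul C y) = C0).
      { destruct (cmul_eq0 y (cadd (cmul B x) (cmul C y))); [|tauto|auto]. rewrite <- e; ring. }
      right; left. rewrite bpt_fin by auto. f_equal.
      destruct (classic (B = C0)) as [->|hB].
      * destruct (cmul_eq0 C y); [|tauto|tauto]. rewrite <- e'; ring.
      * transitivity (cdiv (csub (cmul B x) (cadd (cmul B x) (cmul C y))) (cmul B y)).
        field; auto. rewrite e'; field; auto.
  - destruct (quadratic_roots (cdiv (copp B) A) (cdiv C A)) as (r1 & r2 & hs & hp).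
    assert (fact : forall x y,
      cadd (cadd (cmul A (cmul x x)) (cmul B (cmul x y))) (cmul C (cmul y y)) =
      cmul A (cmul (csub x (cmul r1 y)) (csub x (cmul r2 y)))).
    { intros x y.
      transitivity (cmul A (cadd (csub (cmul x x) (cmul (cdiv (copp B) A) (cmul x y)))
                                 (cmul (cdiv C A) (cmul y y)))).
      field; auto. rewrite <- hs, <- hp; ring. }
    exists r1, C1, (Bd r1 :: Bd r2 :: nil). split; [|split].
    + intros [_ h]; apply C1_neq0; auto.
    + rewrite fact; ring.
    + intros x y hxy e; rewrite fact in e.
      destruct (cmul_eq0 _ _ e) as [|e']; [tauto|].
      assert (key : forall s, csub x (cmul s y) = C0 -> bpt x y = Bd s).
      { intros s es. assert (ex : x = cmul s y).
        { replace x with (cadd (csub x (cmul s y)) (cmul s y)) by ring; rewrite es; ring. }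
        assert (hy : y <> C0). { intros ->; apply hxy; split; auto. rewrite ex; ring. }
        rewrite bpt_fin by auto; f_equal; rewrite ex; field; auto. }
      destruct (cmul_eq0 _ _ e') as [h|h]; apply key in h; rewrite h; simpl; auto.
Qed.

(* The eigenlines of [K] are permuted by the group. *)
Lemma elementary_of_semi_invariant (H : mat2 -> Prop) K :
  (forall h, H h -> mdet h = C1) -> ~ scalar_mat K ->
  (forall h, H h -> exists c, mmul K h = mscal c (mmul h K)) -> elementary H.
Proof.
  intros hdet hK hc.
  (* This form is [det (v, K v)] at [v = (x, y)]: it vanishes exactly on eigenvectors of [K], and
     identically only if [K] is scalar. From [K h = c h K] its value at [h v] is [c * mdet h] times
     its value at [v]. *)
  destruct (quadratic_form_zeros (mc K) (csub (md K) (ma K)) (copp (mb K)))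
    as (x & y & L & hxy & hq & hL).
  { intros (h1 & h2 & h3); apply hK; repeat split; auto.
    - replace (mb K) with (copp (copp (mb K))) by ring; rewrite h3; ring.
    - replace (md K) with (cadd (csub (md K) (ma K)) (ma K)) by ring; rewrite h2; ring. }
  exists (bpt x y); split; [apply validH3bar_bpt|].
  exists L; intros h hh. rewrite act3bar_bpt by auto.
  apply hL; [apply mul_vec_neq0; auto|].
  destruct (hc h hh) as [c e].
  assert (e1 := f_equal ma e); assert (e2 := f_equal mb e).
  assert (e3 := f_equal mc e); assert (e4 := f_equal md e); simpl in *.
  set (X := cadd (cmul (ma h) x) (cmul (mb h) y)).
  set (Y := cadd (cmul (mc h) x) (cmul (md h) y)).
  transitivity (csub (cmul X (cadd (cmul (cadd (cmul (mc K) (ma h)) (cmul (md K) (mc h))) x)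
                                   (cmul (cadd (cmul (mc K) (mb h)) (cmul (md K) (md h))) y)))
                     (cmul Y (cadd (cmul (cadd (cmul (ma K) (ma h)) (cmul (mb K) (mc h))) x)
                                   (cmul (cadd (cmul (ma K) (mb h)) (cmul (mb K) (md h))) y)))).
  { unfold X, Y; ring. }
  rewrite e1, e2, e3, e4.
  transitivity (cmul (cmul c (mdet h))
     (cadd (cadd (cmul (mc K) (cmul x x)) (cmul (csub (md K) (ma K)) (cmul x y)))
           (cmul (copp (mb K)) (cmul y y)))).
  { unfold X, Y, mdet; ring. }
  rewrite hq; ring.
Qed.

(** * Eigenvalues *)

(** The eigenvalues with the dominant one first, provided [mdet g = C1]; since the definition sees
    only the trace, it is invariant under conjugation. *)
Definition eigen_pair (g : mat2) (lam mu : Cx) :=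
  cmul lam mu = C1 /\ cadd lam mu = mtr g /\ 1 <= cnorm2 lam.

Lemma eigen_pair_ex g : exists lam mu, eigen_pair g lam mu.
Proof.
  destruct (quadratic_roots (mtr g) C1) as (x & y & hs & hp).
  assert (e : cnorm2 x * cnorm2 y = 1) by (rewrite <- cnorm2_mul, hp; apply cnorm2_C1).
  assert (hx := cnorm2_ge0 x); assert (hy := cnorm2_ge0 y).
  destruct (Rle_dec 1 (cnorm2 x)).
  - exists x, y; repeat split; auto.
  - exists y, x; repeat split; [rewrite <- hp; ring | rewrite <- hs; ring | nra].
Qed.

Lemma eigen_pair_norm g lam mu : eigen_pair g lam mu -> cnorm2 lam * cnorm2 mu = 1.
Proof. intros (h & _); rewrite <- cnorm2_mul, h; apply cnorm2_C1. Qed.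

(** Modulus one forces [mu] to be the conjugate of [lam], and the trace [2 re lam] lies in [-2, 2].
    Conversely a real trace makes [mu] the conjugate of [lam], hence of modulus one, or makes both
    real; two reals of product 1 and sum at most 2 in absolute value coincide. *)
Lemma loxodromic_eigen g lam mu : eigen_pair g lam mu -> (loxodromic g <-> 1 < cnorm2 lam).
Proof.
  intros (hp & hs & h1).
  assert (p1 := f_equal re hp); assert (p2 := f_equal im hp); simpl in p1, p2.
  unfold loxodromic; rewrite <- hs; unfold cnorm2 in *.
  destruct lam as [x y], mu as [u v]; simpl in *. split.
  - intros hl; destruct h1 as [h1|h1]; auto. exfalso; apply hl.
    assert (a1 : x * (x * u - y * v) = x * 1) by (now rewrite p1).
    assert (a2 : y * (x * v + y * u) = 0) by (rewrite p2; ring).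
    assert (a3 : u * (x * x + y * y) = u) by (rewrite <- h1; ring).
    assert (a4 : y * (x * u - y * v) = y * 1) by (now rewrite p1).
    assert (a5 : x * (x * v + y * u) = 0) by (rewrite p2; ring).
    assert (a6 : v * (x * x + y * y) = v) by (rewrite <- h1; ring).
    assert (u = x) by lra. assert (v = - y) by lra. subst; split; [ring|].
    apply Rabs_le; nra.
  - intros hl [h2 h3].
    assert (v = - y) by lra; subst v.
    apply Rabs_le_between in h3. assert (hy : y * (u - x) = 0) by nra.
    destruct (Rmult_integral _ _ hy) as [-> | hu].
    + assert (hxu : x * u = 1) by lra.
      assert (b1 : (x + u) * (x + u) <= 4) by nra.
      assert (b2 : (x - u) * (x - u) <= 0) by lra.
      assert (b3 : x - u = 0) by nra. assert (u = x) by lra; subst; lra.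
    + assert (u = x) by lra; subst; nra.
Qed.

(** By Cayley-Hamilton [(g - lam)(g - mu) = 0], so a nonzero column of [g - mu] is an eigenvector
    for [lam]. If [g = mu I], the trace gives [lam = mu] and any vector will do. *)
Lemma eigenvector_ex g lam mu : mdet g = cmul lam mu -> mtr g = cadd lam mu ->
  exists x y, ~ (x = C0 /\ y = C0) /\
    cadd (cmul (ma g) x) (cmul (mb g) y) = cmul lam x /\
    cadd (cmul (mc g) x) (cmul (md g) y) = cmul lam y.
Proof.
  intros hd ht.
  assert (hm : mu = csub (mtr g) lam) by (rewrite ht; ring).
  set (M := madd g (mscal (copp mu) mI)).
  destruct (classic (M = mzero)) as [e|e].
  - assert (e1 := f_equal ma e); assert (e2 := f_equal mb e).
    assert (e3 := f_equal mc e); assert (e4 := f_equal md e); unfold M, mtr in *; simpl in *.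
    exists C1, C0; split; [intros [h _]; apply C1_neq0; auto|]. split.
    + replace (ma g) with (cadd (csub mu (cadd (md g) (cmul (copp mu) C1))) (csub (cadd (ma g) (md g)) (cadd mu mu))) by ring.
      rewrite e4, ht; ring.
    + replace (mc g) with (cadd (mc g) (cmul (copp mu) C0)) by ring. rewrite e3; ring.
  - destruct (nonzero_column M e) as (x & y & hxy & hc).
    exists x, y; split; auto.
    assert (hz : cmul lam (csub (mtr g) lam) = mdet g) by (rewrite hd, hm; auto).
    assert (CH : cadd (csub (cmul lam lam) (cmul (mtr g) lam)) (mdet g) = C0) by (rewrite <- hz; ring).
    unfold M in hc; simpl in hc; rewrite hm in hc.
    unfold mtr, mdet in *.
    destruct hc as [[-> ->]|[-> ->]]; split.
    + transitivity (csub (cmul lam (cadd (ma g) (cmul (copp (csub (cadd (ma g) (md g)) lam)) C1)))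
        (cadd (csub (cmul lam lam) (cmul (cadd (ma g) (md g)) lam)) (csub (cmul (ma g) (md g)) (cmul (mb g) (mc g)))));
      [ring | rewrite CH; ring].
    + ring.
    + ring.
    + transitivity (csub (cmul lam (cadd (md g) (cmul (copp (csub (cadd (ma g) (md g)) lam)) C1)))
        (cadd (csub (cmul lam lam) (cmul (cadd (ma g) (md g)) lam)) (csub (cmul (ma g) (md g)) (cmul (mb g) (mc g)))));
      [ring | rewrite CH; ring].
Qed.

Fixpoint cpow (z : Cx) (k : nat) : Cx := match k with O => C1 | S k' => cmul z (cpow z k') end.

Lemma cnorm2_pow z k : cnorm2 (cpow z k) = cnorm2 z ^ k.
Proof. induction k; simpl; [apply cnorm2_C1 | rewrite cnorm2_mul, IHk; auto]. Qed.

Lemma eigenvector_pow g lam x y k :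
  cadd (cmul (ma g) x) (cmul (mb g) y) = cmul lam x ->
  cadd (cmul (mc g) x) (cmul (md g) y) = cmul lam y ->
  cadd (cmul (ma (mpow g k)) x) (cmul (mb (mpow g k)) y) = cmul (cpow lam k) x /\
  cadd (cmul (mc (mpow g k)) x) (cmul (md (mpow g k)) y) = cmul (cpow lam k) y.
Proof.
  intros h1 h2; induction k as [|k [i1 i2]]; simpl; [split; ring|]. split.
  - transitivity (cadd (cmul (ma g) (cadd (cmul (ma (mpow g k)) x) (cmul (mb (mpow g k)) y)))
                       (cmul (mb g) (cadd (cmul (mc (mpow g k)) x) (cmul (md (mpow g k)) y)))); [ring|].
    rewrite i1, i2. transitivity (cmul (cpow lam k) (cadd (cmul (ma g) x) (cmul (mb g) y))); [ring|].
    rewrite h1; ring.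
  - transitivity (cadd (cmul (mc g) (cadd (cmul (ma (mpow g k)) x) (cmul (mb (mpow g k)) y)))
                       (cmul (md g) (cadd (cmul (mc (mpow g k)) x) (cmul (md (mpow g k)) y)))); [ring|].
    rewrite i1, i2. transitivity (cmul (cpow lam k) (cadd (cmul (mc g) x) (cmul (md g) y))); [ring|].
    rewrite h2; ring.
Qed.

Lemma eigenvalue_le_mn g lam x y : ~ (x = C0 /\ y = C0) ->
  cadd (cmul (ma g) x) (cmul (mb g) y) = cmul lam x ->
  cadd (cmul (mc g) x) (cmul (md g) y) = cmul lam y -> cnorm2 lam <= mn g.
Proof.
  intros hxy h1 h2.
  assert (i1 := cnorm2_dot (ma g) (mb g) x y). assert (i2 := cnorm2_dot (mc g) (md g) x y).
  rewrite h1, cnorm2_mul in i1. rewrite h2, cnorm2_mul in i2.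
  assert (hx := cnorm2_ge0 x); assert (hy := cnorm2_ge0 y).
  assert (0 < cnorm2 x + cnorm2 y).
  { destruct (classic (x = C0)) as [->|h].
    - assert (0 < cnorm2 y) by (apply cnorm2_gt0; tauto). lra.
    - assert (0 < cnorm2 x) by (apply cnorm2_gt0; tauto). lra. }
  unfold mn. apply Rmult_le_reg_r with (cnorm2 x + cnorm2 y); auto. nra.
Qed.

Lemma eigen_pow_le_mn g lam mu k : mdet g = C1 -> eigen_pair g lam mu ->
  cnorm2 lam ^ k <= mn (mpow g k).
Proof.
  intros hg (hp & hs & _).
  destruct (eigenvector_ex g lam mu) as (x & y & hxy & h1 & h2); [congruence|congruence|].
  destruct (eigenvector_pow g lam x y k h1 h2) as [i1 i2].
  rewrite <- cnorm2_pow. eapply eigenvalue_le_mn; eauto.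
Qed.

(** A scalar power must be [lam^k I], and its determinant [lam^(2k)] would have modulus one. *)
Lemma loxodromic_pow_nonscalar g k : mdet g = C1 -> loxodromic g -> (1 <= k)%nat ->
  ~ scalar_mat (mpow g k).
Proof.
  intros hg hl hk (hb & hc & ha).
  destruct (eigen_pair_ex g) as (lam & mu & he).
  apply (loxodromic_eigen g lam mu he) in hl. destruct he as (hp & hs & _).
  destruct (eigenvector_ex g lam mu) as (x & y & hxy & h1 & h2); [congruence|congruence|].
  destruct (eigenvector_pow g lam x y k h1 h2) as [i1 i2].
  rewrite hb in i1; rewrite hc, <- ha in i2.
  assert (e : ma (mpow g k) = cpow lam k).
  { assert (j1 : cmul (csub (ma (mpow g k)) (cpow lam k)) x = C0)
      by (transitivity (csub (cadd (cmul (ma (mpow g k)) x) (cmul C0 y)) (cmul (cpow lam k) x)); [ring|rewrite i1; ring]).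
    assert (j2 : cmul (csub (ma (mpow g k)) (cpow lam k)) y = C0)
      by (transitivity (csub (cadd (cmul C0 x) (cmul (ma (mpow g k)) y)) (cmul (cpow lam k) y)); [ring|rewrite i2; ring]).
    destruct (cmul_eq0 _ _ j1) as [h|hx]; [|destruct (cmul_eq0 _ _ j2) as [h|hy]; [|tauto]];
    replace (ma (mpow g k)) with (cadd (csub (ma (mpow g k)) (cpow lam k)) (cpow lam k)) by ring;
    rewrite h; ring. }
  assert (hd := mdet_pow1 g k hg). unfold mdet in hd. rewrite hb, <- ha, e in hd.
  assert (n1 : cnorm2 (cpow lam k) * cnorm2 (cpow lam k) = 1).
  { rewrite <- cnorm2_mul, <- cnorm2_C1, <- hd. f_equal; ring. }
  rewrite cnorm2_pow in n1.
  assert (1 < cnorm2 lam ^ k) by (apply Rlt_pow_R1; auto; lia).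
  nra.
Qed.

Lemma cnorm2_add_le a b A B : 0 <= A -> 0 <= B -> cnorm2 a <= A * A -> cnorm2 b <= B * B ->
  cnorm2 (cadd a b) <= (A + B) * (A + B).
Proof.
  intros hA hB ha hb.
  set (d := re a * re b + im a * im b).
  assert (hd : d * d <= (A * B) * (A * B)).
  { apply Rle_trans with (cnorm2 a * cnorm2 b).
    - unfold d, cnorm2. assert (h := Rle_0_sqr (re a * im b - im a * re b)). unfold Rsqr in h. lra.
    - replace (A * B * (A * B)) with (A * A * (B * B)) by ring.
      apply Rmult_le_compat; auto using cnorm2_ge0. }
  assert (d <= A * B).
  { destruct (Rle_dec d (A * B)); auto. exfalso.
    assert (0 <= A * B) by nra. nra. }
  replace (cnorm2 (cadd a b)) with (cnorm2 a + cnorm2 b + 2 * d) by (unfold cnorm2, d; simpl; ring).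
  lra.
Qed.

(* [g^k = lam^k I + s_k (g - lam I)] with [s_(k+1) = lam^k + mu s_k]. *)
Lemma mn_pow_le g lam mu : mdet g = C1 -> eigen_pair g lam mu ->
  exists C, 1 <= C /\ forall k, mn (mpow g k) <= C * ((INR k + 1) * (INR k + 1)) * cnorm2 lam ^ k.
Proof.
  intros hg he. assert (hn := eigen_pair_norm _ _ _ he). destruct he as (hp & hs & h1).
  set (l := sqrt (cnorm2 lam)).
  assert (hl : l * l = cnorm2 lam) by (apply sqrt_sqrt; lra).
  assert (hl0 : 0 <= l) by apply sqrt_pos.
  set (E := madd g (mscal (copp lam) mI)).
  assert (hE : mmul g E = mscal mu E).
  { assert (hmu : mu = csub (mtr g) lam) by (rewrite <- hs; ring).
    assert (CH : cadd (csub (cmul lam lam) (cmul (mtr g) lam)) (mdet g) = C0).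
    { rewrite <- hs, hg, <- hp; ring. }
    rewrite hmu. unfold E, mtr, mdet in *. apply mat2_eq; simpl; try ring.
    - transitivity (csub (cmul (csub (cadd (ma g) (md g)) lam) (cadd (ma g) (cmul (copp lam) C1)))
        (cadd (csub (cmul lam lam) (cmul (cadd (ma g) (md g)) lam))
              (csub (cmul (ma g) (md g)) (cmul (mb g) (mc g))))); [ring | rewrite CH; ring].
    - transitivity (csub (cmul (csub (cadd (ma g) (md g)) lam) (cadd (md g) (cmul (copp lam) C1)))
        (cadd (csub (cmul lam lam) (cmul (cadd (ma g) (md g)) lam))
              (csub (cmul (ma g) (md g)) (cmul (mb g) (mc g))))); [ring | rewrite CH; ring]. }
  (* The factor [INR k] is genuine when [lam = mu], where [s_k = k lam^(k-1)]; it will cost only a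
     logarithm of [k]. The induction uses |mu| <= 1 <= [l]. *)
  assert (key : forall k, exists s, mpow g k = madd (mscal (cpow lam k) mI) (mscal s E) /\
                  cnorm2 s <= (INR k * l ^ k) * (INR k * l ^ k)).
  { induction k as [|k (s & e & hk)].
    - exists C0; split; [mring|]. rewrite cnorm2_C0; simpl; lra.
    - exists (cadd (cpow lam k) (cmul mu s)); split.
      + simpl; rewrite e.
        transitivity (madd (mscal (cpow lam k) (madd (mscal lam mI) E)) (mscal s (mmul g E))).
        * unfold E; mring.
        * rewrite hE; mring.
      + rewrite S_INR.
        assert (hlk : 0 <= l ^ k) by (apply pow_le; auto).
        assert (hle : 1 <= l) by nra.
        assert (hk0 := pos_INR k).
        apply Rle_trans with ((l ^ k + INR k * l ^ k) * (l ^ k + INR k * l ^ k)).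
        * apply cnorm2_add_le; [auto | nra | | ].
          -- rewrite cnorm2_pow, <- hl, Rpow_mult_distr; lra.
          -- rewrite cnorm2_mul. assert (cnorm2 mu <= 1).
             { assert (hm := cnorm2_ge0 mu); nra. }
             assert (0 <= cnorm2 s) by apply cnorm2_ge0.
             assert (hm := cnorm2_ge0 mu). nra.
        * simpl. assert (hq : l ^ k <= l * l ^ k) by nra.
          assert (h5 : (INR k + 1) * l ^ k <= (INR k + 1) * (l * l ^ k))
            by (apply Rmult_le_compat_l; lra).
          assert (h6 : 0 <= (INR k + 1) * l ^ k) by (apply Rmult_le_pos; lra).
          replace (l ^ k + INR k * l ^ k) with ((INR k + 1) * l ^ k) by ring.
          apply Rmult_le_compat; auto. }
  (* [mn_add] contributes a factor 2 to both terms, and [mn mI = 2]. *)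
  exists (4 + 2 * mn E); split; [assert (h := mn_ge0 E); lra|].
  intros k; destruct (key k) as (s & e & hk). rewrite e.
  eapply Rle_trans; [apply mn_add|]. rewrite !mn_scal.
  assert (mn mI = 2) as -> by (unfold mn; simpl; rewrite !cnorm2_C0, !cnorm2_C1; ring).
  rewrite cnorm2_pow.
  replace (INR k * l ^ k * (INR k * l ^ k)) with (INR k * INR k * cnorm2 lam ^ k) in hk
    by (rewrite <- hl, Rpow_mult_distr; ring).
  set (P := cnorm2 lam ^ k) in *.
  assert (hP : 0 <= P) by (apply pow_le; lra).
  assert (hk0 := pos_INR k). assert (hmE := mn_ge0 E).
  assert (h3 : cnorm2 s * mn E <= INR k * INR k * P * mn E) by (apply Rmult_le_compat_r; auto).
  assert (h4 : INR k * INR k * P <= (INR k + 1) * (INR k + 1) * P) by (apply Rmult_le_compat_r; nra).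
  assert (h5 : P <= (INR k + 1) * (INR k + 1) * P) by nra.
  assert (h6 : INR k * INR k * P * mn E <= (INR k + 1) * (INR k + 1) * P * mn E)
    by (apply Rmult_le_compat_r; auto).
  nra.
Qed.

(** * Hyperbolic distance *)

Lemma exp_pair x : 0 < exp x /\ 0 < exp (- x) /\ exp x * exp (- x) = 1.
Proof.
  repeat split; try apply exp_pos. rewrite <- exp_plus, Rplus_opp_r; apply exp_0.
Qed.

Lemma exp_le x y : x <= y -> exp x <= exp y.
Proof. intros [h| ->]; [left; now apply exp_increasing | lra]. Qed.

Lemma cosh_acosh u : 1 <= u -> cosh (acosh u) = u.
Proof.
  intros hu; unfold cosh, acosh.
  assert (hs : sqrt (u * u - 1) * sqrt (u * u - 1) = u * u - 1) by (apply sqrt_sqrt; nra).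
  set (s := sqrt (u * u - 1)) in *.
  assert (hs0 : 0 <= s) by apply sqrt_pos.
  rewrite exp_Ropp, exp_ln by lra.
  replace (/ (u + s)) with (u - s); [field|].
  apply Rmult_eq_reg_l with (u + s); [|lra]. rewrite Rinv_r by lra. lra.
Qed.

Lemma acosh_ge0 u : 1 <= u -> 0 <= acosh u.
Proof.
  intros hu; unfold acosh. rewrite <- ln_1.
  assert (hs0 : 0 <= sqrt (u * u - 1)) by apply sqrt_pos.
  apply ln_le; lra.
Qed.

Lemma cosh_lt x y : 0 <= x -> x < y -> cosh x < cosh y.
Proof.
  intros hx hxy; unfold cosh.
  destruct (exp_pair x) as (a1 & a2 & a3), (exp_pair y) as (b1 & b2 & b3).
  assert (h1 : exp x < exp y) by now apply exp_increasing.
  assert (h2 : 1 <= exp x) by (rewrite <- exp_0; apply exp_le; auto).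
  set (X := exp x) in *; set (Y := exp y) in *; set (X' := exp (-x)) in *; set (Y' := exp (-y)) in *.
  (* Hence [2 (cosh y - cosh x) = (Y - X) (1 - X' Y')], a product of positive factors. *)
  assert (h3 : X' - Y' = (Y - X) * (X' * Y')).
  { transitivity (X' * (Y * Y') - Y' * (X * X')); [rewrite a3, b3; ring | ring]. }
  assert (h4 : X' <= 1) by nra. assert (h5 : Y' < 1) by nra.
  assert (h6 : X' * Y' < 1) by nra.
  nra.
Qed.

Lemma cosh_le_inv x y : 0 <= x -> 0 <= y -> cosh x <= cosh y -> x <= y.
Proof.
  intros hx hy h; destruct (Rle_dec x y); auto. exfalso.
  assert (cosh y < cosh x) by (apply cosh_lt; lra). lra.
Qed.

Lemma cosh_inj x y : 0 <= x -> 0 <= y -> cosh x = cosh y -> x = y.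
Proof. intros; apply Rle_antisym; apply cosh_le_inv; lra. Qed.

Lemma cosh_opp x : cosh (- x) = cosh x.
Proof. unfold cosh; rewrite Ropp_involutive; lra. Qed.

Lemma cosh_sub x y : cosh (x - y) = cosh x * cosh y - sinh x * sinh y.
Proof.
  unfold cosh, sinh. replace (- (x - y)) with (- x + y) by ring.
  unfold Rminus at 1; rewrite !exp_plus; field.
Qed.

Lemma cosh2_sinh2 x : cosh x * cosh x = 1 + sinh x * sinh x.
Proof. unfold cosh, sinh; destruct (exp_pair x) as (_ & _ & h). nra. Qed.

Lemma sinh_ge0 x : 0 <= x -> 0 <= sinh x.
Proof.
  intros hx; unfold sinh. assert (exp (- x) <= exp x) by (apply exp_le; lra). lra.
Qed.

Lemma sinh_gt0 x : 0 < x -> 0 < sinh x.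
Proof.
  intros hx; unfold sinh. assert (exp (- x) < exp x) by (apply exp_increasing; lra). lra.
Qed.

(** Turns smallness of [cosh] of a distance minus one into smallness of the distance. It comes from
    [cosh x - 1 = 2 sinh^2 (x/2)] and the crude [y/2 <= sinh y]; the sharp constant would be 2. *)
Lemma sqr_le_cosh x : 0 <= x -> x * x <= 8 * (cosh x - 1).
Proof.
  intros hx. set (y := x / 2).
  assert (hs : y / 2 <= sinh y).
  { unfold sinh. destruct (exp_pair y) as (a1 & a2 & a3).
    assert (hy : 0 <= y) by (unfold y; lra).
    assert (h1 : 1 + y <= exp y) by apply exp_ineq1_le.
    assert (exp (-y) <= 1) by nra. lra. }
  assert (hc : cosh x - 1 = 2 * (sinh y * sinh y)).
  { replace x with (y - - y) by (unfold y; field). rewrite cosh_sub, cosh_opp, cosh2_sinh2.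
    replace (sinh (- y)) with (- sinh y) by (unfold sinh; rewrite Ropp_involutive; field). ring. }
  rewrite hc. assert (0 <= y) by (unfold y; lra). replace x with (2 * y) by (unfold y; field). nra.
Qed.

Definition o3 : H3pt := (C0, 1).

(** The hyperbolic cosine of the distance, as a rational function. Distances are computed through
    it, [cosh] being injective on nonnegative reals. *)
Definition hB (p q : H3pt) : R :=
  (cnorm2 (csub (fst p) (fst q)) + snd p * snd p + snd q * snd q) / (2 * snd p * snd q).

Lemma hB_sym p q : inH3 p -> inH3 q -> hB p q = hB q p.
Proof. unfold inH3, hB, cnorm2; simpl; intros; field; lra. Qed.

Lemma d3_hB p q : inH3 p -> inH3 q -> d3 p q = acosh (hB p q) /\ 1 <= hB p q.
Proof.
  unfold inH3; intros hp hq.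
  assert (e : 1 + (cnorm2 (csub (fst p) (fst q)) + (snd p - snd q) * (snd p - snd q))
                    / (2 * snd p * snd q) = hB p q) by (unfold hB; field; lra).
  unfold d3; rewrite e; split; auto; rewrite <- e.
  assert (h := cnorm2_ge0 (csub (fst p) (fst q))).
  assert (0 <= (cnorm2 (csub (fst p) (fst q)) + (snd p - snd q) * (snd p - snd q))
                    / (2 * snd p * snd q)); [|lra].
  assert (h1 := Rle_0_sqr (snd p - snd q)); unfold Rsqr in h1.
  apply Rmult_le_pos; [lra|]. left; apply Rinv_0_lt_compat; nra.
Qed.

Lemma cosh_d3 p q : inH3 p -> inH3 q -> cosh (d3 p q) = hB p q.
Proof. intros hp hq; destruct (d3_hB p q hp hq) as [-> h]; now apply cosh_acosh. Qed.

Lemma d3_ge0 p q : inH3 p -> inH3 q -> 0 <= d3 p q.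
Proof. intros hp hq; destruct (d3_hB p q hp hq) as [-> h]; now apply acosh_ge0. Qed.

Lemma d3_eq_of_cosh p q x : inH3 p -> inH3 q -> 0 <= x -> hB p q = cosh x -> d3 p q = x.
Proof. intros; apply cosh_inj; auto using d3_ge0. now rewrite cosh_d3. Qed.

Lemma d3_sym p q : inH3 p -> inH3 q -> d3 p q = d3 q p.
Proof. intros hp hq; apply d3_eq_of_cosh; auto using d3_ge0. now rewrite cosh_d3, hB_sym. Qed.

Lemma hB_eq1 p q : inH3 p -> inH3 q -> hB p q <= 1 -> p = q.
Proof.
  unfold inH3, hB; intros hp hq h.
  assert (h0 := cnorm2_ge0 (csub (fst p) (fst q))).
  assert (h1 : cnorm2 (csub (fst p) (fst q)) + snd p * snd p + snd q * snd q <= 2 * snd p * snd q).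
  { apply Rmult_le_reg_r with (/ (2 * snd p * snd q)).
    - apply Rinv_0_lt_compat; nra.
    - rewrite Rinv_r by nra. exact h. }
  assert (h2 : snd p = snd q) by nra.
  assert (h3 : cnorm2 (csub (fst p) (fst q)) = 0) by nra.
  apply cnorm2_eq0 in h3. destruct p as [z t], q as [z' t']; simpl in *; subst; f_equal.
  replace z with (cadd (csub z z') z') by ring; rewrite h3; ring.
Qed.

(* Polar coordinates at the base point: in the hyperboloid model [p] is
   [(pch p; pe1 p, pe2 p, pe3 p)], and the hyperbolic plane [im z = 0] is [pe3 = 0]. *)
Definition pch (p : H3pt) := (cnorm2 (fst p) + snd p * snd p + 1) / (2 * snd p).
Definition pe1 (p : H3pt) := (cnorm2 (fst p) + snd p * snd p - 1) / (2 * snd p).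
Definition pe2 (p : H3pt) := re (fst p) / snd p.
Definition pe3 (p : H3pt) := im (fst p) / snd p.

Lemma pch_sq p : inH3 p -> pch p * pch p = 1 + (pe1 p * pe1 p + pe2 p * pe2 p + pe3 p * pe3 p).
Proof. unfold inH3, pch, pe1, pe2, pe3, cnorm2; intros; field; lra. Qed.

Lemma hB_polar p q : inH3 p -> inH3 q ->
  hB p q = pch p * pch q - (pe1 p * pe1 q + pe2 p * pe2 q + pe3 p * pe3 q).
Proof. unfold inH3, hB, pch, pe1, pe2, pe3, cnorm2; simpl; intros; field; lra. Qed.

Lemma inH3_o3 : inH3 o3.
Proof. unfold inH3, o3; simpl; lra. Qed.

Lemma hB_o3 p : inH3 p -> hB o3 p = pch p.
Proof. unfold inH3, hB, pch, o3, cnorm2; simpl; intros; field; lra. Qed.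

Lemma cosh_d3_o3 p : inH3 p -> cosh (d3 o3 p) = pch p.
Proof. intros; rewrite cosh_d3, hB_o3; auto using inH3_o3. Qed.

Lemma sinh_d3_o3 p : inH3 p ->
  sinh (d3 o3 p) * sinh (d3 o3 p) = pe1 p * pe1 p + pe2 p * pe2 p + pe3 p * pe3 p.
Proof.
  intros hp; assert (h := cosh2_sinh2 (d3 o3 p)). rewrite cosh_d3_o3, pch_sq in h by auto. lra.
Qed.

Lemma cosh_d3_polar p q : inH3 p -> inH3 q ->
  cosh (d3 p q) = cosh (d3 o3 p) * cosh (d3 o3 q) - (pe1 p * pe1 q + pe2 p * pe2 q + pe3 p * pe3 q).
Proof. intros; rewrite cosh_d3, hB_polar, !cosh_d3_o3; auto. Qed.

Lemma dot3_le a1 a2 a3 b1 b2 b3 x y : 0 <= x -> 0 <= y ->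
  x * x = a1 * a1 + a2 * a2 + a3 * a3 -> y * y = b1 * b1 + b2 * b2 + b3 * b3 ->
  a1 * b1 + a2 * b2 + a3 * b3 <= x * y.
Proof.
  intros hx hy ex ey. set (d := a1 * b1 + a2 * b2 + a3 * b3).
  assert (h : d * d <= (x * y) * (x * y)).
  { replace (x * y * (x * y)) with ((x * x) * (y * y)) by ring. rewrite ex, ey; unfold d.
    assert (h1 := Rle_0_sqr (a1 * b2 - a2 * b1)); assert (h2 := Rle_0_sqr (a1 * b3 - a3 * b1)).
    assert (h3 := Rle_0_sqr (a2 * b3 - a3 * b2)); unfold Rsqr in *; lra. }
  destruct (Rle_dec d (x * y)); auto. exfalso. assert (0 <= x * y) by nra. nra.
Qed.

(** The hyperbolic law of cosines at the base point, with Cauchy-Schwarz for the two directions,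
    gives [cosh (c - a) <= cosh (d3 p q)] for the radii [a] of [p] and [c] of [q]. *)
Lemma d3_triangle_o3 p q : inH3 p -> inH3 q -> d3 o3 q <= d3 o3 p + d3 p q.
Proof.
  intros hp hq.
  assert (ha := d3_ge0 o3 p inH3_o3 hp). assert (hc := d3_ge0 o3 q inH3_o3 hq).
  assert (hb := d3_ge0 p q hp hq).
  destruct (Rle_dec (d3 o3 q) (d3 o3 p)); [lra|].
  cut (d3 o3 q - d3 o3 p <= d3 p q); [lra|].
  apply cosh_le_inv; auto; [lra|].
  rewrite cosh_sub, (cosh_d3_polar p q) by auto.
  assert (h := dot3_le (pe1 p) (pe2 p) (pe3 p) (pe1 q) (pe2 q) (pe3 q)
    (sinh (d3 o3 p)) (sinh (d3 o3 q)) (sinh_ge0 _ ha) (sinh_ge0 _ hc)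
    (sinh_d3_o3 p hp) (sinh_d3_o3 q hq)). lra.
Qed.

Lemma d3_o3_diff p q : inH3 p -> inH3 q -> Rabs (d3 o3 p - d3 o3 q) <= d3 p q.
Proof.
  intros hp hq; apply Rabs_le.
  assert (h1 := d3_triangle_o3 p q hp hq). assert (h2 := d3_triangle_o3 q p hq hp).
  rewrite (d3_sym q p) in h2 by auto. lra.
Qed.

(* Equality in the triangle inequality: [p] lies on the segment from the base point to [q]. *)
Lemma d3_between_o3 p q : inH3 p -> inH3 q -> d3 o3 p + d3 p q = d3 o3 q ->
  let s := sinh (d3 o3 p) in let s' := sinh (d3 o3 q) in
  s' * pe1 p = s * pe1 q /\ s' * pe2 p = s * pe2 q /\ s' * pe3 p = s * pe3 q.
Proof.
  intros hp hq e s s'.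
  assert (h := cosh_d3_polar p q hp hq).
  replace (d3 p q) with (d3 o3 q - d3 o3 p) in h by lra.
  rewrite cosh_sub in h.
  assert (h1 := sinh_d3_o3 p hp). assert (h2 := sinh_d3_o3 q hq).
  fold s in h, h1. fold s' in h, h2.
  assert (hd : pe1 p * pe1 q + pe2 p * pe2 q + pe3 p * pe3 q = s * s') by lra.
  (* Equality case of Cauchy-Schwarz: this vector has squared length zero. *)
  set (x1 := s' * pe1 p - s * pe1 q). set (x2 := s' * pe2 p - s * pe2 q).
  set (x3 := s' * pe3 p - s * pe3 q).
  assert (z : x1 * x1 + x2 * x2 + x3 * x3 = 0).
  { transitivity (s' * s' * (pe1 p * pe1 p + pe2 p * pe2 p + pe3 p * pe3 p)
      + s * s * (pe1 q * pe1 q + pe2 q * pe2 q + pe3 q * pe3 q)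
      - 2 * s * s' * (pe1 p * pe1 q + pe2 p * pe2 q + pe3 p * pe3 q)).
    - unfold x1, x2, x3; ring.
    - rewrite hd, <- h1, <- h2; ring. }
  assert (x1 = 0 /\ x2 = 0 /\ x3 = 0) as (z1 & z2 & z3) by (repeat split; nra).
  unfold x1, x2, x3 in *; repeat split; lra.
Qed.

(** Inverse of the coordinates [pe1], [pe2], [pe3]: since [pch p - pe1 p = 1 / snd p], the number
    [w] is the inverse height. *)
Definition polar_pt (e1 e2 e3 : R) : H3pt :=
  let w := sqrt (1 + (e1 * e1 + e2 * e2 + e3 * e3)) - e1 in (mkC (e2 / w) (e3 / w), 1 / w).

Lemma polar_pt_spec e1 e2 e3 :
  let p := polar_pt e1 e2 e3 in inH3 p /\ pe1 p = e1 /\ pe2 p = e2 /\ pe3 p = e3.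
Proof.
  intros p; unfold p, polar_pt, inH3, pe1, pe2, pe3, cnorm2; simpl.
  set (c := sqrt (1 + (e1 * e1 + e2 * e2 + e3 * e3))).
  assert (hc : c * c = 1 + (e1 * e1 + e2 * e2 + e3 * e3)) by (apply sqrt_sqrt; nra).
  assert (hc0 : 0 <= c) by apply sqrt_pos.
  assert (hw : 0 < c - e1) by nra.
  assert (hn : c - e1 <> 0) by lra.
  repeat split.
  - apply Rdiv_lt_0_compat; lra.
  - apply Rmult_eq_reg_r with (2 * / (c - e1)).
    2: { apply Rmult_integral_contrapositive; split; [lra | now apply Rinv_neq_0_compat]. }
    transitivity ((e2 * e2 + e3 * e3 + 1) / ((c - e1) * (c - e1)) - 1); [field; auto|].
    replace (e2 * e2 + e3 * e3 + 1) with ((c - e1) * (c + e1)) by lra. field; auto.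
  - field; auto.
  - field; auto.
Qed.

Lemma polar_pt_0 : polar_pt 0 0 0 = o3.
Proof.
  unfold polar_pt, o3. replace (1 + (0 * 0 + 0 * 0 + 0 * 0)) with 1 by ring.
  rewrite sqrt_1. f_equal; [apply Cx_eq; simpl; field | field].
Qed.

Lemma d3_o3_of_polar p x : inH3 p -> 0 <= x ->
  pe1 p * pe1 p + pe2 p * pe2 p + pe3 p * pe3 p = sinh x * sinh x -> d3 o3 p = x.
Proof.
  intros hp hx e; apply d3_eq_of_cosh; auto using inH3_o3.
  rewrite hB_o3 by auto.
  assert (h := pch_sq p hp). rewrite e, <- cosh2_sinh2 in h.
  assert (0 < pch p).
  { unfold pch, inH3 in *. assert (h0 := cnorm2_ge0 (fst p)).
    apply Rdiv_lt_0_compat; nra. }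
  assert (0 < cosh x) by (unfold cosh; destruct (exp_pair x); lra). nra.
Qed.

(** * The action on hyperbolic space *)

(** [hA g], [hY g], [hD g] are the entries of [g g^+], where [g^+] is the conjugate transpose. This
    is the model of H^3 by positive Hermitian matrices of determinant one, with [g g^+] standing for
    the image of the base point under [g]. *)
Definition hA (g : mat2) := cnorm2 (ma g) + cnorm2 (mb g).
Definition hD (g : mat2) := cnorm2 (mc g) + cnorm2 (md g).
Definition hY (g : mat2) := cadd (cmul (ma g) (cconj (mc g))) (cmul (mb g) (cconj (md g))).

Lemma hermitian_det g : mdet g = C1 -> hA g * hD g - cnorm2 (hY g) = 1.
Proof.
  intros h; transitivity (cnorm2 (mdet g)).
  - unfold hA, hD, hY, mdet, cnorm2; simpl; ring.
  - rewrite h; apply cnorm2_C1.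
Qed.

Lemma hD_gt0 g : mdet g = C1 -> 0 < hD g.
Proof.
  intros h; assert (e := hermitian_det g h).
  assert (h1 := cnorm2_ge0 (hY g)). assert (0 <= hD g).
  { unfold hD; assert (i := cnorm2_ge0 (mc g)); assert (j := cnorm2_ge0 (md g)); lra. }
  assert (0 <= hA g).
  { unfold hA; assert (i := cnorm2_ge0 (ma g)); assert (j := cnorm2_ge0 (mb g)); lra. }
  nra.
Qed.

Lemma act3_o3 g : act3 g o3 = (cscal (/ hD g) (hY g), / hD g).
Proof.
  unfold act3, o3, hY, hD; simpl.
  replace (cadd (cmul (mc g) C0) (md g)) with (md g) by ring.
  replace (cadd (cmul (ma g) C0) (mb g)) with (mb g) by ring.
  replace (cnorm2 (md g) + cnorm2 (mc g) * (1 * 1)) with (cnorm2 (mc g) + cnorm2 (md g)) by ring.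
  f_equal; [|unfold Rdiv; ring]. f_equal. apply Cx_eq; simpl; ring.
Qed.

Lemma inH3_act3_o3 g : mdet g = C1 -> inH3 (act3 g o3).
Proof. intros h; rewrite act3_o3; unfold inH3; simpl; apply Rinv_0_lt_compat, hD_gt0; auto. Qed.

(** Both sides are half the trace of the inverse of [g g^+] times [h h^+]; the middle expression of
    the proof is this trace in coordinates. *)
Lemma hB_act3_o3 g h : mdet g = C1 -> mdet h = C1 ->
  hB (act3 g o3) (act3 h o3) = mn (mmul (minv g) h) / 2.
Proof.
  intros hg hh.
  assert (e1 := hermitian_det g hg); assert (e2 := hermitian_det h hh).
  assert (p1 := hD_gt0 g hg); assert (p2 := hD_gt0 h hh).
  transitivity ((hA g * hD h + hA h * hD g
     - 2 * (re (hY g) * re (hY h) + im (hY g) * im (hY h))) / 2).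
  - rewrite !act3_o3; unfold hB.
    destruct (hY g) as [y1 y2], (hY h) as [z1 z2]; unfold cnorm2 in *; simpl in *.
    replace (hA g) with ((1 + (y1 * y1 + y2 * y2)) / hD g) by (rewrite <- e1; field; lra).
    replace (hA h) with ((1 + (z1 * z1 + z2 * z2)) / hD h) by (rewrite <- e2; field; lra).
    field; lra.
  - f_equal. unfold hA, hD, hY, mn, minv, cnorm2; simpl; ring.
Qed.

Lemma act3_surj p : inH3 p -> exists k, mdet k = C1 /\ act3 k o3 = p.
Proof.
  destruct p as [z t]; unfold inH3; simpl; intros ht.
  set (s := sqrt t). assert (hs : s * s = t) by (apply sqrt_sqrt; lra).
  assert (hs0 : 0 < s) by (apply sqrt_lt_R0; auto).
  exists (mkM (mkC s 0) (cscal (/ s) z) C0 (mkC (/ s) 0)). split.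
  - apply Cx_eq; unfold mdet; simpl; field; lra.
  - rewrite act3_o3; unfold hD, hY, cnorm2; simpl. f_equal.
    + apply Cx_eq; simpl; field; lra.
    + rewrite <- hs; field; lra.
Qed.

(** Composition, checked at the points [h o3], which by [act3_surj] are all points. The determinant
    relation eliminates [hA h], after which the identity is rational in [hD h] and [hY h]. *)
Lemma act3_mul_o3 g h : mdet g = C1 -> mdet h = C1 ->
  act3 g (act3 h o3) = act3 (mmul g h) o3.
Proof.
  intros hg hh.
  assert (hgh := mdet_mul1 g h hg hh).
  assert (e := hermitian_det h hh). assert (p := hD_gt0 h hh).
  assert (p' := hD_gt0 _ hgh).
  set (A := hA h) in *. set (D := hD h) in *.
  destruct (hY h) as [y1 y2] eqn:eY. unfold cnorm2 in e; simpl in e.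
  assert (eA : A = (1 + (y1 * y1 + y2 * y2)) / D) by (rewrite <- e; field; lra).
  set (c := mc g) in *. set (d := md g) in *. set (a := ma g). set (b := mb g).
  assert (ey1 := f_equal re eY); assert (ey2 := f_equal im eY); unfold hY in ey1, ey2; simpl in ey1, ey2.
  assert (eD : hD (mmul g h) = cnorm2 c * A + cnorm2 d * D
     + 2 * (re (cmul c (cconj d)) * y1 - im (cmul c (cconj d)) * y2)).
  { rewrite <- ey1, <- ey2. unfold A, D, hA, hD, cnorm2, c, d; simpl; ring. }
  assert (eYY : hY (mmul g h) = cadd (cadd (cscal A (cmul a (cconj c))) (cscal D (cmul b (cconj d))))
     (cadd (cmul (cmul a (cconj d)) (mkC y1 y2)) (cmul (cmul b (cconj c)) (mkC y1 (- y2))))).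
  { rewrite <- ey1, <- ey2. unfold A, D, hA, hD, hY, cnorm2, a, b, c, d; apply Cx_eq; simpl; ring. }
  rewrite (act3_o3 (mmul g h)), (act3_o3 h). unfold act3; cbv zeta. fold D c d a b.
  rewrite eY; simpl fst; simpl snd.
  assert (eDD : cnorm2 (cadd (cmul c (cscal (/ D) (mkC y1 y2))) d) + cnorm2 c * (/ D * / D)
     = hD (mmul g h) / D).
  { rewrite eD, eA. unfold cnorm2; simpl; field; lra. }
  rewrite eDD. f_equal; [|field; lra].
  rewrite eYY. rewrite eA.
  apply Cx_eq; simpl; field; lra.
Qed.

Lemma mdet_conj k g : mdet k = C1 -> mdet g = C1 -> mdet (mmul (minv k) (mmul g k)) = C1.
Proof. intros; apply mdet_mul1; [rewrite mdet_inv; auto | now apply mdet_mul1]. Qed.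

Lemma hB_displacement k g : mdet k = C1 -> mdet g = C1 ->
  hB (act3 k o3) (act3 g (act3 k o3)) = mn (mmul (minv k) (mmul g k)) / 2.
Proof. intros; rewrite act3_mul_o3, hB_act3_o3; auto using mdet_mul1. Qed.

Lemma inH3_act3 g p : mdet g = C1 -> inH3 p -> inH3 (act3 g p).
Proof.
  intros hg hp; destruct (act3_surj p hp) as (k & hk & <-).
  rewrite act3_mul_o3; auto using inH3_act3_o3, mdet_mul1.
Qed.

Definition cartan (g : mat2) : R := d3 o3 (act3 g o3).

Lemma cosh_cartan g : mdet g = C1 -> cosh (cartan g) = mn g / 2.
Proof.
  intros hg; unfold cartan; rewrite cosh_d3 by (auto using inH3_o3, inH3_act3_o3).
  replace o3 with (act3 mI o3) at 1.
  - rewrite hB_act3_o3; auto using mdet_I. f_equal; f_equal. mring.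
  - rewrite act3_o3; unfold hD, hY, o3, cnorm2; simpl; f_equal; [apply Cx_eq; simpl|]; field.
Qed.

Lemma cartan_ge0 g : mdet g = C1 -> 0 <= cartan g.
Proof. intros; apply d3_ge0; auto using inH3_o3, inH3_act3_o3. Qed.

(** From [exp c <= 2 cosh c <= 2 exp c] for nonnegative [c]. *)
Lemma cartan_bounds g : mdet g = C1 -> ln (mn g) - ln 2 <= cartan g <= ln (mn g).
Proof.
  intros hg; assert (h := cosh_cartan g hg). assert (h2 := mn_ge2 g hg).
  assert (h0 := cartan_ge0 g hg).
  unfold cosh in h. destruct (exp_pair (cartan g)) as (a1 & a2 & a3).
  assert (exp (- cartan g) <= exp (cartan g)) by (apply exp_le; lra).
  split.
  - rewrite <- ln_div by lra. rewrite <- (ln_exp (cartan g)) at 1. apply ln_le; lra.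
  - rewrite <- (ln_exp (cartan g)) at 1. apply ln_le; lra.
Qed.

(** * Translation lengths *)

(** The algebraic translation length, twice the logarithm of the spectral radius; for nonloxodromic
    [g] it is 0, in agreement with the convention of [transl_length]. *)
Definition is_len (g : mat2) (l : R) :=
  exists lam mu, eigen_pair g lam mu /\ l = ln (cnorm2 lam).

Lemma is_len_ex g : exists l, is_len g l.
Proof. destruct (eigen_pair_ex g) as (lam & mu & h); exists (ln (cnorm2 lam)), lam, mu; auto. Qed.

Lemma mtr_conj k g : mdet k = C1 -> mtr (mmul (minv k) (mmul g k)) = mtr g.
Proof. intros h; now rewrite mtr_mulC, <- mmul_assoc, mmul_Vr, mmul_1r. Qed.

(* Schur: a unitary conjugation makes [g] triangular without changing its norm. *)
Lemma mn_ge_eigen g lam mu : mdet g = C1 -> eigen_pair g lam mu -> cnorm2 lam + cnorm2 mu <= mn g.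
Proof.
  intros hg (hp & hs & _).
  destruct (eigenvector_ex g lam mu) as (x & y & hxy & h1 & h2); [congruence|congruence|].
  (* The second column is orthogonal to the eigenvector, so [h] is unitary up to the factor
     [sqrt N], and [minv h] is its conjugate transpose. Carrying the powers of [N] along avoids
     normalising. *)
  set (h := mkM x (copp (cconj y)) y (cconj x)).
  set (N := cnorm2 x + cnorm2 y).
  assert (hN : 0 < N).
  { unfold N; destruct (classic (x = C0)) as [->|hx].
    - assert (0 < cnorm2 y) by (apply cnorm2_gt0; tauto). rewrite cnorm2_C0; lra.
    - assert (0 < cnorm2 x) by (apply cnorm2_gt0; auto). assert (i := cnorm2_ge0 y). lra. }
  assert (left : forall M, mn (mmul (minv h) M) = N * mn M).
  { intros; unfold N, h, mn, cnorm2; simpl; ring. }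
  assert (right : forall M, mn (mmul M h) = N * mn M).
  { intros; unfold N, h, mn, cnorm2; simpl; ring. }
  set (T := mmul (minv h) (mmul g h)).
  assert (eN : mn T = N * (N * mn g)) by (unfold T; now rewrite left, right).
  assert (ea : ma T = cmul lam (mkC N 0)).
  { transitivity (cadd (cmul (cconj x) (cadd (cmul (ma g) x) (cmul (mb g) y)))
                       (cmul (cconj y) (cadd (cmul (mc g) x) (cmul (md g) y)))).
    - unfold T, h; simpl; ring.
    - rewrite h1, h2. unfold N, cnorm2; apply Cx_eq; simpl; ring. }
  assert (et : cadd (ma T) (md T) = cmul (mtr g) (mkC N 0)).
  { unfold T, h, N, mtr, cnorm2; apply Cx_eq; simpl; ring. }
  assert (ed : md T = cmul mu (mkC N 0)).
  { replace (md T) with (csub (cadd (ma T) (md T)) (ma T)) by ring.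
    rewrite et, ea, <- hs; ring. }
  assert (i : cnorm2 (ma T) + cnorm2 (md T) <= mn T).
  { unfold mn; assert (j1 := cnorm2_ge0 (mb T)); assert (j2 := cnorm2_ge0 (mc T)); lra. }
  rewrite ea, ed, !cnorm2_mul, eN in i.
  replace (cnorm2 (mkC N 0)) with (N * N) in i by (unfold cnorm2; simpl; ring).
  assert (0 < N * N) by nra. apply Rmult_le_reg_r with (N * N); auto. lra.
Qed.

(** The columns of [k] are eigenvectors for [lam] and [mu], independent because the eigenvalues
    differ in modulus; dividing the second by [dl] makes the determinant one. *)
Lemma loxodromic_diag g lam mu : mdet g = C1 -> eigen_pair g lam mu -> 1 < cnorm2 lam ->
  exists k, mdet k = C1 /\ mmul (minv k) (mmul g k) = mkM lam C0 C0 mu.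
Proof.
  intros hg he hl. assert (hn := eigen_pair_norm _ _ _ he). destruct he as (hp & hs & _).
  destruct (eigenvector_ex g lam mu) as (x & y & hxy & h1 & h2); [congruence|congruence|].
  destruct (eigenvector_ex g mu lam) as (x' & y' & hxy' & h1' & h2').
  { rewrite hg, <- hp; ring. } { rewrite <- hs; ring. }
  assert (hne : csub mu lam <> C0).
  { intros e; assert (mu = lam) by (replace mu with (cadd (csub mu lam) lam) by ring; rewrite e; ring).
    subst; nra. }
  set (dl := csub (cmul x y') (cmul x' y)).
  assert (hd : dl <> C0).
  { intros e. assert (e' : cmul x y' = cmul x' y)
      by (replace (cmul x y') with (cadd dl (cmul x' y)) by (unfold dl; ring); rewrite e; ring).
    assert (z1 : cmul (csub mu lam) (cmul x x') = C0).
    { transitivity (csub (cmul x (cmul mu x')) (cmul x' (cmul lam x))); [ring|].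
      rewrite <- h1, <- h1'.
      transitivity (cmul (mb g) (csub (cmul x y') (cmul x' y))); [ring|]. rewrite e'; ring. }
    assert (z2 : cmul (csub mu lam) (cmul x y') = C0).
    { transitivity (csub (cmul x (cmul mu y')) (cmul lam (cmul x y'))); [ring|].
      rewrite e'. transitivity (csub (cmul x (cmul mu y')) (cmul x' (cmul lam y))); [ring|].
      rewrite <- h2, <- h2'.
      transitivity (cmul (md g) (csub (cmul x y') (cmul x' y))); [ring|]. rewrite e'; ring. }
    assert (z3 : cmul (csub mu lam) (cmul y y') = C0).
    { transitivity (csub (cmul y (cmul mu y')) (cmul y' (cmul lam y))); [ring|].
      rewrite <- h2, <- h2'.
      transitivity (cmul (mc g) (csub (cmul x' y) (cmul x y'))); [ring|]. rewrite e'; ring. }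
    apply cmul_eq0 in z1, z2, z3.
    destruct z1 as [|z1]; [tauto|]. destruct z2 as [|z2]; [tauto|]. destruct z3 as [|z3]; [tauto|].
    apply cmul_eq0 in z1, z2, z3.
    assert (z4 : x' = C0 \/ y = C0) by (apply cmul_eq0; rewrite <- e'; destruct z2 as [-> | ->]; ring).
    tauto. }
  exists (mkM x (cdiv x' dl) y (cdiv y' dl)). split.
  - unfold mdet; simpl. transitivity (cdiv dl dl); [unfold dl at 3; field; auto | field; auto].
  - set (k := mkM x (cdiv x' dl) y (cdiv y' dl)).
    assert (hk : mdet k = C1).
    { unfold mdet; simpl. transitivity (cdiv dl dl); [unfold dl at 3; field; auto | field; auto]. }
    transitivity (mmul (minv k) (mmul k (mkM lam C0 C0 mu))).
    + f_equal. unfold k; apply mat2_eq; simpl.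
      * rewrite h1; ring.
      * transitivity (cdiv (cadd (cmul (ma g) x') (cmul (mb g) y')) dl); [field; auto|].
        rewrite h1'; field; auto.
      * rewrite h2; ring.
      * transitivity (cdiv (cadd (cmul (mc g) x') (cmul (md g) y')) dl); [field; auto|].
        rewrite h2'; field; auto.
    + now rewrite mmul_assoc, mmul_Vl, mmul_1l.
Qed.

Lemma cosh_ln u : 0 < u -> cosh (ln u) = (u + / u) / 2.
Proof. intros; unfold cosh; rewrite exp_Ropp, exp_ln; auto. Qed.

(** At the point [k o3] the displacement has hyperbolic cosine half of [mn] of the conjugate by [k].
    The Schur bound [mn_ge_eigen] bounds this from below for every [k], and a diagonalising [k]
    attains the bound. *)
Lemma is_len_transl_length g l : mdet g = C1 -> is_len g l -> transl_length g l.
Proof.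
  intros hg (lam & mu & he & ->).
  assert (hn := eigen_pair_norm _ _ _ he). assert (h1 := proj2 (proj2 he)).
  assert (hmu : cnorm2 mu = / cnorm2 lam).
  { apply Rmult_eq_reg_l with (cnorm2 lam); [|lra]. rewrite Rinv_r; lra. }
  assert (hl0 : 0 <= ln (cnorm2 lam)) by (rewrite <- ln_1; apply ln_le; lra).
  assert (hlox := loxodromic_eigen g lam mu he).
  destruct (classic (loxodromic g)) as [hl|hl].
  - left; split; auto. apply hlox in hl. split.
    + intros x (p & hp & ->). destruct (act3_surj p hp) as (k & hk & <-).
      apply cosh_le_inv; auto.
      * apply d3_ge0; auto using inH3_act3.
      * rewrite cosh_d3 by (auto using inH3_act3).
        rewrite hB_displacement, cosh_ln by (auto; lra). rewrite <- hmu.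
        cut (cnorm2 lam + cnorm2 mu <= mn (mmul (minv k) (mmul g k))); [lra|].
        apply mn_ge_eigen; [now apply mdet_conj|].
        destruct he as (e1 & e2 & e3); repeat split; auto. now rewrite mtr_conj.
    + intros l' hl'. destruct (loxodromic_diag g lam mu hg he hl) as (k & hk & ek).
      apply hl'. exists (act3 k o3); split; [now apply inH3_act3_o3|].
      symmetry; apply d3_eq_of_cosh; auto using inH3_act3, inH3_act3_o3.
      rewrite hB_displacement, cosh_ln by (auto; lra). rewrite ek, <- hmu.
      unfold mn; simpl; rewrite !cnorm2_C0; field.
  - right; split; auto. replace (cnorm2 lam) with 1; [apply ln_1|].
    destruct h1; auto. exfalso; tauto.
Qed.

Lemma transl_length_is_len g l : mdet g = C1 -> transl_length g l -> is_len g l.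
Proof.
  intros hg h. destruct (is_len_ex g) as [l' hl'].
  assert (h' := is_len_transl_length g l' hg hl').
  replace l with l'; auto.
  destruct h as [[a [b1 b2]]|[a b]], h' as [[a' [b1' b2']]|[a' b']]; try tauto; [|congruence].
  apply Rle_antisym; auto.
Qed.

Lemma is_len_ge0 g l : is_len g l -> 0 <= l.
Proof. intros (lam & mu & (_ & _ & h) & ->). rewrite <- ln_1; apply ln_le; lra. Qed.

Lemma is_len_gt0 g l : loxodromic g -> is_len g l -> 0 < l.
Proof.
  intros hl (lam & mu & he & ->). apply (loxodromic_eigen _ _ _ he) in hl.
  rewrite <- ln_1; apply ln_increasing; lra.
Qed.

Lemma is_len_le_mn g l : mdet g = C1 -> is_len g l -> l <= ln (mn g).
Proof.
  intros hg (lam & mu & he & ->). assert (h := mn_ge_eigen g lam mu hg he).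
  assert (h0 := cnorm2_ge0 mu). destruct he as (_ & _ & h1). apply ln_le; lra.
Qed.

(** |tr g| <= |lam| + |mu| <= 2 |lam|, whence the [ln 4] for squared moduli. *)
Lemma is_len_ge_trace g l : is_len g l -> mtr g <> C0 -> ln (cnorm2 (mtr g)) - ln 4 <= l.
Proof.
  intros (lam & mu & he & ->) ht. assert (hn := eigen_pair_norm _ _ _ he).
  assert (h0 := cnorm2_ge0 mu). destruct he as (_ & hs & h1). assert (h2 := cnorm2_gt0 _ ht).
  rewrite <- ln_div by lra. apply ln_le; [lra|].
  rewrite <- hs in *. assert (h := cnorm2_add lam mu). nra.
Qed.

Lemma is_len_pow_lower g l k : mdet g = C1 -> is_len g l -> INR k * l <= ln (mn (mpow g k)).
Proof.
  intros hg (lam & mu & he & ->). assert (h := eigen_pow_le_mn g lam mu k hg he).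
  destruct he as (_ & _ & h1). rewrite <- ln_pow by lra.
  apply ln_le; auto. apply pow_lt; lra.
Qed.

(** A quantitative spectral radius formula: [eps] absorbs the logarithm of the quadratic factor in
    [mn_pow_le]. *)
Lemma is_len_pow_upper g l eps : mdet g = C1 -> is_len g l -> 0 < eps ->
  exists C, forall k, ln (mn (mpow g k)) <= INR k * l + eps * INR k + C.
Proof.
  intros hg (lam & mu & he & ->) heps.
  destruct (mn_pow_le g lam mu hg he) as (C & hC & hk).
  destruct he as (_ & _ & h1).
  (* [d <= 1] gives [d (k + 1) <= 1 + d k <= exp (d k)], and [2 d <= eps] pays for the square of
     [k + 1]. *)
  set (d := Rmin 1 (eps / 2)).
  assert (hd : 0 < d) by (apply Rmin_glb_lt; lra).
  assert (hd1 : d <= 1) by apply Rmin_l. assert (hd2 : d <= eps / 2) by apply Rmin_r.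
  exists (ln C - 2 * ln d); intros k.
  assert (hk0 := pos_INR k).
  assert (hP : 0 < cnorm2 lam ^ k) by (apply pow_lt; lra).
  eapply Rle_trans.
  - apply ln_le; [|apply hk]. assert (h := mn_ge2 _ (mdet_pow1 g k hg)); lra.
  - rewrite ln_mult, ln_mult, ln_mult, ln_pow by (try nra; apply Rmult_lt_0_compat; nra).
    assert (hl : ln (INR k + 1) <= d * INR k - ln d).
    { rewrite <- (ln_exp (d * INR k)), <- ln_div by (auto using exp_pos).
      apply ln_le; [lra|]. assert (h := exp_ineq1_le (d * INR k)).
      apply Rmult_le_reg_r with d; auto.
      unfold Rdiv; rewrite Rmult_assoc, Rinv_l by lra. nra. }
    nra.
Qed.

(** * Compactness *)

Lemma choice_nat {A : Type} (P : nat -> A -> Prop) :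
  (forall k, exists a, P k a) -> exists f, forall k, P k (f k).
Proof.
  intros h; exists (fun k => proj1_sig (constructive_indefinite_description _ (h k))).
  intros k; apply proj2_sig.
Qed.

Lemma bounded_subseq (u : nat -> R) (B : R) : (forall k, Rabs (u k) <= B) ->
  exists phi (l : R), (forall k, (phi k < phi (S k))%nat) /\ is_lim_seq (fun k => u (phi k)) l.
Proof.
  intros hB.
  destruct (Bolzano_Weierstrass u (fun x => -B <= x <= B)) as [l hl].
  { apply compact_P3. } { intros k; apply Rabs_le_between; auto. }
  assert (hex : forall k N : nat, exists p, (N <= p)%nat /\ Rabs (u p - l) < / (INR k + 1)).
  { intros k N.
    assert (hpos : 0 < / (INR k + 1)) by (apply Rinv_0_lt_compat; assert (h := pos_INR k); lra).
    destruct (hl (disc l (mkposreal _ hpos)) N) as (p & hp & hd).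
    - exists (mkposreal _ hpos); intros x hx; exact hx.
    - exists p; split; auto. }
  destruct (choice_nat (fun k (f : nat -> nat) =>
     forall N, (N <= f N)%nat /\ Rabs (u (f N) - l) < / (INR k + 1))) as [psi hpsi].
  { intros k; destruct (choice_nat _ (hex k)) as [f hf]; exists f; auto. }
  (* Each new index is sought strictly beyond the previous one, and the [k]-th term lies within
     [/ (INR k + 1)] of [l]. *)
  set (phi := fix phi k := match k with O => psi O O | S k' => psi (S k') (S (phi k')) end).
  exists phi, l; split.
  - intros k. destruct (hpsi (S k) (S (phi k))) as [h _].
    change (phi (S k)) with (psi (S k) (S (phi k))). lia.
  - assert (hk : forall k, Rabs (u (phi k) - l) < / (INR k + 1)).
    { intros [|k]; [apply (hpsi O O) | apply (hpsi (S k) (S (phi k)))]. }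
    apply is_lim_seq_spec; intros [e he]; simpl.
    destruct (archimed_cor1 e he) as (N & hN & hN0).
    exists N; intros k hle. eapply Rlt_le_trans; [apply hk|].
    left; eapply Rle_lt_trans; [|apply hN]. apply Rinv_le_contravar; [now apply lt_0_INR|].
    apply le_INR in hle; lra.
Qed.

Lemma bounded_subseq_fam (m : nat) (u : nat -> nat -> R) (B : R) :
  (forall i k, (i < m)%nat -> Rabs (u i k) <= B) ->
  exists phi (l : nat -> R), (forall k, (phi k < phi (S k))%nat) /\
    forall i, (i < m)%nat -> is_lim_seq (fun k => u i (phi k)) (l i).
Proof.
  induction m as [|m IH]; intros hB.
  - exists (fun k => k), (fun _ => 0); split; intros; lia.
  - destruct IH as (phi & l & hphi & hl); [intros; apply hB; lia|].
    destruct (bounded_subseq (fun k => u m (phi k)) B) as (psi & lm & hpsi & hlm).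
    { intros; apply hB; lia. }
    exists (fun k => phi (psi k)), (fun i => if Nat.eq_dec i m then lm else l i). split.
    + intros k. assert (mono : forall a b, (a < b)%nat -> (phi a < phi b)%nat).
      { intros a b hab; induction hab; [auto|]. eapply Nat.lt_trans; eauto. }
      apply mono, hpsi.
    + intros i hi; destruct (Nat.eq_dec i m) as [->|ne]; auto.
      apply (is_lim_seq_subseq (fun k => u i (phi k)) (l i) psi).
      * now apply eventually_subseq.
      * apply hl; lia.
Qed.

Definition ccv (z : nat -> Cx) (w : Cx) :=
  is_lim_seq (fun k => re (z k)) (re w) /\ is_lim_seq (fun k => im (z k)) (im w).

Lemma ccv_add z w a b : ccv z a -> ccv w b -> ccv (fun k => cadd (z k) (w k)) (cadd a b).
Proof. intros [h1 h2] [h3 h4]; split; apply (is_lim_seq_plus' _ _ _ _); auto. Qed.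

Lemma ccv_opp z a : ccv z a -> ccv (fun k => copp (z k)) (copp a).
Proof.
  intros [h1 h2]; split; [apply (is_lim_seq_opp _ (re a)) | apply (is_lim_seq_opp _ (im a))]; auto.
Qed.

Lemma ccv_mul z w a b : ccv z a -> ccv w b -> ccv (fun k => cmul (z k) (w k)) (cmul a b).
Proof.
  intros [h1 h2] [h3 h4]; split; simpl.
  - apply is_lim_seq_minus'; apply is_lim_seq_mult'; auto.
  - apply is_lim_seq_plus'; apply is_lim_seq_mult'; auto.
Qed.

Lemma ccv_norm2 z a : ccv z a -> is_lim_seq (fun k => cnorm2 (z k)) (cnorm2 a).
Proof. intros [h1 h2]; apply is_lim_seq_plus'; apply is_lim_seq_mult'; auto. Qed.

Definition mcv (M : nat -> mat2) (L : mat2) :=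
  ccv (fun k => ma (M k)) (ma L) /\ ccv (fun k => mb (M k)) (mb L) /\
  ccv (fun k => mc (M k)) (mc L) /\ ccv (fun k => md (M k)) (md L).

Lemma mcv_const g : mcv (fun _ => g) g.
Proof. repeat split; apply is_lim_seq_const. Qed.

Lemma mcv_mul M N A B : mcv M A -> mcv N B -> mcv (fun k => mmul (M k) (N k)) (mmul A B).
Proof.
  intros (h1 & h2 & h3 & h4) (k1 & k2 & k3 & k4).
  split; [|split; [|split]]; apply ccv_add; apply ccv_mul; auto.
Qed.

Lemma mcv_tr M A : mcv M A -> ccv (fun k => mtr (M k)) (mtr A).
Proof. intros (h1 & h2 & h3 & h4); now apply ccv_add. Qed.

Lemma mcv_det M A : mcv M A -> ccv (fun k => mdet (M k)) (mdet A).
Proof.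
  intros (h1 & h2 & h3 & h4); apply ccv_add; [|apply ccv_opp]; apply ccv_mul; auto.
Qed.

Lemma mcv_mn M A : mcv M A -> is_lim_seq (fun k => mn (M k)) (mn A).
Proof.
  intros (h1 & h2 & h3 & h4); unfold mn.
  repeat (apply is_lim_seq_plus'; [|now apply ccv_norm2]). now apply ccv_norm2.
Qed.

Lemma is_lim_seq_eq (u : nat -> R) (a b : R) : is_lim_seq u a -> is_lim_seq u b -> a = b.
Proof.
  intros h1 h2. apply is_lim_seq_unique in h1, h2. congruence.
Qed.

Lemma ccv_unique z a b : ccv z a -> ccv z b -> a = b.
Proof. intros [h1 h2] [h3 h4]; apply Cx_eq; eapply is_lim_seq_eq; eauto. Qed.

(** Eight real coordinates, so that [n] matrices become [8 * n] real sequences with index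
    [8 * i + c] and one extraction serves them all. *)
Definition coord (c : nat) (M : mat2) : R :=
  match c with
  | 0 => re (ma M) | 1 => im (ma M) | 2 => re (mb M) | 3 => im (mb M)
  | 4 => re (mc M) | 5 => im (mc M) | 6 => re (md M) | _ => im (md M)
  end%nat.

Lemma coord_le c M : coord c M * coord c M <= mn M.
Proof.
  unfold mn, cnorm2.
  assert (h1 := Rle_0_sqr (re (ma M))); assert (h2 := Rle_0_sqr (im (ma M))).
  assert (h3 := Rle_0_sqr (re (mb M))); assert (h4 := Rle_0_sqr (im (mb M))).
  assert (h5 := Rle_0_sqr (re (mc M))); assert (h6 := Rle_0_sqr (im (mc M))).
  assert (h7 := Rle_0_sqr (re (md M))); assert (h8 := Rle_0_sqr (im (md M))).
  unfold Rsqr in *. unfold coord; do 7 (destruct c; [lra|]); lra.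
Qed.

Lemma mat2_subseq_fam (n : nat) (M : nat -> nat -> mat2) (B : R) :
  (forall i k, (i < n)%nat -> mn (M i k) <= B) ->
  exists phi (L : nat -> mat2), (forall k, (phi k < phi (S k))%nat) /\
    forall i, (i < n)%nat -> mcv (fun k => M i (phi k)) (L i).
Proof.
  intros hB.
  (* [B + 1] bounds any real whose square is at most [B], without a square root. *)
  destruct (bounded_subseq_fam (8 * n) (fun j k => coord (j mod 8) (M (j / 8)%nat k)) (B + 1))
    as (phi & l & hphi & hl).
  { intros j k hj.
    assert (hi : (j / 8 < n)%nat) by (apply Nat.Div0.div_lt_upper_bound; lia).
    assert (h1 := hB _ k hi). assert (h2 := coord_le (j mod 8) (M (j / 8)%nat k)).
    assert (h3 := mn_ge0 (M (j / 8)%nat k)).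
    apply Rabs_le; nra. }
  exists phi, (fun i => mkM (mkC (l (8*i)%nat) (l (8*i+1)%nat)) (mkC (l (8*i+2)%nat) (l (8*i+3)%nat))
                         (mkC (l (8*i+4)%nat) (l (8*i+5)%nat)) (mkC (l (8*i+6)%nat) (l (8*i+7)%nat))).
  split; auto. intros i hi.
  assert (key : forall c, (c < 8)%nat -> is_lim_seq (fun k => coord c (M i (phi k))) (l (8 * i + c)%nat)).
  { intros c hc. assert (h := hl (8 * i + c)%nat ltac:(lia)).
    replace ((8 * i + c) mod 8)%nat with c in h
      by (rewrite Nat.add_comm, Nat.mul_comm, Nat.Div0.mod_add, Nat.mod_small; lia).
    replace ((8 * i + c) / 8)%nat with i in h; auto.
    rewrite Nat.add_comm, Nat.mul_comm, Nat.div_add, Nat.div_small by lia; auto. }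
  assert (k0 := key 0%nat ltac:(lia)); rewrite Nat.add_0_r in k0.
  split; [|split; [|split]]; split; simpl.
  - exact k0.
  - exact (key 1%nat ltac:(lia)).
  - exact (key 2%nat ltac:(lia)).
  - exact (key 3%nat ltac:(lia)).
  - exact (key 4%nat ltac:(lia)).
  - exact (key 5%nat ltac:(lia)).
  - exact (key 6%nat ltac:(lia)).
  - exact (key 7%nat ltac:(lia)).
Qed.

Lemma mat2_subseq (M : nat -> mat2) (B : R) : (forall k, mn (M k) <= B) ->
  exists phi L, (forall k, (phi k < phi (S k))%nat) /\ mcv (fun k => M (phi k)) L.
Proof.
  intros h; destruct (mat2_subseq_fam 1 (fun _ => M) B) as (phi & L & h1 & h2); auto.
  exists phi, (L O); split; auto.
Qed.

Lemma subseq_ge phi : (forall k, (phi k < phi (S k))%nat) -> forall k, (k <= phi k)%nat.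
Proof. intros h k; induction k; [lia|]. specialize (h k); lia. Qed.

Lemma is_lim_seq_inv_nat : is_lim_seq (fun k => / (INR k + 1)) 0.
Proof.
  apply is_lim_seq_spec; intros [e he]; simpl.
  destruct (archimed_cor1 e he) as (N & hN & hN0).
  exists N; intros k hle.
  assert (hk := pos_INR k). assert (0 < / (INR k + 1)) by (apply Rinv_0_lt_compat; lra).
  rewrite Rminus_0_r, Rabs_pos_eq by lra.
  eapply Rle_lt_trans; [|apply hN]. apply Rinv_le_contravar; [now apply lt_0_INR|].
  apply le_INR in hle; lra.
Qed.

Lemma is_lim_seq_squeeze0 (u : nat -> R) (phi : nat -> nat) C :
  (forall k, (phi k < phi (S k))%nat) ->
  (forall k, 0 <= u k <= C * / (INR (phi k) + 1)) -> is_lim_seq u 0.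
Proof.
  intros hphi hu.
  apply (is_lim_seq_le_le (fun _ => 0) u (fun k => C * / (INR (phi k) + 1))); auto.
  - apply is_lim_seq_const.
  - replace (Finite 0) with (Rbar_mult C 0) by (simpl; f_equal; ring).
    apply is_lim_seq_scal_l.
    apply (is_lim_seq_subseq (fun k => / (INR k + 1)) 0 phi);
      [now apply eventually_subseq | apply is_lim_seq_inv_nat].
Qed.

(** * Nonelementary subgroups of SL(2,C) *)

Definition sl2_subgroup (H : mat2 -> Prop) :=
  (forall h, H h -> mdet h = C1) /\ H mI /\
  (forall g h, H g -> H h -> H (mmul g h)) /\ (forall g, H g -> H (minv g)).

(** Cholesky factorisation: a positive Hermitian matrix of determinant one is [k k^+] with [k]
    triangular. *)
Lemma hermitian_factor A D y : 0 < D -> A * D - cnorm2 y = 1 ->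
  exists k, mdet k = C1 /\ hA k = A /\ hD k = D /\ hY k = y.
Proof.
  intros hD0 e. set (s := sqrt D).
  assert (hs : s * s = D) by (apply sqrt_sqrt; lra).
  assert (hs0 : 0 < s) by (apply sqrt_lt_R0; auto).
  exists (mkM (mkC (/ s) 0) (cscal (/ s) y) C0 (mkC s 0)).
  unfold mdet, hA, hD, hY; simpl. repeat split.
  - apply Cx_eq; simpl; field; lra.
  - rewrite cnorm2_scal. replace (cnorm2 y) with (A * D - 1) by lra.
    unfold cnorm2; simpl. rewrite <- hs; field; lra.
  - unfold cnorm2; simpl; lra.
  - apply Cx_eq; simpl; field; lra.
Qed.

(** The trace of [h^+ h k k^+]. Its use is that it is linear in [k k^+], so that averaging Hermitian
    matrices averages these norms. *)
Lemma mn_mul_hermitian h k :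
  mn (mmul h k) = (cnorm2 (ma h) + cnorm2 (mc h)) * hA k + (cnorm2 (mb h) + cnorm2 (md h)) * hD k
    + 2 * re (cmul (cadd (cmul (ma h) (cconj (mb h))) (cmul (mc h) (cconj (md h)))) (hY k)).
Proof. unfold mn, hA, hD, hY, cnorm2; simpl; ring. Qed.

Lemma mn_conj_hermitian g h : mn (mmul (minv g) h) =
  hA g * hD h + hA h * hD g - 2 * (re (hY g) * re (hY h) + im (hY g) * im (hY h)).
Proof. unfold hA, hD, hY, mn, minv, cnorm2; simpl; ring. Qed.

(* The circumcentre of a bounded orbit, i.e. the point [k o] minimising [sup_h mn (h k)], is
   unique: the normalised midpoint of two minimisers would do strictly better. *)
Lemma elementary_of_bounded H B : sl2_subgroup H -> (forall h, H h -> mn h <= B) -> elementary H.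
Proof.
  intros (hdet & h1 & hmul & _) hB.
  set (E := fun b => exists k, mdet k = C1 /\ forall h, H h -> mn (mmul h k) <= b).
  assert (E2 : forall b, E b -> 2 <= b).
  { intros b (k & hk & hb). specialize (hb mI h1). rewrite mmul_1l in hb.
    assert (i := mn_ge2 k hk); lra. }
  (* The infimum of [E], obtained as minus the supremum of its opposite. *)
  destruct (completeness (fun x => E (- x))) as [m' [hub hlub]].
  { exists (-2); intros x hx; apply E2 in hx; lra. }
  { exists (- B); rewrite Ropp_involutive; exists mI; split; [apply mdet_I|].
    intros; rewrite mmul_1r; auto. }
  set (m := - m').
  assert (low : forall b, E b -> m <= b).
  { intros b hb. assert (i : - b <= m'); [|unfold m; lra].
    apply hub; cbv beta; now rewrite Ropp_involutive. }
  assert (app : forall j : nat, exists k, mdet k = C1 /\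
             forall h, H h -> mn (mmul h k) <= m + / (INR j + 1)).
  { intros j. assert (0 < / (INR j + 1)) by (apply Rinv_0_lt_compat; assert (i := pos_INR j); lra).
    apply NNPP; intro hno. assert (hu : is_upper_bound (fun x => E (- x)) (m' - / (INR j + 1))).
    { intros x hx. destruct (Rle_dec x (m' - / (INR j + 1))); auto. exfalso; apply hno.
      destruct hx as (k & hk & hb). exists k; split; auto.
      intros h hh; specialize (hb h hh). unfold m; lra. }
    apply hlub in hu; lra. }
  destruct (choice_nat _ app) as [ks hks].
  destruct (mat2_subseq ks (m + 1)) as (phi & k & hphi & hcv).
  { intros j; destruct (hks j) as [_ hj]. specialize (hj mI h1). rewrite mmul_1l in hj.
    assert (/ (INR j + 1) <= 1); [|lra].
    rewrite <- Rinv_1. apply Rinv_le_contravar; [lra|]. assert (i := pos_INR j); lra. }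
  assert (hk : mdet k = C1).
  { apply (ccv_unique (fun j => mdet (ks (phi j)))); [now apply mcv_det|].
    split; (eapply is_lim_seq_ext; [|apply is_lim_seq_const]);
    intros j; cbv beta; now rewrite (proj1 (hks (phi j))). }
  assert (hm : forall h, H h -> mn (mmul h k) <= m).
  { intros h hh.
    apply (is_lim_seq_le (fun j => mn (mmul h (ks (phi j)))) (fun j => m + / (INR (phi j) + 1))
             (mn (mmul h k)) m).
    - intros j; now apply hks.
    - apply mcv_mn, mcv_mul; auto. apply mcv_const.
    - replace (Finite m) with (Finite (m + 0)) by (f_equal; ring).
      apply is_lim_seq_plus'; [apply is_lim_seq_const|].
      apply (is_lim_seq_subseq (fun k => / (INR k + 1)) 0 phi);
        [now apply eventually_subseq | apply is_lim_seq_inv_nat]. }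
  assert (m2 : 2 <= m) by (apply E2; exists k; auto).
  assert (hfix : forall g, H g -> act3 g (act3 k o3) = act3 k o3).
  { intros g hg. assert (hgd := hdet g hg). assert (hgk := mdet_mul1 g k hgd hk).
    symmetry; apply hB_eq1; auto using inH3_act3, inH3_act3_o3.
    rewrite hB_displacement by auto.
    assert (e1 := hermitian_det k hk). assert (e2 := hermitian_det _ hgk).
    assert (p1 := hD_gt0 k hk). assert (p2 := hD_gt0 _ hgk).
    assert (emix := mn_conj_hermitian k (mmul g k)).
    set (W := mn (mmul (minv k) (mmul g k))) in *.
    assert (hW : 2 <= W) by (apply mn_ge2, mdet_conj; auto).
    (* The mean of the Hermitian matrices of [k] and [g k] has determinant [(2 + W) / 4], [W] being
       the mixed term. Dividing the mean by [dl] restores determinant one and lowers the bound [m]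
       to [m / dl]; minimality then forces [dl <= 1], hence [W <= 2] and [g] fixes the point. *)
    set (dl := sqrt ((2 + W) / 4)).
    assert (hdl : dl * dl = (2 + W) / 4) by (apply sqrt_sqrt; lra).
    assert (hdl0 : 0 < dl) by (apply sqrt_lt_R0; lra).
    destruct (hermitian_factor ((hA k + hA (mmul g k)) / (2 * dl)) ((hD k + hD (mmul g k)) / (2 * dl))
       (cscal (/ (2 * dl)) (cadd (hY k) (hY (mmul g k))))) as (k' & hk' & eA & eD & eY).
    - apply Rdiv_lt_0_compat; lra.
    - rewrite cnorm2_scal.
      transitivity (((hA k + hA (mmul g k)) * (hD k + hD (mmul g k))
         - cnorm2 (cadd (hY k) (hY (mmul g k)))) / (4 * (dl * dl))); [field; lra|].
      rewrite hdl.
      replace ((hA k + hA (mmul g k)) * (hD k + hD (mmul g k))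
         - cnorm2 (cadd (hY k) (hY (mmul g k)))) with (2 + W).
      + field; lra.
      + rewrite emix. unfold cnorm2 in *. cbn [re im cadd]. lra.
    - assert (Ek : E (m / dl)).
      { exists k'; split; auto. intros h hh.
        assert (i1 := hm h hh). assert (i2 := hm (mmul h g) (hmul _ _ hh hg)).
        rewrite <- mmul_assoc in i2.
        replace (mn (mmul h k')) with ((mn (mmul h k) + mn (mmul h (mmul g k))) / (2 * dl)).
        - apply Rmult_le_reg_r with (2 * dl); [lra|].
          unfold Rdiv; rewrite Rmult_assoc, Rinv_l by lra.
          replace (m * / dl * (2 * dl)) with (2 * m) by (field; lra). lra.
        - rewrite !mn_mul_hermitian, eA, eD, eY. cbn [re im cadd cmul cscal]. field; lra. }
      apply low in Ek.
      assert (dl <= 1).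
      { destruct (Rle_dec dl 1); auto. exfalso.
        assert (m / dl < m); [|lra]. apply Rmult_lt_reg_r with dl; auto.
        unfold Rdiv; rewrite Rmult_assoc, Rinv_l by lra. nra. }
      nra. }
  exists (Inner (fst (act3 k o3)) (snd (act3 k o3))); split.
  - apply inH3_act3_o3; auto.
  - exists (Inner (fst (act3 k o3)) (snd (act3 k o3)) :: nil). intros h hh; left.
    unfold act3bar. rewrite <- surjective_pairing, (hfix h hh). reflexivity.
Qed.

(* Normalise an unbounded sequence; the limit has determinant zero and is trace-orthogonal to
   the group. *)
Lemma bounded_of_bounded_trace H B : sl2_subgroup H -> ~ elementary H ->
  (forall h, H h -> cnorm2 (mtr h) <= B) -> exists B', forall h, H h -> mn h <= B'.
Proof.
  intros (hdet & h1 & hmul & _) hne hB. apply NNPP; intro hno. apply hne.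
  assert (hex : forall k : nat, exists h, H h /\ INR k + 1 < mn h).
  { intros k; apply NNPP; intro hk; apply hno; exists (INR k + 1); intros h hh.
    destruct (Rle_dec (mn h) (INR k + 1)); auto. exfalso; apply hk; exists h; split; auto; lra. }
  destruct (choice_nat _ hex) as [hs hhs].
  set (M := fun k => mscal (mkC (/ sqrt (mn (hs k))) 0) (hs k)).
  assert (hpos : forall k, 0 < mn (hs k)).
  { intros k; destruct (hhs k) as [_ h]; assert (i := pos_INR k); lra. }
  assert (hsc : forall k, cnorm2 (mkC (/ sqrt (mn (hs k))) 0) = / mn (hs k)).
  { intros k. unfold cnorm2; simpl. rewrite <- (sqrt_sqrt (mn (hs k))) at 3 by (left; auto).
    assert (0 < sqrt (mn (hs k))) by (apply sqrt_lt_R0; auto). field; lra. }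
  assert (hinv : forall k, 0 <= / mn (hs k) <= / (INR k + 1)).
  { intros k; destruct (hhs k) as [_ h]; assert (i := pos_INR k). split.
    - left; apply Rinv_0_lt_compat; auto.
    - apply Rinv_le_contravar; lra. }
  assert (hM1 : forall k, mn (M k) = 1).
  { intros k; unfold M; rewrite mn_scal, hsc. apply Rinv_l. specialize (hpos k); lra. }
  destruct (mat2_subseq M 1) as (phi & L & hphi & hcv).
  { intros k; rewrite hM1; lra. }
  assert (hL1 : mn L = 1).
  { apply (is_lim_seq_eq (fun k => mn (M (phi k)))); [now apply mcv_mn|].
    eapply is_lim_seq_ext; [|apply is_lim_seq_const]. intros; cbv beta; now rewrite hM1. }
  assert (hLd : mdet L = C0).
  { apply cnorm2_eq0. apply (is_lim_seq_eq (fun k => cnorm2 (mdet (M (phi k))))).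
    - now apply ccv_norm2, mcv_det.
    - apply (is_lim_seq_squeeze0 _ phi 1); auto. intros k. split; [apply cnorm2_ge0|].
      assert (e : mdet (M (phi k)) = cmul (mkC (/ sqrt (mn (hs (phi k)))) 0) (mkC (/ sqrt (mn (hs (phi k)))) 0)).
      { transitivity (cmul (cmul (mkC (/ sqrt (mn (hs (phi k)))) 0) (mkC (/ sqrt (mn (hs (phi k)))) 0)) (mdet (hs (phi k)))).
        - unfold M, mdet; simpl ma; simpl mb; simpl mc; simpl md; ring.
        - rewrite hdet by apply hhs. ring. }
      rewrite e, cnorm2_mul, hsc. destruct (hinv (phi k)).
      assert (/ (INR (phi k) + 1) <= 1).
      { rewrite <- Rinv_1. apply Rinv_le_contravar; [lra|]. assert (i := pos_INR (phi k)); lra. }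
      nra. }
  assert (hLt : forall t, H t -> mtr (mmul L t) = C0).
  { intros t ht. apply cnorm2_eq0.
    apply (is_lim_seq_eq (fun k => cnorm2 (mtr (mmul (M (phi k)) t)))).
    - apply ccv_norm2, mcv_tr, mcv_mul; auto. apply mcv_const.
    - apply (is_lim_seq_squeeze0 _ phi B); auto. intros k. split; [apply cnorm2_ge0|].
      assert (e : mtr (mmul (M (phi k)) t) = cmul (mkC (/ sqrt (mn (hs (phi k)))) 0) (mtr (mmul (hs (phi k)) t))).
      { unfold M, mtr, mmul; simpl ma; simpl mb; simpl mc; simpl md; ring. }
      rewrite e, cnorm2_mul, hsc. destruct (hinv (phi k)).
      assert (i := hB (mmul (hs (phi k)) t) (hmul _ _ (proj1 (hhs (phi k))) ht)).
      assert (j := cnorm2_ge0 (mtr (mmul (hs (phi k)) t))).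
      rewrite Rmult_comm. apply Rmult_le_compat; auto. }
  apply (elementary_of_sandwich H L); auto.
  - intros ->. unfold mn in hL1; simpl in hL1; rewrite !cnorm2_C0 in hL1; lra.
  - intros t ht.
    (* Cayley-Hamilton for [L t], multiplied on the right by the inverse of [t]. *)
    transitivity (madd (mscal (mtr (mmul L t)) L) (mscal (copp (mdet L)) (minv t))).
    + unfold mtr, mdet; mring.
    + rewrite hLt, hLd by auto. mring.
Qed.

Lemma loxodromic_ex H : sl2_subgroup H -> ~ elementary H -> exists h, H h /\ loxodromic h.
Proof.
  intros hH hne; apply NNPP; intro hno.
  destruct (bounded_of_bounded_trace H 4 hH hne) as [B hB].
  - intros h hh.
    assert (hl : im (mtr h) = 0 /\ Rabs (re (mtr h)) <= 2).
    { apply NNPP; intro hl; apply hno; exists h; split; auto. }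
    destruct hl as [h1 h2]. apply Rabs_le_between in h2. unfold cnorm2; rewrite h1; nra.
  - apply hne, (elementary_of_bounded H B); auto.
Qed.

(** On traceless matrices with the trace form, the commutator is a cross product. A vector [Q]
    orthogonal to [X] and [Y] has zero product with their cross product; the identity [key] is the
    vector triple product formula. *)
Lemma traceless_commutes_commutator Q X Y :
  mtr Q = C0 -> mtr (mmul Q X) = C0 -> mtr (mmul Q Y) = C0 ->
  let K := madd (mmul X Y) (mscal (copp C1) (mmul Y X)) in mmul K Q = mmul Q K.
Proof.
  intros hQ hX hY K.
  assert (e : md Q = copp (ma Q)).
  { replace (md Q) with (csub (mtr Q) (ma Q)) by (unfold mtr; ring). rewrite hQ; ring. }
  assert (key : mmul K Q = madd (mmul Q K)
     (madd (mscal (mtr (mmul Q Y)) (madd (mscal (cadd C1 C1) X) (mscal (copp (mtr X)) mI)))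
           (mscal (copp (mtr (mmul Q X))) (madd (mscal (cadd C1 C1) Y) (mscal (copp (mtr Y)) mI))))).
  { unfold K, mtr; apply mat2_eq; simpl ma; simpl mb; simpl mc; simpl md; rewrite e; ring. }
  rewrite key, hX, hY. apply mat2_eq; simpl; ring.
Qed.

Lemma double_eq0 z : cadd z z = C0 -> z = C0.
Proof.
  intros h; assert (h1 := f_equal re h); assert (h2 := f_equal im h); simpl in *.
  apply Cx_eq; simpl; lra.
Qed.

Lemma traceless_nonscalar Q : mtr Q = C0 -> Q <> mzero -> ~ scalar_mat Q.
Proof.
  intros ht hn (hb & hc & ha); apply hn. unfold mtr in ht; rewrite <- ha in ht.
  apply double_eq0 in ht. apply mat2_eq; simpl; congruence.
Qed.

Lemma traceless_in_span Q K : mtr K = C0 -> mtr Q = C0 ->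
  (exists al be, Q = madd (mscal al mI) (mscal be K)) -> exists be, Q = mscal be K.
Proof.
  intros hK hQ (al & be & ->). exists be.
  assert (al = C0) as ->.
  { apply double_eq0. rewrite <- hQ. transitivity (cadd (cadd al al) (cmul be (mtr K))).
    - rewrite hK; ring. - unfold mtr; simpl; ring. }
  mring.
Qed.

Lemma mtr_conj_move t Q X :
  mtr (mmul (mmul (minv t) (mmul Q t)) X) = mtr (mmul Q (mmul t (mmul X (minv t)))).
Proof. now rewrite <- mmul_assoc, mtr_mulC, <- !mmul_assoc. Qed.

(* Otherwise [Q] spans a line stable under conjugation (or, when all conjugates of [g] commute,
   [g] does). *)
Lemma conjugates_span H g Q : sl2_subgroup H -> ~ elementary H -> H g -> ~ scalar_mat g ->
  mtr Q = C0 -> Q <> mzero ->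
  exists t, H t /\ mtr (mmul Q (mmul t (mmul g (minv t)))) <> C0.
Proof.
  intros (hdet & h1 & hmul & hinv) hne hg hns htQ hQ. apply NNPP; intro hno.
  assert (hz : forall t, H t -> mtr (mmul Q (mmul t (mmul g (minv t)))) = C0).
  { intros t ht; apply NNPP; intro h; apply hno; eauto. }
  apply hne.
  destruct (classic (forall t, H t -> exists al be,
     mmul t (mmul g (minv t)) = madd (mscal al mI) (mscal be g))) as [hA|hA].
  (* Twice the traceless part of [g]; when all conjugates lie in the span of [I] and [g], they
     preserve this line. *)
  - set (K := madd (mscal (cadd C1 C1) g) (mscal (copp (mtr g)) mI)).
    assert (hK0 : mtr K = C0) by (unfold K, mtr; simpl; ring).
    apply (elementary_of_semi_invariant H K); auto.
    + intros (hb & hc & ha); apply hns; unfold K in *; simpl in *.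
      assert (mb g = C0) by (apply double_eq0; rewrite <- hb; ring).
      assert (mc g = C0) by (apply double_eq0; rewrite <- hc; ring).
      repeat split; auto.
      assert (hd : csub (ma g) (md g) = C0).
      { apply double_eq0. transitivity (csub
          (cadd (cmul (cadd C1 C1) (ma g)) (cmul (copp (mtr g)) C1))
          (cadd (cmul (cadd C1 C1) (md g)) (cmul (copp (mtr g)) C1))); [ring|]. rewrite ha; ring. }
      replace (ma g) with (cadd (csub (ma g) (md g)) (md g)) by ring; rewrite hd; ring.
    + intros t ht. destruct (hA (minv t) (hinv t ht)) as (al & be & e).
      rewrite minv_minv in e.
      destruct (traceless_in_span (mmul (minv t) (mmul K t)) K) as [c hc]; auto.
      * rewrite mtr_conj by auto; auto.
      * exists (cadd (cadd al al) (cadd (cmul be (mtr g)) (copp (mtr g)))), be.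
        transitivity (madd (mscal (cadd C1 C1) (mmul (minv t) (mmul g t)))
          (mscal (copp (mtr g)) (mmul (minv t) t))); [unfold K; mring|].
        rewrite e, mmul_Vl by auto. unfold K; mring.
      * exists c. transitivity (mmul t (mmul (minv t) (mmul K t))).
        -- now rewrite mmul_assoc, mmul_Vr, mmul_1l by auto.
        -- rewrite hc; mring.
  - apply not_all_ex_not in hA; destruct hA as [t1 hA].
    assert (ht1 : H t1) by (apply NNPP; intro; tauto).
    set (g1 := mmul t1 (mmul g (minv t1))) in *.
    set (K := madd (mmul g g1) (mscal (copp C1) (mmul g1 g))).
    assert (hK0 : mtr K = C0) by (unfold K, mtr; simpl ma; simpl md; ring).
    assert (hKn : K <> mzero).
    { intro e; apply hA; intros _. apply commutant_nonscalar; auto.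
      transitivity (madd K (mmul g1 g)); [unfold K; mring|]. rewrite e; mring. }
    (* [hz] ranges over all conjugates of [g], so every conjugate of [Q] is again orthogonal to both
       [g] and [g1], hence lies in the line of [K]. Taking [t = mI] identifies this line with that
       of [Q]. *)
    assert (line : forall t, H t -> exists be, mmul (minv t) (mmul Q t) = mscal be K).
    { intros t ht. apply traceless_in_span; auto; [rewrite mtr_conj; auto|].
      apply commutant_nonscalar; [now apply traceless_nonscalar|].
      apply traceless_commutes_commutator; [rewrite mtr_conj; auto| |].
      - rewrite mtr_conj_move; auto.
      - rewrite mtr_conj_move, <- (hz (mmul t t1)) by auto.
        unfold g1; now rewrite minv_mul, <- !mmul_assoc. }
    destruct (line mI h1) as [b0 hb0].
    assert (eQ : Q = mscal b0 K) by (rewrite <- hb0; mring).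
    assert (hb : b0 <> C0) by (intros ->; apply hQ; rewrite eQ; mring).
    apply (elementary_of_semi_invariant H Q); auto; [now apply traceless_nonscalar|].
    intros t ht. destruct (line t ht) as [b e]. exists (cdiv b b0).
    transitivity (mmul t (mmul (minv t) (mmul Q t))).
    + now rewrite mmul_assoc, mmul_Vr, mmul_1l by auto.
    + rewrite e. rewrite eQ at 1. apply mat2_eq; simpl; field; auto.
Qed.

(** * Simultaneous transversality *)

Definition factor_nonelementary (n : nat) (Gam : (nat -> mat2) -> Prop) :=
  (forall g, Gam g -> forall i, (i < n)%nat -> mdet (g i) = C1) /\
  Gam gone /\ (forall g h, Gam g -> Gam h -> Gam (gmul g h)) /\
  (forall g, Gam g -> Gam (ginv g)) /\
  forall i, (i < n)%nat -> ~ elementary (proj Gam i).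

Lemma factor_nonelementary_of q r Gam : is_subgroup q r Gam -> nonelementary q r Gam ->
  factor_nonelementary (q + r) Gam.
Proof.
  intros (h1 & h2 & h3 & h4 & _) (h5 & _). repeat split; auto.
  intros g hg i hi; now apply h1.
Qed.

Lemma sl2_subgroup_proj n Gam i : factor_nonelementary n Gam -> (i < n)%nat ->
  sl2_subgroup (proj Gam i).
Proof.
  intros (h1 & h2 & h3 & h4 & _) hi. split; [|split; [|split]].
  - intros h (g & hg & <-); auto.
  - exists gone; auto.
  - intros g h (g' & hg & <-) (h' & hh & <-). exists (gmul g' h'); auto.
  - intros g (g' & hg & <-). exists (ginv g'); auto.
Qed.

Definition gpow (g : nat -> mat2) (k : nat) : nat -> mat2 := fun i => mpow (g i) k.

Lemma gpow_in n Gam g k : factor_nonelementary n Gam -> Gam g -> Gam (gpow g k).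
Proof.
  intros (h1 & h2 & h3 & _) hg; induction k as [|k IH]; [exact h2|].
  exact (h3 g (gpow g k) hg IH).
Qed.

Lemma eventually_all_lt (m : nat) (P : nat -> nat -> Prop) :
  (forall i, (i < m)%nat -> exists L, forall k, (L <= k)%nat -> P i k) ->
  exists L, forall i k, (i < m)%nat -> (L <= k)%nat -> P i k.
Proof.
  induction m as [|m IH]; intros h; [exists O; intros; lia|].
  destruct IH as [L hL]; [intros; apply h; lia|].
  destruct (h m ltac:(lia)) as [L' hL'].
  exists (L + L')%nat; intros i k hi hk.
  destruct (Nat.eq_dec i m) as [->|]; [apply hL' | apply hL]; lia.
Qed.

(** The periods of the factors are multiplied: multiples of [N * N'] are multiples of both. *)
Lemma trace_pow_multiples_fam (m : nat) (g M : nat -> mat2) :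
  (forall i, (i < m)%nat -> mdet (g i) = C1) -> (forall i, (i < m)%nat -> mtr (M i) <> C0) ->
  exists N L, (1 <= N)%nat /\ forall i k, (i < m)%nat -> (L <= k)%nat ->
    mtr (mmul (mpow (g i) (N * k)) (M i)) <> C0.
Proof.
  induction m as [|m IH]; intros hg hM; [exists 1%nat, O; split; intros; lia|].
  destruct IH as (N & L & hN & hL); [intros; apply hg; lia | intros; apply hM; lia|].
  destruct (trace_pow_multiples_neq0 (g m) (M m)) as (N' & L' & hN' & hL');
    [apply hg; lia | apply hM; lia|].
  exists (N * N')%nat, (L + L')%nat; split; [nia|]. intros i k hi hk.
  destruct (Nat.eq_dec i m) as [->|].
  - replace (N * N' * k)%nat with (N' * (N * k))%nat by ring. apply hL'; nia.
  - replace (N * N' * k)%nat with (N * (N' * k))%nat by ring. apply hL; [lia|nia].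
Qed.

Lemma loxodromic_conj t g : mdet t = C1 -> loxodromic g ->
  loxodromic (mmul t (mmul g (minv t))).
Proof.
  intros ht h; unfold loxodromic.
  now rewrite mtr_mulC, <- mmul_assoc, mmul_Vl, mmul_1r by auto.
Qed.

(* An element avoiding the first [m] hyperplanes is moved off the next one by the powers of an
   element of [Gam] that is loxodromic in that factor. *)
Lemma avoid_hyperplanes n Gam (M : nat -> mat2) : factor_nonelementary n Gam ->
  forall m, (m <= n)%nat -> (forall i, (i < m)%nat -> M i <> mzero) ->
  exists f, Gam f /\ forall i, (i < m)%nat -> mtr (mmul (M i) (f i)) <> C0.
Proof.
  intros hG m. assert (hG' := hG). destruct hG' as (hdet & hone & hmul & hinv & hne).
  induction m as [|m IH]; intros hm hM; [exists gone; split; auto; intros; lia|].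
  destruct IH as (f & hf & hav); [lia | intros; apply hM; lia|].
  destruct (classic (mtr (mmul (M m) (f m)) = C0)) as [hz|hnz].
  2: { exists f; split; auto; intros i hi; destruct (Nat.eq_dec i m) as [->|]; auto; apply hav; lia. }
  assert (hmn : (m < n)%nat) by lia.
  set (H := proj Gam m). assert (hH := sl2_subgroup_proj n Gam m hG hmn).
  destruct (loxodromic_ex H hH (hne m hmn)) as (c & hc & hlox).
  (* By cyclicity the trace of [M g^k f] is that of [g^k Q], so the task is to find a conjugate of
     [c] not orthogonal to the traceless matrix [Q]. *)
  set (Q := mmul (f m) (M m)).
  assert (hQ0 : mtr Q = C0) by (unfold Q; now rewrite mtr_mulC).
  assert (hQ : Q <> mzero).
  { intros e. apply (hM m); [lia|].
    transitivity (mmul (minv (f m)) Q).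
    - unfold Q; rewrite mmul_assoc, mmul_Vl, mmul_1l; auto.
    - rewrite e; mring. }
  assert (hcd : mdet c = C1) by (apply hH; auto).
  assert (hns : ~ scalar_mat c).
  { rewrite <- (mmul_1r c). apply (loxodromic_pow_nonscalar c 1); auto. }
  destruct (conjugates_span H c Q hH (hne m hmn) hc hns hQ0 hQ) as (t & ht & htr).
  destruct hc as (c' & hc' & ec), ht as (t' & ht' & et).
  set (g := gmul t' (gmul c' (ginv t'))).
  assert (hg : Gam g) by (unfold g; auto).
  assert (egm : g m = mmul t (mmul c (minv t))) by (unfold g, gmul, ginv; now rewrite ec, et).
  assert (htd : mdet t = C1) by (rewrite <- et; auto).
  assert (hgd : forall i, (i < n)%nat -> mdet (g i) = C1) by (intros; auto).
  destruct (trace_pow_multiples_fam m g (fun i => mmul (f i) (M i))) as (N & L & hN & hL).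
  { intros; apply hgd; lia. } { intros i hi; rewrite mtr_mulC; auto. }
  (* The nonzero value sits at exponent 1: at exponent 0 the trace is [mtr Q], which vanishes. *)
  destruct (trace_pow_eventually_neq0 (g m) Q 1) as [L' hL']; auto.
  { intros k hk; apply loxodromic_pow_nonscalar; auto. rewrite egm; now apply loxodromic_conj. }
  { simpl. rewrite mmul_1r, egm, mtr_mulC. exact htr. }
  (* A multiple of [N] with quotient at least [L] for the old factors, and, as [1 <= N], an exponent
     at least [L'] for the new one. *)
  exists (gmul (gpow g (N * (L + L'))) f); split.
  - apply hmul; auto. now apply (gpow_in n).
  - intros i hi. unfold gmul, gpow.
    rewrite mtr_mulC, <- mmul_assoc.
    destruct (Nat.eq_dec i m) as [->|].
    + apply hL'; nia.
    + apply hL; lia.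
Qed.

Lemma normalize_mat M : M <> mzero -> exists z, cnorm2 z * mn M = 1.
Proof.
  intros h; assert (i := mn_gt0 M h). exists (mkC (/ sqrt (mn M)) 0).
  assert (0 < sqrt (mn M)) by (apply sqrt_lt_R0; auto).
  unfold cnorm2; simpl. rewrite <- (sqrt_sqrt (mn M)) at 3 by lra. field; lra.
Qed.

(** The trace inequality is homogeneous in each [M i], so counterexamples to the constants [k + 1]
    can be scaled to unit norm and made to converge. The element found for the limit then serves all
    late members of the sequence. *)
Lemma uniform_transversality n Gam : factor_nonelementary n Gam ->
  exists C, 1 <= C /\ forall M : nat -> mat2, (forall i, (i < n)%nat -> M i <> mzero) ->
    exists f, Gam f /\ forall i, (i < n)%nat ->
      mn (f i) <= C /\ mn (M i) <= C * cnorm2 (mtr (mmul (M i) (f i))).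
Proof.
  intros hG; apply NNPP; intro hno.
  assert (hex : forall k : nat, exists M : nat -> mat2, (forall i, (i < n)%nat -> mn (M i) = 1) /\
     ~ exists f, Gam f /\ forall i, (i < n)%nat ->
         mn (f i) <= INR k + 1 /\ mn (M i) <= (INR k + 1) * cnorm2 (mtr (mmul (M i) (f i)))).
  { intros k; apply NNPP; intro hk; apply hno. exists (INR k + 1).
    split; [assert (i := pos_INR k); lra|]. intros M hM.
    assert (hz : forall i, exists z, (i < n)%nat -> cnorm2 z * mn (M i) = 1).
    { intros i; destruct (Compare_dec.le_lt_dec n i); [exists C0; intros; lia|].
      destruct (normalize_mat (M i)) as [z hz]; auto. exists z; auto. }
    destruct (choice_nat _ hz) as [z hz'].
    apply NNPP; intro hf; apply hk. exists (fun i => mscal (z i) (M i)).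
    split; [intros i hi; rewrite mn_scal; auto|].
    intros (f & hf1 & hf2); apply hf; exists f; split; auto.
    intros i hi; destruct (hf2 i hi) as [i1 i2]; split; auto.
    assert (e : mtr (mmul (mscal (z i) (M i)) (f i)) = cmul (z i) (mtr (mmul (M i) (f i)))).
    { unfold mtr, mmul, mscal; simpl ma; simpl mb; simpl mc; simpl md; ring. }
    rewrite e, mn_scal, cnorm2_mul in i2. specialize (hz' i hi).
    assert (j := cnorm2_ge0 (z i)). assert (j' := mn_ge0 (M i)).
    apply Rmult_le_reg_l with (cnorm2 (z i)); [nra|]. lra. }
  destruct (choice_nat _ hex) as [Ms hMs].
  destruct (mat2_subseq_fam n (fun i k => Ms k i) 1) as (phi & L & hphi & hcv).
  { intros i k hi; rewrite (proj1 (hMs k) i hi); lra. }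
  assert (hL1 : forall i, (i < n)%nat -> mn (L i) = 1).
  { intros i hi. apply (is_lim_seq_eq (fun k => mn (Ms (phi k) i))); [now apply mcv_mn, hcv|].
    eapply is_lim_seq_ext; [|apply is_lim_seq_const]. intros; cbv beta.
    now rewrite (proj1 (hMs (phi n0)) i hi). }
  destruct (avoid_hyperplanes n Gam L hG n (Nat.le_refl n)) as (f & hf & hav).
  { intros i hi e. assert (j := hL1 i hi). rewrite e in j. unfold mn in j; simpl in j.
    rewrite !cnorm2_C0 in j; lra. }
  destruct (eventually_all_lt n (fun i k => mn (f i) <= INR (phi k) + 1 /\
     mn (Ms (phi k) i) <= (INR (phi k) + 1) * cnorm2 (mtr (mmul (Ms (phi k) i) (f i))))) as [K hK].
  { intros i hi. set (d := cnorm2 (mtr (mmul (L i) (f i)))).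
    assert (hd : 0 < d) by (apply cnorm2_gt0, hav; auto).
    assert (hlim : is_lim_seq (fun k => cnorm2 (mtr (mmul (Ms (phi k) i) (f i)))) d).
    { apply ccv_norm2, mcv_tr, mcv_mul; [now apply hcv | apply mcv_const]. }
    apply is_lim_seq_spec in hlim. destruct (hlim (mkposreal (d / 2) ltac:(lra))) as [K1 hK1].
    simpl in hK1.
    (* From [K1] on the traces exceed [d / 2], so a constant above both [mn (f i)] and [2 / d]
       works. *)
    destruct (nfloor_ex (mn (f i) + 2 / d)) as (K2 & _ & hK2).
    { assert (j := mn_ge0 (f i)). assert (0 < 2 / d) by (apply Rdiv_lt_0_compat; lra). lra. }
    exists (K1 + K2)%nat; intros k hk.
    assert (hp : INR K2 <= INR (phi k)).
    { apply le_INR. assert (j := subseq_ge phi hphi k). lia. }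
    assert (j := mn_ge0 (f i)). assert (h2d : 0 < 2 / d) by (apply Rdiv_lt_0_compat; lra).
    split; [lra|]. rewrite (proj1 (hMs (phi k)) i hi).
    specialize (hK1 k ltac:(lia)). apply Rabs_lt_between in hK1.
    set (x := cnorm2 (mtr (mmul (Ms (phi k) i) (f i)))) in *.
    assert (hx : d / 2 <= x) by lra.
    apply Rle_trans with (2 / d * (d / 2)); [right; field; lra|].
    apply Rmult_le_compat; lra. }
  apply (proj2 (hMs (phi K))). exists f; split; auto.
Qed.

(** [M] is a column of [h] times a row of [g], so the trace of [M f] is an entry of [g f h]. Row and
    column are chosen to carry at least half of [mn g] and [mn h], whence the 4. *)
Lemma dominant_entry g h : 0 < mn g -> 0 < mn h ->
  exists M, M <> mzero /\ mn g * mn h <= 4 * mn M /\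
    forall f, cnorm2 (mtr (mmul M f)) <= mn (mmul g (mmul f h)).
Proof.
  intros hg hh.
  assert (hr : exists p q, mn g <= 2 * (cnorm2 p + cnorm2 q) /\
     ((p = ma g /\ q = mb g) \/ (p = mc g /\ q = md g))).
  { unfold mn. destruct (Rle_dec (cnorm2 (mc g) + cnorm2 (md g)) (cnorm2 (ma g) + cnorm2 (mb g))).
    - exists (ma g), (mb g); split; auto; lra.
    - exists (mc g), (md g); split; auto; lra. }
  assert (hc : exists x y, mn h <= 2 * (cnorm2 x + cnorm2 y) /\
     ((x = ma h /\ y = mc h) \/ (x = mb h /\ y = md h))).
  { unfold mn. destruct (Rle_dec (cnorm2 (mb h) + cnorm2 (md h)) (cnorm2 (ma h) + cnorm2 (mc h))).
    - exists (ma h), (mc h); split; auto; lra.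
    - exists (mb h), (md h); split; auto; lra. }
  destruct hr as (p & q & hr & er), hc as (x & y & hc & ec).
  set (M := mkM (cmul x p) (cmul x q) (cmul y p) (cmul y q)).
  assert (eM : mn M = (cnorm2 p + cnorm2 q) * (cnorm2 x + cnorm2 y)).
  { unfold mn; simpl; rewrite !cnorm2_mul; ring. }
  assert (hM : mn g * mn h <= 4 * mn M).
  { rewrite eM. replace (4 * ((cnorm2 p + cnorm2 q) * (cnorm2 x + cnorm2 y)))
      with ((2 * (cnorm2 p + cnorm2 q)) * (2 * (cnorm2 x + cnorm2 y))) by ring.
    apply Rmult_le_compat; lra. }
  exists M; split; [|split; auto].
  - intros e. rewrite e in hM. assert (mn mzero = 0) as e0 by (unfold mn; simpl; rewrite cnorm2_C0; ring).
    rewrite e0 in hM. nra.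
  - intros f.
    assert (e : mtr (mmul M f) = cadd (cmul p (cadd (cmul (ma f) x) (cmul (mb f) y)))
                                      (cmul q (cadd (cmul (mc f) x) (cmul (md f) y)))).
    { unfold mtr, M; simpl; ring. }
    rewrite e; unfold mn, mmul; simpl ma; simpl mb; simpl mc; simpl md.
    assert (i1 := cnorm2_ge0 (cadd (cmul (ma g) (cadd (cmul (ma f) (ma h)) (cmul (mb f) (mc h))))
                                   (cmul (mb g) (cadd (cmul (mc f) (ma h)) (cmul (md f) (mc h)))))).
    assert (i2 := cnorm2_ge0 (cadd (cmul (ma g) (cadd (cmul (ma f) (mb h)) (cmul (mb f) (md h))))
                                   (cmul (mb g) (cadd (cmul (mc f) (mb h)) (cmul (md f) (md h)))))).
    assert (i3 := cnorm2_ge0 (cadd (cmul (mc g) (cadd (cmul (ma f) (ma h)) (cmul (mb f) (mc h))))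
                                   (cmul (md g) (cadd (cmul (mc f) (ma h)) (cmul (md f) (mc h)))))).
    assert (i4 := cnorm2_ge0 (cadd (cmul (mc g) (cadd (cmul (ma f) (mb h)) (cmul (mb f) (md h))))
                                   (cmul (md g) (cadd (cmul (mc f) (mb h)) (cmul (md f) (md h)))))).
    destruct er as [[-> ->]|[-> ->]], ec as [[-> ->]|[-> ->]]; lra.
Qed.

Lemma product_almost_multiplicative n Gam : factor_nonelementary n Gam ->
  exists C, 1 <= C /\ forall g h, Gam g -> Gam h -> exists f, Gam f /\ forall i, (i < n)%nat ->
    mn (f i) <= C /\ mn (g i) * mn (h i) <= C * mn (mmul (g i) (mmul (f i) (h i))).
Proof.
  intros hG. destruct (uniform_transversality n Gam hG) as (C & hC & huni).
  destruct hG as (hdet & _).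
  exists (4 * C); split; [lra|]. intros g h hg hh.
  assert (hex : forall i, exists M, (i < n)%nat -> M <> mzero /\ mn (g i) * mn (h i) <= 4 * mn M /\
     forall f, cnorm2 (mtr (mmul M f)) <= mn (mmul (g i) (mmul f (h i)))).
  { intros i; destruct (Compare_dec.le_lt_dec n i); [exists mzero; intros; lia|].
    destruct (dominant_entry (g i) (h i)) as [M hM].
    - assert (j := mn_ge2 _ (hdet g hg i l)); lra.
    - assert (j := mn_ge2 _ (hdet h hh i l)); lra.
    - exists M; auto. }
  destruct (choice_nat _ hex) as [M hM].
  destruct (huni M) as (f & hf & hfi); [intros i hi; now apply hM|].
  exists f; split; auto. intros i hi. destruct (hfi i hi) as [i1 i2].
  destruct (hM i hi) as (_ & i3 & i4). specialize (i4 (f i)). split; [lra|].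
  assert (C * cnorm2 (mtr (mmul (M i) (f i))) <= C * mn (mmul (g i) (mmul (f i) (h i))))
    by (apply Rmult_le_compat_l; lra).
  lra.
Qed.

(** * The asymptotic cone of the Cartan projections *)

(** [T] has to be arbitrarily large for additive constants to disappear into [eps * T]; the clause
    [0 < T] matters because [T0] may be negative. *)
Definition asym_cone (n : nat) (Gam : (nat -> mat2) -> Prop) (v : nat -> R) :=
  forall eps T0, 0 < eps -> exists T g, T0 < T /\ 0 < T /\ Gam g /\
    forall i, (i < n)%nat -> Rabs (cartan (g i) - T * v i) <= eps * T.

Lemma asym_cone_ext n Gam u v : (forall i, (i < n)%nat -> u i = v i) ->
  asym_cone n Gam u -> asym_cone n Gam v.
Proof.
  intros e h eps T0 he. destruct (h eps T0 he) as (T & g & h1 & h2 & h3 & h4).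
  exists T, g; repeat split; auto. intros i hi; rewrite <- e by auto; auto.
Qed.

Lemma sumR_ge0 n f : (forall i, (i < n)%nat -> 0 <= f i) -> 0 <= sumR n f.
Proof.
  induction n; simpl; intros h; [lra|].
  assert (0 <= sumR n f) by (apply IHn; intros; apply h; lia). assert (0 <= f n) by (apply h; lia). lra.
Qed.

Lemma sumR_le n f g : (forall i, (i < n)%nat -> f i <= g i) -> sumR n f <= sumR n g.
Proof.
  induction n; simpl; intros h; [lra|].
  assert (sumR n f <= sumR n g) by (apply IHn; intros; apply h; lia).
  assert (f n <= g n) by (apply h; lia). lra.
Qed.

Lemma sumR_ext n f g : (forall i, (i < n)%nat -> f i = g i) -> sumR n f = sumR n g.
Proof. intros h; apply Rle_antisym; apply sumR_le; intros; rewrite h; auto; lra. Qed.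

Lemma sumR_term n f i : (forall j, (j < n)%nat -> 0 <= f j) -> (i < n)%nat -> f i <= sumR n f.
Proof.
  induction n; simpl; intros h hi; [lia|].
  assert (h0 : 0 <= sumR n f) by (apply sumR_ge0; intros; apply h; lia).
  assert (h1 : 0 <= f n) by (apply h; lia).
  destruct (Nat.eq_dec i n) as [->|]; [lra|].
  assert (f i <= sumR n f) by (apply IHn; [intros; apply h|]; lia). lra.
Qed.

Lemma sumR_const n c : sumR n (fun _ => c) = INR n * c.
Proof. induction n; simpl sumR; [simpl; ring | rewrite IHn, S_INR; ring]. Qed.

Lemma sqr_le_abs x y : 0 <= y -> x * x <= y * y -> Rabs x <= y.
Proof. intros hy h; apply Rabs_le; split; nra. Qed.

Lemma vdist_coord n u v i : (i < n)%nat -> Rabs (u i - v i) <= vdist n u v.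
Proof.
  intros hi; unfold vdist, vnorm. apply sqr_le_abs; [apply sqrt_pos|].
  rewrite sqrt_sqrt by (apply sumR_ge0; intros; apply (Rle_0_sqr (_ - _))).
  apply (sumR_term n (fun i => (u i - v i) * (u i - v i)) i); auto.
  intros; apply (Rle_0_sqr (_ - _)).
Qed.

Lemma vdist_le n u v e : 0 <= e -> (forall i, (i < n)%nat -> Rabs (u i - v i) <= e) ->
  vdist n u v <= INR n * e.
Proof.
  intros he h; unfold vdist, vnorm.
  rewrite <- (sqrt_square (INR n * e)) by (apply Rmult_le_pos; auto; apply pos_INR).
  apply sqrt_le_1_alt.
  apply Rle_trans with (INR n * (e * e)).
  - rewrite <- sumR_const. apply sumR_le; intros i hi. specialize (h i hi).
    apply Rabs_le_between in h. nra.
  - destruct n; [simpl; lra|]. rewrite S_INR. assert (j := pos_INR n).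
    assert (0 <= e * e) by nra. nra.
Qed.

Lemma asym_cone_closed n Gam : closed_set n (asym_cone n Gam).
Proof.
  intros v hv eps T0 he. destruct (hv (eps / 2) ltac:(lra)) as (u & hu & hd).
  destruct (hu (eps / 2) T0 ltac:(lra)) as (T & g & h1 & h2 & h3 & h4).
  exists T, g; repeat split; auto. intros i hi. specialize (h4 i hi).
  assert (h5 := vdist_coord n u v i hi).
  replace (cartan (g i) - T * v i) with ((cartan (g i) - T * u i) + T * (u i - v i)) by ring.
  eapply Rle_trans; [apply Rabs_triang|].
  rewrite Rabs_mult, (Rabs_pos_eq T) by lra.
  assert (T * Rabs (u i - v i) <= T * (eps / 2)) by (apply Rmult_le_compat_l; lra). lra.
Qed.

Lemma cartan_one : cartan mI = 0.
Proof.
  apply cosh_inj; [apply cartan_ge0, mdet_I | lra|].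
  rewrite cosh_cartan, cosh_0 by apply mdet_I.
  unfold mn; simpl; rewrite !cnorm2_C0, !cnorm2_C1; lra.
Qed.

Lemma asym_cone_is_cone n Gam : Gam gone -> is_cone (asym_cone n Gam).
Proof.
  intros hone v t hv ht eps T0 he. destruct ht as [ht|<-].
  - destruct (hv (eps / t) (t * T0)) as (T & g & h1 & h2 & h3 & h4).
    { apply Rdiv_lt_0_compat; auto. }
    exists (T / t), g; repeat split; auto.
    + apply Rmult_lt_reg_l with t; auto. replace (t * (T / t)) with T by (field; lra). auto.
    + apply Rdiv_lt_0_compat; auto.
    + intros i hi; specialize (h4 i hi).
      replace (T / t * (t * v i)) with (T * v i) by (field; lra).
      replace (eps * (T / t)) with (eps / t * T) by (field; lra). auto.
  - exists (Rmax T0 0 + 1), gone. assert (h1 := Rmax_l T0 0); assert (h2 := Rmax_r T0 0).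
    repeat split; auto; [lra|lra|]. intros i _. unfold gone; rewrite cartan_one.
    rewrite Rmult_0_l, Rmult_0_r, Rminus_0_r, Rabs_R0. apply Rmult_le_pos; lra.
Qed.

Lemma asym_cone_nonneg n Gam v i : factor_nonelementary n Gam -> asym_cone n Gam v ->
  (i < n)%nat -> 0 <= v i.
Proof.
  intros (hdet & _) hv hi. destruct (Rle_dec 0 (v i)); auto. exfalso.
  destruct (hv (- v i / 2) 0 ltac:(lra)) as (T & g & _ & h2 & h3 & h4).
  specialize (h4 i hi). apply Rabs_le_between in h4.
  assert (h5 := cartan_ge0 (g i) (hdet g h3 i hi)). nra.
Qed.

Lemma is_len_family (h : nat -> mat2) : exists u, forall i, is_len (h i) (u i).
Proof. exact (choice_nat _ (fun i => is_len_ex (h i))). Qed.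

(** A corrector [f] adapted to [g] makes the lengths of [g f] agree with the Cartan projections of
    [g] up to a constant; scaling by [/ T] yields multiples of genuine length vectors. *)
Lemma asym_cone_approx n Gam v eps : factor_nonelementary n Gam -> asym_cone n Gam v -> 0 < eps ->
  exists t h u, 0 <= t /\ Gam h /\ (forall i, is_len (h i) (u i)) /\
    forall i, (i < n)%nat -> Rabs (t * u i - v i) <= eps.
Proof.
  intros hG hv he. destruct (uniform_transversality n Gam hG) as (C & hC & huni).
  destruct hG as (hdet & _ & hmul & _).
  (* Above, [ln C] is the norm of [f] and [ln 2 <= ln 4] comes from [cartan_bounds]; below, [ln C]
     is the loss in transversality and [ln 4] that of [is_len_ge_trace]. Then [T > 2 D / eps] makes
     [D] at most [eps / 2 * T]. *)
  set (D := ln C + ln 4).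
  assert (hlC : 0 <= ln C) by (rewrite <- ln_1; apply ln_le; lra).
  assert (hl2 : 0 < ln 2) by (rewrite <- ln_1; apply ln_increasing; lra).
  assert (hl4 : ln 4 = 2 * ln 2) by (replace 4 with (2 * 2) by ring; rewrite ln_mult; lra).
  destruct (hv (eps / 2) (2 * D / eps) ltac:(lra)) as (T & g & h1 & h2 & h3 & h4).
  destruct (huni g) as (f & hf & hfi).
  { intros i hi e. assert (j := mn_ge2 _ (hdet g h3 i hi)). rewrite e in j.
    unfold mn in j; simpl in j; rewrite cnorm2_C0 in j; lra. }
  destruct (is_len_family (gmul g f)) as [u hu].
  exists (/ T), (gmul g f), u. split; [left; now apply Rinv_0_lt_compat|].
  split; [auto|]. split; auto. intros i hi.
  specialize (h4 i hi). destruct (hfi i hi) as [i1 i2]. specialize (hu i). unfold gmul in hu.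
  assert (dg := hdet g h3 i hi). assert (df := hdet f hf i hi).
  assert (j1 := mn_ge2 _ dg). assert (j2 := mn_ge2 _ df).
  assert (jb := cartan_bounds _ dg).
  assert (htr : 0 < cnorm2 (mtr (mmul (g i) (f i)))).
  { destruct (cnorm2_ge0 (mtr (mmul (g i) (f i)))) as [|e]; auto. rewrite <- e in i2; lra. }
  assert (up : u i <= cartan (g i) + D).
  { assert (k := is_len_le_mn _ _ (mdet_mul1 _ _ dg df) hu).
    assert (k' : ln (mn (mmul (g i) (f i))) <= ln (mn (g i)) + ln (mn (f i))).
    { rewrite <- ln_mult by lra. apply ln_le; [|apply mn_mul].
      assert (l := mn_ge2 _ (mdet_mul1 _ _ dg df)); lra. }
    assert (ln (mn (f i)) <= ln C) by (apply ln_le; lra). unfold D; lra. }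
  assert (lo : cartan (g i) - D <= u i).
  { assert (k := is_len_ge_trace _ _ hu).
    assert (k' : ln (mn (g i)) <= ln C + ln (cnorm2 (mtr (mmul (g i) (f i))))).
    { rewrite <- ln_mult by lra. apply ln_le; lra. }
    assert (mtr (mmul (g i) (f i)) <> C0) by (intro e; rewrite e, cnorm2_C0 in htr; lra).
    specialize (k H). unfold D; lra. }
  apply Rabs_le_between in h4.
  assert (hDT : D <= eps / 2 * T).
  { apply Rmult_lt_compat_r with (r := eps / 2) in h1; [|lra].
    replace (2 * D / eps * (eps / 2)) with D in h1 by (field; lra). lra. }
  apply Rabs_le; split; apply Rmult_le_reg_l with T; auto;
  rewrite Rmult_minus_distr_l, <- Rmult_assoc, Rinv_r, Rmult_1_l by lra; lra.
Qed.

Lemma limit_cone_of_asym q r Gam v : factor_nonelementary (q + r) Gam ->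
  asym_cone (q + r) Gam v -> limit_cone q r Gam v.
Proof.
  intros hG hv C hcl hco hlen. apply hcl; intros eps he.
  assert (hn := pos_INR (q + r)).
  set (e := eps / (INR (q + r) + 1)).
  assert (he0 : 0 < e) by (apply Rdiv_lt_0_compat; lra).
  destruct (asym_cone_approx _ _ v e hG hv he0) as (t & h & u & ht & hh & hu & happ).
  exists (fun i => t * u i); split.
  - apply hco; auto. apply (hlen h); auto. intros i hi. apply is_len_transl_length; auto.
    now apply (proj1 hG).
  - eapply Rle_lt_trans; [apply (vdist_le _ _ _ e); auto; lra|].
    assert (e * (INR (q + r) + 1) = eps) by (unfold e; field; lra). lra.
Qed.

(** The exponent is the integer part of [INR N * s], so that powers realise real multiples of a
    length. The constant is [C] from the upper bound on powers plus [a] for the rounding. *)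
Lemma len_floor_pow g a s eps : mdet g = C1 -> is_len g a -> 0 <= s -> 0 < eps ->
  exists D, forall N k, INR k <= INR N * s < INR k + 1 ->
    Rabs (ln (mn (mpow g k)) - INR N * s * a) <= eps * INR N + D.
Proof.
  intros hg ha hs he.
  (* The exponent is at most [INR N * s], so an error [e] per power is at most [eps] per unit of
     [N]; the [+ 1] covers [s = 0]. *)
  set (e := eps / (s + 1)). assert (he0 : 0 < e) by (apply Rdiv_lt_0_compat; lra).
  assert (hes : e * s <= eps).
  { assert (e * (s + 1) = eps) by (unfold e; field; lra). lra. }
  destruct (is_len_pow_upper g a e hg ha he0) as [C hC].
  assert (ha0 := is_len_ge0 g a ha).
  exists (Rabs C + a); intros N k [h1 h2].
  assert (lo := is_len_pow_lower g a k hg ha). assert (up := hC k).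
  assert (hN := pos_INR N). assert (hC' := Rle_abs C). assert (hC0 := Rabs_pos C).
  assert (i1 : INR k * a <= INR N * s * a) by (apply Rmult_le_compat_r; lra).
  assert (i2 : INR N * s * a <= (INR k + 1) * a) by (apply Rmult_le_compat_r; lra).
  assert (i3 : e * INR k <= e * (INR N * s)) by (apply Rmult_le_compat_l; lra).
  assert (i4 : e * s * INR N <= eps * INR N) by (apply Rmult_le_compat_r; lra).
  assert (0 <= eps * INR N) by (apply Rmult_le_pos; lra).
  apply Rabs_le; lra.
Qed.

(** At scale [N] the witness is [g^k1 f h^k2] with [k1], [k2] the integer parts of [N s], [N t] and
    [f] a bounded corrector making norms multiply up to a constant. *)
Lemma asym_cone_len_comb n Gam g h a b s t : factor_nonelementary n Gam -> Gam g -> Gam h ->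
  (forall i, (i < n)%nat -> is_len (g i) (a i)) -> (forall i, (i < n)%nat -> is_len (h i) (b i)) ->
  0 <= s -> 0 <= t -> asym_cone n Gam (fun i => s * a i + t * b i).
Proof.
  intros hG hg hh ha hb hs ht eps T0 he.
  destruct (product_almost_multiplicative n Gam hG) as (C & hC & hprod).
  assert (hdet := proj1 hG).
  assert (hlC : 0 <= ln C) by (rewrite <- ln_1; apply ln_le; lra).
  assert (hl2 : 0 < ln 2) by (rewrite <- ln_1; apply ln_increasing; lra).
  (* The estimate is uniform in [k1], [k2] and [f], since these are chosen only after [N]. *)
  destruct (eventually_all_lt n (fun i N => forall k1 k2 f,
     INR k1 <= INR N * s < INR k1 + 1 -> INR k2 <= INR N * t < INR k2 + 1 -> mdet f = C1 ->
     mn f <= C ->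
     mn (mpow (g i) k1) * mn (mpow (h i) k2) <=
       C * mn (mmul (mpow (g i) k1) (mmul f (mpow (h i) k2))) ->
     Rabs (cartan (mmul (mpow (g i) k1) (mmul f (mpow (h i) k2))) - INR N * (s * a i + t * b i))
       <= eps * INR N)) as [L hL].
  { intros i hi. assert (dg := hdet g hg i hi). assert (dh := hdet h hh i hi).
    (* The two powers use up [eps / 2]; the other half is for the constants collected in [D]. *)
    destruct (len_floor_pow (g i) (a i) s (eps / 4) dg (ha i hi) hs ltac:(lra)) as [D1 hD1].
    destruct (len_floor_pow (h i) (b i) t (eps / 4) dh (hb i hi) ht ltac:(lra)) as [D2 hD2].
    set (D := Rabs (D1 + D2 + ln C + ln 2)).
    destruct (nfloor_ex (2 * D / eps)) as (L & _ & hL).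
    { apply Rmult_le_pos; [|left; apply Rinv_0_lt_compat; lra].
      assert (j := Rabs_pos (D1 + D2 + ln C + ln 2)). unfold D; lra. }
    (* [2 * D / eps] is below [INR L + 1], hence the successor. *)
    exists (S L); intros N hN k1 k2 f h1 h2 df hf hm.
    apply le_INR in hN. rewrite S_INR in hN.
    assert (e1 := hD1 N k1 h1). assert (e2 := hD2 N k2 h2).
    assert (d1 := mdet_pow1 (g i) k1 dg). assert (d2 := mdet_pow1 (h i) k2 dh).
    set (P := mpow (g i) k1) in *. set (Q := mpow (h i) k2) in *.
    assert (dw : mdet (mmul P (mmul f Q)) = C1) by (repeat apply mdet_mul1; auto).
    assert (j1 := mn_ge2 _ d1). assert (j2 := mn_ge2 _ d2). assert (j3 := mn_ge2 _ df).
    assert (j4 := mn_ge2 _ dw). assert (jc := cartan_bounds _ dw).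
    assert (up : ln (mn (mmul P (mmul f Q))) <= ln (mn P) + ln (mn Q) + ln C).
    { rewrite <- ln_mult, <- ln_mult by nra. apply ln_le; [lra|].
      apply Rle_trans with (mn P * (mn f * mn Q)).
      - eapply Rle_trans; [apply mn_mul|]. apply Rmult_le_compat_l; [lra|apply mn_mul].
      - assert (0 < mn P * mn Q) by nra.
        replace (mn P * (mn f * mn Q)) with (mn P * mn Q * mn f) by ring.
        apply Rmult_le_compat_l; lra. }
    assert (lo : ln (mn P) + ln (mn Q) <= ln C + ln (mn (mmul P (mmul f Q)))).
    { rewrite <- ln_mult, <- ln_mult by lra. apply ln_le; [nra|auto]. }
    assert (hD : D <= eps / 2 * INR N).
    { assert (hx : 2 * D / eps < INR N) by lra.
      apply Rmult_lt_compat_r with (r := eps / 2) in hx; [|lra].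
      replace (2 * D / eps * (eps / 2)) with D in hx by (field; lra). lra. }
    assert (hD' := Rle_abs (D1 + D2 + ln C + ln 2)). fold D in hD'.
    apply Rabs_le_between in e1, e2. apply Rabs_le; lra. }
  destruct (nfloor_ex (Rabs T0)) as (N0 & _ & hN0); [apply Rabs_pos|].
  set (N := (L + N0 + 1)%nat).
  assert (hNT : T0 < INR N).
  { unfold N; rewrite !plus_INR. assert (j := Rle_abs T0). assert (j' := pos_INR L). simpl; lra. }
  assert (hNp : 0 < INR N).
  { unfold N; rewrite !plus_INR. assert (j := pos_INR N0). assert (j' := pos_INR L). simpl; lra. }
  destruct (nfloor_ex (INR N * s)) as (k1 & hk1); [apply Rmult_le_pos; lra|].
  destruct (nfloor_ex (INR N * t)) as (k2 & hk2); [apply Rmult_le_pos; lra|].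
  destruct (hprod (gpow g k1) (gpow h k2)) as (f & hf & hfi); try (now apply (gpow_in n)).
  exists (INR N), (gmul (gpow g k1) (gmul f (gpow h k2))). repeat split; auto.
  - assert (hmul := proj1 (proj2 (proj2 hG))).
    apply hmul; [now apply (gpow_in n) | apply hmul; auto; now apply (gpow_in n)].
  - intros i hi. destruct (hfi i hi). apply (hL i N); auto. unfold N; lia.
Qed.

Lemma asym_cone_len n Gam g a : factor_nonelementary n Gam -> Gam g ->
  (forall i, (i < n)%nat -> is_len (g i) (a i)) -> asym_cone n Gam a.
Proof.
  intros hG hg ha. apply (asym_cone_ext n Gam (fun i => 1 * a i + 0 * a i)); [intros; ring|].
  apply (asym_cone_len_comb n Gam g g); auto; lra.
Qed.

Lemma asym_of_limit_cone q r Gam v : factor_nonelementary (q + r) Gam ->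
  limit_cone q r Gam v -> asym_cone (q + r) Gam v.
Proof.
  intros hG hv. apply hv.
  - apply asym_cone_closed.
  - apply asym_cone_is_cone, hG.
  - intros g u hg hu. apply (asym_cone_len _ _ g); auto. intros i hi.
    apply transl_length_is_len; auto. now apply (proj1 hG).
Qed.

(** The elements realising [u] and [v] come with unrelated scales [T], so they cannot be multiplied
    directly. Multiples of length vectors can be matched in scale by taking powers, and closedness
    removes the approximation. *)
Lemma asym_cone_add n Gam u v : factor_nonelementary n Gam ->
  asym_cone n Gam u -> asym_cone n Gam v -> asym_cone n Gam (fun i => u i + v i).
Proof.
  intros hG hu hv. apply asym_cone_closed; intros eps he.
  assert (hn := pos_INR n).
  set (e := eps / (2 * INR n + 1)).
  assert (he0 : 0 < e) by (apply Rdiv_lt_0_compat; lra).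
  destruct (asym_cone_approx _ _ u e hG hu he0) as (s & g & a & hs & hg & ha & hau).
  destruct (asym_cone_approx _ _ v e hG hv he0) as (t & h & b & ht & hh & hb & hbv).
  exists (fun i => s * a i + t * b i); split.
  - apply (asym_cone_len_comb n Gam g h); auto.
  - eapply Rle_lt_trans; [apply (vdist_le _ _ _ (2 * e)); [lra|]|].
    + intros i hi. specialize (hau i hi). specialize (hbv i hi).
      apply Rabs_le_between in hau, hbv. apply Rabs_le; lra.
    + assert (e * (2 * INR n + 1) = eps) by (unfold e; field; lra). lra.
Qed.

Lemma asym_cone_positive_vector n Gam : factor_nonelementary n Gam ->
  exists p, asym_cone n Gam p /\ forall i, (i < n)%nat -> 0 < p i.
Proof.
  intros hG.
  assert (key : forall m, (m <= n)%nat -> exists p, asym_cone n Gam p /\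
            forall i, (i < m)%nat -> 0 < p i).
  { induction m as [|m IH]; intros hm.
    - destruct (is_len_family gone) as [u hu]. exists u; split; [|intros; lia].
      apply (asym_cone_len n Gam gone); auto. apply hG.
    - destruct IH as (p & hp & hpos); [lia|].
      assert (hmn : (m < n)%nat) by lia.
      destruct (loxodromic_ex _ (sl2_subgroup_proj n Gam m hG hmn)) as (c & (g & hg & <-) & hl).
      { exact (proj2 (proj2 (proj2 (proj2 hG))) m hmn). }
      destruct (is_len_family g) as [u hu].
      exists (fun i => p i + u i); split.
      + apply asym_cone_add; auto. apply (asym_cone_len n Gam g); auto.
      + intros i hi. assert (h0 := is_len_ge0 _ _ (hu i)).
        destruct (Nat.eq_dec i m) as [->|].
        * assert (h1 := is_len_gt0 _ _ hl (hu m)).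
          assert (h2 := asym_cone_nonneg n Gam p m hG hp hmn). lra.
        * assert (0 < p i) by (apply hpos; lia). lra. }
  apply key; lia.
Qed.

(** * Geodesics in the product *)

Lemma sumR_plus n f g : sumR n (fun i => f i + g i) = sumR n f + sumR n g.
Proof. induction n; simpl; [ring | rewrite IHn; ring]. Qed.

Lemma sumR_scal n c f : sumR n (fun i => c * f i) = c * sumR n f.
Proof. induction n; simpl; [ring | rewrite IHn; ring]. Qed.

Lemma sumR_eq0 n f i : (forall j, (j < n)%nat -> 0 <= f j) -> sumR n f <= 0 -> (i < n)%nat ->
  f i = 0.
Proof.
  intros h1 h2 hi. assert (h3 := sumR_term n f i h1 hi). assert (h4 := h1 i hi). lra.
Qed.

Lemma vnorm_ge0 n v : 0 <= vnorm n v.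
Proof. apply sqrt_pos. Qed.

Lemma vnorm_sq n v : vnorm n v * vnorm n v = sumR n (fun i => v i * v i).
Proof. apply sqrt_sqrt, sumR_ge0; intros; apply Rle_0_sqr. Qed.

Lemma vnorm_ext n u v : (forall i, (i < n)%nat -> u i = v i) -> vnorm n u = vnorm n v.
Proof. intros h; unfold vnorm; f_equal; apply sumR_ext; intros; now rewrite h. Qed.

Lemma vnorm_scal n t v : vnorm n (fun i => t * v i) = Rabs t * vnorm n v.
Proof.
  unfold vnorm. rewrite <- (sqrt_Rsqr_abs t), <- sqrt_mult.
  - f_equal. rewrite <- sumR_scal. apply sumR_ext; intros; unfold Rsqr; ring.
  - apply Rle_0_sqr.
  - apply sumR_ge0; intros; apply Rle_0_sqr.
Qed.

Lemma vnorm_gt0 n v i : (i < n)%nat -> v i <> 0 -> 0 < vnorm n v.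
Proof.
  intros hi hv; apply sqrt_lt_R0.
  apply Rlt_le_trans with (v i * v i).
  - now apply Rlt_0_sqr.
  - apply (sumR_term n (fun i => v i * v i)); auto. intros; apply Rle_0_sqr.
Qed.

Lemma vnorm_coord n v i : (i < n)%nat -> Rabs (v i) <= vnorm n v.
Proof.
  intros hi. apply sqr_le_abs; [apply vnorm_ge0|]. rewrite vnorm_sq.
  apply (sumR_term n (fun i => v i * v i)); auto. intros; apply Rle_0_sqr.
Qed.

(** Applied to distances, it says that a geodesic of the product projects to geodesics of the
    factors run at proportional speeds. In |c| <= |a + b| <= |a| + |b| both inequalities must be
    equalities. *)
Lemma minkowski_equality n (a b c : nat -> R) :
  (forall i, (i < n)%nat -> 0 <= a i /\ 0 <= b i /\ 0 <= c i <= a i + b i) ->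
  vnorm n c = vnorm n a + vnorm n b -> 0 < vnorm n a ->
  forall i, (i < n)%nat -> c i = a i + b i /\ vnorm n a * c i = vnorm n c * a i.
Proof.
  intros h hc hA.
  assert (eA := vnorm_sq n a). assert (eB := vnorm_sq n b). assert (eC := vnorm_sq n c).
  assert (hB := vnorm_ge0 n b).
  set (A := vnorm n a) in *. set (B := vnorm n b) in *. set (X := sumR n (fun i => a i * b i)).
  (* With [X] the inner product, nonnegativity of this sum gives [X >= A B], while the sum of
     squares in [eD] is [2 A B (A B - X)]; so all its terms vanish. *)
  assert (eS : sumR n (fun i => (a i + b i) * (a i + b i) + -1 * (c i * c i)) = 2 * X - 2 * (A * B)).
  { rewrite sumR_plus, sumR_scal, <- eC, hc.
    rewrite (sumR_ext n _ (fun i => (a i * a i + b i * b i) + 2 * (a i * b i))) by (intros; ring).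
    rewrite !sumR_plus, sumR_scal, <- eA, <- eB. fold X; ring. }
  assert (pS : forall i, (i < n)%nat -> 0 <= (a i + b i) * (a i + b i) + -1 * (c i * c i)).
  { intros i hi; destruct (h i hi) as (h1 & h2 & h3). nra. }
  assert (hX : A * B <= X) by (assert (j := sumR_ge0 _ _ pS); lra).
  assert (eD : sumR n (fun i => (B * a i - A * b i) * (B * a i - A * b i))
               = 2 * (A * B) * (A * B) - 2 * (A * B) * X).
  { rewrite (sumR_ext n _ (fun i => (B * B * (a i * a i) + A * A * (b i * b i))
                                    + -2 * (A * B) * (a i * b i))) by (intros; ring).
    rewrite !sumR_plus, !sumR_scal, <- eA, <- eB. fold X; ring. }
  assert (hAB : 0 <= A * B) by nra.
  assert (zD : forall i, (i < n)%nat -> B * a i = A * b i).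
  { intros i hi.
    assert (z : (B * a i - A * b i) * (B * a i - A * b i) = 0).
    { apply (sumR_eq0 n (fun i => (B * a i - A * b i) * (B * a i - A * b i))); auto.
      - intros; apply Rle_0_sqr.
      - rewrite eD; nra. }
    apply Rmult_integral in z; destruct z; lra. }
  assert (eX : X = A * B).
  { apply Rmult_eq_reg_l with A; [|lra]. unfold X; rewrite <- sumR_scal.
    rewrite (sumR_ext n _ (fun i => B * (a i * a i))).
    - rewrite sumR_scal, <- eA; ring.
    - intros i hi. replace (A * (a i * b i)) with (a i * (A * b i)) by ring.
      rewrite <- zD by auto; ring. }
  intros i hi. destruct (h i hi) as (h1 & h2 & h3).
  assert (z : (a i + b i) * (a i + b i) + -1 * (c i * c i) = 0).
  { apply (sumR_eq0 n (fun i => (a i + b i) * (a i + b i) + -1 * (c i * c i))); auto.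
    rewrite eS, eX; lra. }
  assert (ec : c i = a i + b i) by nra.
  split; auto. rewrite ec, hc. assert (j := zD i hi). lra.
Qed.

(** The quotients are the unit direction of [p] seen from the base point. At the base point itself
    all coordinates vanish, so the value of a division by zero is immaterial. *)
Lemma sinh_polar_quot p : inH3 p ->
  pe1 p = sinh (d3 o3 p) * (pe1 p / sinh (d3 o3 p)) /\
  pe2 p = sinh (d3 o3 p) * (pe2 p / sinh (d3 o3 p)) /\
  pe3 p = sinh (d3 o3 p) * (pe3 p / sinh (d3 o3 p)).
Proof.
  intros hp. assert (h := sinh_d3_o3 p hp).
  destruct (Req_dec (sinh (d3 o3 p)) 0) as [e|e].
  - rewrite e in *. assert (pe1 p = 0 /\ pe2 p = 0 /\ pe3 p = 0) as (-> & -> & ->).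
    { repeat split; nra. }
    repeat split; ring.
  - repeat split; field; auto.
Qed.

(** Same direction as [p], radius multiplied by [th]. The hyperbolic plane is preserved because it
    is the locus where the third direction coordinate vanishes. *)
Lemma geodesic_point p th : inH3 p -> 0 <= th <= 1 -> exists y, inH3 y /\
  (im (fst p) = 0 -> im (fst y) = 0) /\
  d3 o3 y = th * d3 o3 p /\ d3 y p = (1 - th) * d3 o3 p.
Proof.
  intros hp hth. set (c := d3 o3 p). assert (hc : 0 <= c) by (apply d3_ge0; auto using inH3_o3).
  set (s := sinh c).
  assert (hs : s * s = pe1 p * pe1 p + pe2 p * pe2 p + pe3 p * pe3 p) by (apply sinh_d3_o3; auto).
  destruct (sinh_polar_quot p hp) as (q1 & q2 & q3). fold c in q1, q2, q3; fold s in q1, q2, q3.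
  set (t := sinh (th * c)).
  destruct (polar_pt_spec (t * (pe1 p / s)) (t * (pe2 p / s)) (t * (pe3 p / s))) as (hy & e1 & e2 & e3).
  set (y := polar_pt (t * (pe1 p / s)) (t * (pe2 p / s)) (t * (pe3 p / s))) in *.
  set (x1 := pe1 p / s) in *; set (x2 := pe2 p / s) in *; set (x3 := pe3 p / s) in *.
  assert (hthc : 0 <= th * c) by (apply Rmult_le_pos; lra).
  assert (ht0 : s = 0 -> t = 0).
  { intros h0. assert (c = 0) as e.
    { destruct hc as [hc|]; auto. assert (j := sinh_gt0 c hc). fold s in j; lra. }
    unfold t; rewrite e, Rmult_0_r, sinh_0; auto. }
  assert (hunit : t * t * (x1 * x1 + x2 * x2 + x3 * x3) = t * t).
  { destruct (Req_dec s 0) as [e|e]; [rewrite (ht0 e); ring|].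
    assert (x1 * x1 + x2 * x2 + x3 * x3 = 1) as ->; [|ring].
    apply Rmult_eq_reg_l with (s * s); [|apply Rmult_integral_contrapositive; auto].
    rewrite q1, q2, q3 in hs. lra. }
  assert (dy : d3 o3 y = th * c).
  { apply d3_o3_of_polar; auto. rewrite e1, e2, e3. fold t. lra. }
  exists y; repeat split; auto.
  - intros him. assert (x3 = 0) as z.
    { unfold x3, pe3; rewrite him; unfold Rdiv; ring. }
    unfold y, polar_pt; simpl. rewrite z. unfold Rdiv; ring.
  - apply d3_eq_of_cosh; auto; [apply Rmult_le_pos; lra|].
    rewrite <- cosh_d3, cosh_d3_polar by auto. rewrite dy. fold c.
    replace ((1 - th) * c) with (c - th * c) by ring. rewrite cosh_sub. fold s t.
    rewrite e1, e2, e3.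
    assert (ts : t * x1 * pe1 p + t * x2 * pe2 p + t * x3 * pe3 p = s * t); [|lra].
    rewrite q1, q2, q3.
    destruct (Req_dec t 0) as [e|e]; [rewrite e; ring|].
    apply Rmult_eq_reg_l with t; auto.
    transitivity (s * (t * t * (x1 * x1 + x2 * x2 + x3 * x3))); [ring|]. rewrite hunit; ring.
Qed.

Lemma im_act3_real g : real_mat g -> im (fst (act3 g o3)) = 0.
Proof.
  intros (h1 & h2 & h3 & h4). rewrite act3_o3; unfold hY; simpl.
  rewrite h1, h2, h3, h4; ring.
Qed.

Lemma inX_orbit q r Gam g : is_subgroup q r Gam -> Gam g -> inX q r (actX g base).
Proof.
  intros (hG & _) hg i hi. destruct (hG g hg i hi) as [h1 h2]. split.
  - now apply inH3_act3_o3.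
  - intros hq; apply im_act3_real; auto.
Qed.

(** Time 1, where [comp_speed] is measured, serves as the intermediate point between 0 and [s];
    hence [1 <= s]. *)
Lemma ray_speed q r gam s i : ray_from_base q r gam -> 1 <= s -> (i < q + r)%nat ->
  d3 o3 (gam s i) = s * comp_speed gam i.
Proof.
  intros (h0 & hX & hd) hs hi.
  assert (d1 := hd 0 1 ltac:(lra) ltac:(lra)).
  assert (d2 := hd 1 s ltac:(lra) ltac:(lra)).
  assert (d3' := hd 0 s ltac:(lra) ltac:(lra)).
  replace (0 - 1) with (- (1)) in d1 by ring. rewrite Rabs_Ropp, Rabs_R1 in d1.
  rewrite Rabs_left1 in d2, d3' by lra.
  destruct (minkowski_equality (q + r) (fun i => d3 (gam 0 i) (gam 1 i))
     (fun i => d3 (gam 1 i) (gam s i)) (fun i => d3 (gam 0 i) (gam s i))) with (i := i) as [_ e]; auto.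
  - intros j hj. rewrite h0. unfold base; fold o3.
    destruct (hX 1 ltac:(lra) j hj) as [i1 _]. destruct (hX s ltac:(lra) j hj) as [i2 _].
    repeat split; try (apply d3_ge0; auto using inH3_o3). now apply d3_triangle_o3.
  - unfold dX in d1, d2, d3'. unfold vnorm. lra.
  - unfold dX in d1. unfold vnorm. lra.
  - unfold dX in d1, d3'. unfold vnorm in e. rewrite d1, d3' in e.
    unfold comp_speed. rewrite h0 in *. unfold base in *; fold o3 in *. lra.
Qed.

(** [T] is the distance of an orbit point [x] from the base point. The point at distance [R0] on the
    segment to [x] has component radii [R0 / T] times those of [x], and is compared with
    [gam R0]. *)
Lemma asym_of_limit_ray q r Gam gam : is_subgroup q r Gam -> in_limit_set q r Gam gam ->
  asym_cone (q + r) Gam (comp_speed gam).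
Proof.
  intros hG (hray & hlim) eps T0 he.
  (* It exceeds [T0] and satisfies [1 <= R0], as [ray_speed] requires. The tolerance [eps * R0]
     becomes [eps * T] after rescaling by [T / R0]. *)
  set (R0 := Rabs T0 + 1). assert (hR : 1 <= R0) by (assert (j := Rabs_pos T0); unfold R0; lra).
  destruct (hlim R0 (eps * R0)) as (g & hg & hfar & hnb); [lra | apply Rmult_lt_0_compat; lra|].
  set (x := actX g base) in *. assert (hx := inX_orbit q r Gam g hG hg). fold x in hx.
  set (T := dX (q + r) base x) in *.
  exists T, g. assert (jT := Rle_abs T0). split; [unfold R0 in *; lra|]. split; [lra|]. split; auto.
  set (th := R0 / T).
  assert (hth : 0 <= th <= 1).
  { unfold th; split; [apply Rmult_le_pos; [lra|left; apply Rinv_0_lt_compat; lra]|].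
    apply Rmult_le_reg_r with T; [lra|]. unfold Rdiv; rewrite Rmult_assoc, Rinv_l; lra. }
  assert (thT : th * T = R0) by (unfold th; field; lra).
  assert (hex : forall i, exists y, (i < q + r)%nat -> inH3 y /\
     (im (fst (x i)) = 0 -> im (fst y) = 0) /\
     d3 o3 y = th * d3 o3 (x i) /\ d3 y (x i) = (1 - th) * d3 o3 (x i)).
  { intros i; destruct (Compare_dec.le_lt_dec (q + r) i); [exists o3; intros; lia|].
    destruct (geodesic_point (x i) th) as [y hy]; auto; [now apply hx|]. exists y; auto. }
  destruct (choice_nat _ hex) as [y hy].
  assert (iy : inX q r y).
  { intros i hi; destruct (hy i hi) as (h1 & h2 & _); split; auto.
    intros hq. apply h2. now apply (proj2 (hx i hi)). }
  assert (ey : dX (q + r) base y = R0).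
  { change (vnorm (q + r) (fun i => d3 o3 (y i)) = R0).
    rewrite (vnorm_ext _ _ (fun i => th * d3 o3 (x i))) by (intros i hi; now apply hy).
    rewrite vnorm_scal, Rabs_pos_eq by lra. exact thT. }
  assert (eyx : dX (q + r) y x = T - R0).
  { change (vnorm (q + r) (fun i => d3 (y i) (x i)) = T - R0).
    rewrite (vnorm_ext _ _ (fun i => (1 - th) * d3 o3 (x i))) by (intros i hi; now apply hy).
    rewrite vnorm_scal, Rabs_pos_eq by lra. change ((1 - th) * T = T - R0). lra. }
  assert (hlt := hnb y iy ey eyx).
  intros i hi. destruct (hy i hi) as (h1 & _ & h3 & _).
  assert (hgR := proj1 (proj1 (proj2 hray) R0 ltac:(lra) i hi)).
  assert (k1 := d3_o3_diff (y i) (gam R0 i) h1 hgR).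
  assert (k2 := vnorm_coord (q + r) (fun i => d3 (y i) (gam R0 i)) i hi). cbv beta in k2.
  change (vnorm (q + r) (fun i => d3 (y i) (gam R0 i)) < eps * R0) in hlt.
  assert (k3 := Rle_abs (d3 (y i) (gam R0 i))).
  rewrite h3, (ray_speed q r gam R0 i hray hR hi) in k1.
  change (d3 o3 (x i)) with (cartan (g i)) in k1.
  assert (k4 : Rabs (th * (cartan (g i) - T * comp_speed gam i)) <= eps * R0).
  { replace (th * (cartan (g i) - T * comp_speed gam i))
      with (th * cartan (g i) - R0 * comp_speed gam i) by (rewrite <- thT; ring). lra. }
  rewrite Rabs_mult, (Rabs_pos_eq th) in k4 by lra.
  assert (hth0 : 0 < th) by (unfold th; apply Rdiv_lt_0_compat; lra).
  apply Rmult_le_reg_l with th; auto. rewrite <- thT in k4. lra.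
Qed.

Lemma asym_of_proj_limit_set q r Gam w : is_subgroup q r Gam -> proj_limit_set q r Gam w ->
  asym_cone (q + r) Gam w.
Proof.
  intros hG (_ & gam & hl & _ & c & hc & hw).
  apply (asym_cone_ext _ _ (fun i => c * comp_speed gam i)); [intros; symmetry; auto|].
  apply asym_cone_is_cone; [apply hG | now apply asym_of_limit_ray | lra].
Qed.

(** * Limit rays with a prescribed speed vector *)

Lemma is_lim_seq_sumR n (u : nat -> nat -> R) (l : nat -> R) :
  (forall i, (i < n)%nat -> is_lim_seq (fun k => u k i) (l i)) ->
  is_lim_seq (fun k => sumR n (u k)) (sumR n l).
Proof.
  induction n; intros h; simpl; [apply is_lim_seq_const|].
  apply is_lim_seq_plus'; [apply IHn; intros; apply h; lia | apply h; lia].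
Qed.

Lemma is_lim_seq_vnorm n (u : nat -> nat -> R) (l : nat -> R) :
  (forall i, (i < n)%nat -> is_lim_seq (fun k => u k i) (l i)) ->
  is_lim_seq (fun k => vnorm n (u k)) (vnorm n l).
Proof.
  intros h; unfold vnorm.
  apply (is_lim_seq_continuous sqrt (fun k => sumR n (fun i => u k i * u k i))).
  - apply continuity_pt_sqrt, sumR_ge0; intros; apply Rle_0_sqr.
  - apply (is_lim_seq_sumR n (fun k i => u k i * u k i)). intros i hi.
    apply is_lim_seq_mult'; auto.
Qed.

Lemma is_lim_seq_cosh (u : nat -> R) (l : R) : is_lim_seq u l -> is_lim_seq (fun k => cosh (u k)) (cosh l).
Proof.
  apply is_lim_seq_continuous, derivable_continuous_pt, derivable_pt_cosh.
Qed.

Lemma is_lim_seq_sinh (u : nat -> R) (l : R) : is_lim_seq u l -> is_lim_seq (fun k => sinh (u k)) (sinh l).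
Proof.
  apply is_lim_seq_continuous, derivable_continuous_pt, derivable_pt_sinh.
Qed.

Lemma positive_lower_bound n (v : nat -> R) : (forall i, (i < n)%nat -> 0 < v i) ->
  exists m, 0 < m /\ forall i, (i < n)%nat -> m <= v i.
Proof.
  induction n as [|n IH]; intros h; [exists 1; split; [lra | intros; lia]|].
  destruct IH as (m & hm & hmi); [intros; apply h; lia|].
  assert (hn := h n ltac:(lia)).
  exists (Rmin m (v n)); split; [now apply Rmin_glb_lt|]. intros i hi.
  destruct (Nat.eq_dec i n) as [->|]; [apply Rmin_r|].
  eapply Rle_trans; [apply Rmin_l | apply hmi; lia].
Qed.

Definition pe (c : nat) (p : H3pt) : R :=
  match c with O => pe1 p | S O => pe2 p | _ => pe3 p end.

Lemma polar_quot_le1 c p : inH3 p -> Rabs (pe c p / sinh (d3 o3 p)) <= 1.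
Proof.
  intros hp. assert (h := sinh_d3_o3 p hp).
  assert (hc : pe c p * pe c p <= sinh (d3 o3 p) * sinh (d3 o3 p)).
  { rewrite h. assert (j1 := Rle_0_sqr (pe1 p)); assert (j2 := Rle_0_sqr (pe2 p)).
    assert (j3 := Rle_0_sqr (pe3 p)). unfold Rsqr in *.
    destruct c as [|[|c]]; simpl; lra. }
  destruct (Req_dec (sinh (d3 o3 p)) 0) as [e|e].
  - rewrite e in hc. assert (pe c p = 0) as -> by nra.
    unfold Rdiv; rewrite Rmult_0_l, Rabs_R0; lra.
  - assert (hs := sinh_ge0 _ (d3_ge0 o3 p inH3_o3 hp)).
    apply sqr_le_abs; [lra|].
    assert (0 < sinh (d3 o3 p)) by lra.
    apply Rmult_le_reg_r with (sinh (d3 o3 p) * sinh (d3 o3 p)); [nra|].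
    replace (pe c p / sinh (d3 o3 p) * (pe c p / sinh (d3 o3 p)) * (sinh (d3 o3 p) * sinh (d3 o3 p)))
      with (pe c p * pe c p) by (field; auto). lra.
Qed.

(** The geodesic from the base point with speed [v i] and unit direction [(U1 i, U2 i, U3 i)] in
    factor [i]. *)
Definition polar_ray (v U1 U2 U3 : nat -> R) (s : R) : Xpt :=
  fun i => polar_pt (sinh (s * v i) * U1 i) (sinh (s * v i) * U2 i) (sinh (s * v i) * U3 i).

Lemma polar_ray_base v U1 U2 U3 : polar_ray v U1 U2 U3 0 = base.
Proof.
  apply functional_extensionality; intros i. unfold polar_ray.
  rewrite Rmult_0_l, sinh_0, !Rmult_0_l. apply polar_pt_0.
Qed.

Lemma d3_o3_polar_ray v U1 U2 U3 s i : U1 i * U1 i + U2 i * U2 i + U3 i * U3 i = 1 ->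
  0 <= s -> 0 <= v i -> d3 o3 (polar_ray v U1 U2 U3 s i) = s * v i.
Proof.
  intros hU hs hv. unfold polar_ray.
  destruct (polar_pt_spec (sinh (s * v i) * U1 i) (sinh (s * v i) * U2 i) (sinh (s * v i) * U3 i))
    as (h0 & h1 & h2 & h3).
  apply d3_o3_of_polar; auto; [nra|]. rewrite h1, h2, h3.
  transitivity (sinh (s * v i) * sinh (s * v i) * (U1 i * U1 i + U2 i * U2 i + U3 i * U3 i)); [ring|].
  rewrite hU; ring.
Qed.

Lemma d3_polar_ray v U1 U2 U3 s s' i : U1 i * U1 i + U2 i * U2 i + U3 i * U3 i = 1 ->
  0 <= s -> 0 <= s' -> 0 <= v i ->
  d3 (polar_ray v U1 U2 U3 s i) (polar_ray v U1 U2 U3 s' i) = Rabs (s - s') * v i.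
Proof.
  intros hU hs hs' hv.
  assert (e := d3_o3_polar_ray v U1 U2 U3 s i hU hs hv).
  assert (e' := d3_o3_polar_ray v U1 U2 U3 s' i hU hs' hv).
  unfold polar_ray in *.
  destruct (polar_pt_spec (sinh (s * v i) * U1 i) (sinh (s * v i) * U2 i) (sinh (s * v i) * U3 i))
    as (h0 & h1 & h2 & h3).
  destruct (polar_pt_spec (sinh (s' * v i) * U1 i) (sinh (s' * v i) * U2 i) (sinh (s' * v i) * U3 i))
    as (k0 & k1 & k2 & k3).
  apply d3_eq_of_cosh; auto; [apply Rmult_le_pos; auto using Rabs_pos|].
  rewrite <- cosh_d3, cosh_d3_polar by auto. rewrite e, e', h1, h2, h3, k1, k2, k3.
  transitivity (cosh (s * v i - s' * v i)).
  - rewrite cosh_sub. f_equal.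
    transitivity (sinh (s * v i) * sinh (s' * v i) * (U1 i * U1 i + U2 i * U2 i + U3 i * U3 i)); [ring|].
    rewrite hU; ring.
  - replace (s * v i - s' * v i) with ((s - s') * v i) by ring.
    unfold Rabs; destruct (Rcase_abs (s - s')); auto.
    now rewrite <- cosh_opp, Ropp_mult_distr_l.
Qed.

Lemma polar_ray_is_ray q r v U1 U2 U3 :
  (forall i, (i < q + r)%nat -> 0 <= v i) -> vnorm (q + r) v = 1 ->
  (forall i, (i < q + r)%nat -> U1 i * U1 i + U2 i * U2 i + U3 i * U3 i = 1) ->
  (forall i, (i < q + r)%nat -> (q <= i)%nat -> U3 i = 0) ->
  ray_from_base q r (polar_ray v U1 U2 U3).
Proof.
  intros hv hn hU h3. split; [apply polar_ray_base|]. split.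
  - intros s hs i hi. split; [apply polar_pt_spec|].
    intros hq. unfold polar_ray, polar_pt; simpl. rewrite (h3 i hi hq). unfold Rdiv; ring.
  - intros s s' hs hs'.
    change (vnorm (q + r) (fun i => d3 (polar_ray v U1 U2 U3 s i) (polar_ray v U1 U2 U3 s' i)) = Rabs (s - s')).
    rewrite (vnorm_ext _ _ (fun i => Rabs (s - s') * v i)) by (intros; apply d3_polar_ray; auto).
    rewrite vnorm_scal, hn, Rabs_Rabsolu; ring.
Qed.

(* A point on the geodesic from the base point towards [x] at distance [Rr] is determined by [x]. *)
Lemma cone_nbhd_of_close q r v U1 U2 U3 Rr eps x :
  (forall i, (i < q + r)%nat -> 0 < v i) ->
  (forall i, (i < q + r)%nat -> U1 i * U1 i + U2 i * U2 i + U3 i * U3 i = 1) ->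
  0 < Rr -> 0 < eps -> inX q r x -> (forall i, (i < q + r)%nat -> 0 < d3 o3 (x i)) ->
  let T := dX (q + r) base x in Rr < T ->
  sumR (q + r) (fun i =>
    let a := Rr * (d3 o3 (x i) / T) in let s := sinh (d3 o3 (x i)) in
    8 * (cosh a * cosh (Rr * v i) - sinh a * sinh (Rr * v i) *
         (pe1 (x i) / s * U1 i + pe2 (x i) / s * U2 i + pe3 (x i) / s * U3 i) - 1)) < eps * eps ->
  in_cone_nbhd q r (polar_ray v U1 U2 U3) Rr eps x.
Proof.
  intros hv hU hR he hx hpos T hT hsum. split; auto.
  intros y hy ey eyx; fold T in eyx.
  set (gR := polar_ray v U1 U2 U3 Rr).
  assert (hbd : forall i, (i < q + r)%nat -> d3 (y i) (gR i) * d3 (y i) (gR i) <=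
    (let a := Rr * (d3 o3 (x i) / T) in let s := sinh (d3 o3 (x i)) in
    8 * (cosh a * cosh (Rr * v i) - sinh a * sinh (Rr * v i) *
         (pe1 (x i) / s * U1 i + pe2 (x i) / s * U2 i + pe3 (x i) / s * U3 i) - 1))).
  { intros i hi; cbv zeta.
    destruct (hy i hi) as [iy _]. destruct (hx i hi) as [ix _].
    (* Equality in the product triangle inequality forces equality in each factor, so [y i] has the
       direction of [x i] and radius [a]. The summand is then [sqr_le_cosh] with the law of cosines
       for [y i] and [gR i]. *)
    assert (hm : d3 o3 (x i) = d3 o3 (y i) + d3 (y i) (x i) /\ Rr * d3 o3 (x i) = T * d3 o3 (y i)).
    { rewrite <- ey.
      apply (minkowski_equality (q + r) (fun i => d3 o3 (y i)) (fun i => d3 (y i) (x i))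
               (fun i => d3 o3 (x i))); auto.
      - intros j hj. destruct (hy j hj) as [jy _]. destruct (hx j hj) as [jx _].
        repeat split; try (apply d3_ge0; auto using inH3_o3). now apply d3_triangle_o3.
      - change (T = dX (q + r) base y + dX (q + r) y x). lra.
      - change (0 < dX (q + r) base y). lra. }
    destruct hm as [m1 m2].
    assert (ea : Rr * (d3 o3 (x i) / T) = d3 o3 (y i)).
    { apply Rmult_eq_reg_l with T; [|lra]. rewrite <- m2. field; lra. }
    rewrite ea.
    assert (hs : 0 < sinh (d3 o3 (x i))) by (apply sinh_gt0; auto).
    destruct (d3_between_o3 (y i) (x i) iy ix ltac:(lra)) as (b1 & b2 & b3).
    set (s := sinh (d3 o3 (x i))) in *.
    assert (p1 : pe1 (y i) = sinh (d3 o3 (y i)) * (pe1 (x i) / s)).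
    { apply Rmult_eq_reg_l with s; [|lra]. rewrite b1; field; lra. }
    assert (p2 : pe2 (y i) = sinh (d3 o3 (y i)) * (pe2 (x i) / s)).
    { apply Rmult_eq_reg_l with s; [|lra]. rewrite b2; field; lra. }
    assert (p3 : pe3 (y i) = sinh (d3 o3 (y i)) * (pe3 (x i) / s)).
    { apply Rmult_eq_reg_l with s; [|lra]. rewrite b3; field; lra. }
    assert (hvi := hv i hi).
    assert (eg := d3_o3_polar_ray v U1 U2 U3 Rr i (hU i hi) ltac:(lra) ltac:(lra)). change (d3 o3 (gR i) = Rr * v i) in eg.
    destruct (polar_pt_spec (sinh (Rr * v i) * U1 i) (sinh (Rr * v i) * U2 i) (sinh (Rr * v i) * U3 i))
      as (h0 & h1 & h2 & h3).
    change (inH3 (gR i)) in h0. change (pe1 (gR i) = sinh (Rr * v i) * U1 i) in h1.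
    change (pe2 (gR i) = sinh (Rr * v i) * U2 i) in h2.
    change (pe3 (gR i) = sinh (Rr * v i) * U3 i) in h3.
    eapply Rle_trans; [apply sqr_le_cosh, d3_ge0; auto|].
    rewrite cosh_d3_polar, eg, h1, h2, h3 by auto.
    rewrite p1 at 1; rewrite p2 at 1; rewrite p3 at 1.
    right; ring. }
  change (vnorm (q + r) (fun i => d3 (y i) (gR i)) < eps).
  assert (h := vnorm_sq (q + r) (fun i => d3 (y i) (gR i))).
  assert (h' := sumR_le _ _ _ hbd). cbv beta in h, h'.
  assert (j := vnorm_ge0 (q + r) (fun i => d3 (y i) (gR i))).
  cbv zeta in *. nra.
Qed.

(** The cone supplies orbit points whose radii grow with ratios tending to [w]. A subsequence of
    their unit directions converges in every factor, and the ray with these directions and speeds is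
    the limit. *)
Lemma proj_limit_set_of_asym q r Gam w : (1 <= q + r)%nat -> is_subgroup q r Gam ->
  (forall i, (i < q + r)%nat -> 0 < w i) -> asym_cone (q + r) Gam w -> proj_limit_set q r Gam w.
Proof.
  intros hn hG hw hcone. set (n := (q + r)%nat) in *.
  set (W := vnorm n w).
  assert (hW : 0 < W) by (apply (vnorm_gt0 n w 0); [lia | assert (j := hw O ltac:(lia)); lra]).
  set (v := fun i => / W * w i).
  assert (hv : forall i, (i < n)%nat -> 0 < v i).
  { intros i hi; apply Rmult_lt_0_compat; auto. now apply Rinv_0_lt_compat. }
  assert (hv1 : vnorm n v = 1).
  { unfold v; rewrite vnorm_scal, Rabs_pos_eq by (left; now apply Rinv_0_lt_compat).
    fold W; field; lra. }
  assert (hvc : asym_cone n Gam v).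
  { apply asym_cone_is_cone; auto; [apply hG | left; now apply Rinv_0_lt_compat]. }
  (* Keeping the error below [m / 2] per unit of [T] leaves every component of the orbit point at
     distance at least [m / 2 * T] from the base point; so its direction is defined, and the
     distance eventually exceeds any [Rr]. *)
  destruct (positive_lower_bound n v hv) as (m & hm & hmv).
  assert (hex : forall k : nat, exists Tg : R * (nat -> mat2), INR k < fst Tg /\ 0 < fst Tg /\ Gam (snd Tg) /\
     forall i, (i < n)%nat -> Rabs (cartan (snd Tg i) - fst Tg * v i) <= m / 2 * / (INR k + 1) * fst Tg).
  { intros k. destruct (hvc (m / 2 * / (INR k + 1)) (INR k)) as (T & g & h1 & h2 & h3 & h4).
    - apply Rmult_lt_0_compat; [lra|]. apply Rinv_0_lt_compat. assert (j := pos_INR k); lra.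
    - exists (T, g); auto. }
  destruct (choice_nat _ hex) as [Tg hTg].
  set (x := fun k => actX (snd (Tg k)) base).
  assert (hx : forall k, inX q r (x k)) by (intros k; apply (inX_orbit q r Gam); auto; apply hTg).
  assert (hxi : forall k i, (i < n)%nat -> inH3 (x k i)) by (intros k i hi; now apply hx).
  set (c := fun k i => d3 o3 (x k i)).
  assert (hc : forall k i, (i < n)%nat -> Rabs (c k i / fst (Tg k) - v i) <= m / 2 * / (INR k + 1)).
  { intros k i hi; destruct (hTg k) as (_ & h2 & _ & h4). specialize (h4 i hi).
    change (cartan (snd (Tg k) i)) with (c k i) in h4.
    apply Rmult_le_reg_r with (fst (Tg k)); auto.
    rewrite <- (Rabs_pos_eq (fst (Tg k))) at 2 by lra. rewrite <- Rabs_mult.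
    replace ((c k i / fst (Tg k) - v i) * fst (Tg k)) with (c k i - fst (Tg k) * v i) by (field; lra).
    exact h4. }
  assert (hinv1 : forall k, / (INR k + 1) <= 1).
  { intros k. rewrite <- Rinv_1. apply Rinv_le_contravar; [lra|]. assert (j := pos_INR k); lra. }
  assert (hcl : forall k i, (i < n)%nat -> m / 2 * fst (Tg k) <= c k i).
  { intros k i hi; destruct (hTg k) as (_ & h2 & _ & _). assert (h := hc k i hi).
    apply Rabs_le_between in h. specialize (hinv1 k). assert (j := hmv i hi).
    assert (jj : m / 2 <= c k i / fst (Tg k)) by nra.
    apply Rmult_le_compat_r with (r := fst (Tg k)) in jj; [|lra].
    replace (c k i / fst (Tg k) * fst (Tg k)) with (c k i) in jj by (field; lra). lra. }
  assert (hc0 : forall k i, (i < n)%nat -> 0 < c k i).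
  { intros k i hi; assert (h := hcl k i hi). destruct (hTg k) as (_ & h2 & _ & _).
    assert (0 < m / 2 * fst (Tg k)) by (apply Rmult_lt_0_compat; lra). lra. }
  destruct (bounded_subseq_fam (3 * n)
     (fun j k => pe (j mod 3) (x k (j / 3)%nat) / sinh (c k (j / 3)%nat)) 1) as (phi & l & hphi & hl).
  { intros j k hj. apply polar_quot_le1, hxi. apply Nat.Div0.div_lt_upper_bound; lia. }
  assert (key : forall d i, (d < 3)%nat -> (i < n)%nat ->
     is_lim_seq (fun k => pe d (x (phi k) i) / sinh (c (phi k) i)) (l (3 * i + d)%nat)).
  { intros d i hd hi. assert (h := hl (3 * i + d)%nat ltac:(lia)).
    replace ((3 * i + d) mod 3)%nat with d in h
      by (rewrite Nat.add_comm, Nat.mul_comm, Nat.Div0.mod_add, Nat.mod_small; lia).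
    replace ((3 * i + d) / 3)%nat with i in h; auto.
    rewrite Nat.add_comm, Nat.mul_comm, Nat.div_add, Nat.div_small by lia; auto. }
  set (U1 := fun i => l (3 * i + 0)%nat). set (U2 := fun i => l (3 * i + 1)%nat).
  set (U3 := fun i => l (3 * i + 2)%nat).
  assert (L1 : forall i, (i < n)%nat -> is_lim_seq (fun k => pe1 (x (phi k) i) / sinh (c (phi k) i)) (U1 i)).
  { intros i hi; exact (key 0%nat i ltac:(lia) hi). }
  assert (L2 : forall i, (i < n)%nat -> is_lim_seq (fun k => pe2 (x (phi k) i) / sinh (c (phi k) i)) (U2 i)).
  { intros i hi; exact (key 1%nat i ltac:(lia) hi). }
  assert (L3 : forall i, (i < n)%nat -> is_lim_seq (fun k => pe3 (x (phi k) i) / sinh (c (phi k) i)) (U3 i)).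
  { intros i hi; exact (key 2%nat i ltac:(lia) hi). }
  assert (hU : forall i, (i < n)%nat -> U1 i * U1 i + U2 i * U2 i + U3 i * U3 i = 1).
  { intros i hi.
    apply (is_lim_seq_eq (fun k => pe1 (x (phi k) i) / sinh (c (phi k) i) * (pe1 (x (phi k) i) / sinh (c (phi k) i))
      + pe2 (x (phi k) i) / sinh (c (phi k) i) * (pe2 (x (phi k) i) / sinh (c (phi k) i))
      + pe3 (x (phi k) i) / sinh (c (phi k) i) * (pe3 (x (phi k) i) / sinh (c (phi k) i)))).
    - repeat apply is_lim_seq_plus'; apply is_lim_seq_mult'; auto.
    - apply (is_lim_seq_ext (fun _ => 1)); [|apply is_lim_seq_const]. intros k.
      assert (hs := sinh_gt0 _ (hc0 (phi k) i hi)).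
      assert (e := sinh_d3_o3 (x (phi k) i) (hxi _ _ hi)). fold (c (phi k) i) in e.
      apply Rmult_eq_reg_r with (sinh (c (phi k) i) * sinh (c (phi k) i)); [|nra].
      rewrite Rmult_1_l, e at 1. field; lra. }
  assert (hU3 : forall i, (i < n)%nat -> (q <= i)%nat -> U3 i = 0).
  { intros i hi hq. apply (is_lim_seq_eq _ _ _ (L3 i hi)).
    apply (is_lim_seq_ext (fun _ => 0)); [|apply is_lim_seq_const]. intros k.
    unfold pe3. rewrite (proj2 (hx (phi k) i hi) hq). unfold Rdiv; ring. }
  set (gam := polar_ray v U1 U2 U3).
  assert (hv0 : forall i, (i < n)%nat -> 0 <= v i) by (intros; left; auto).
  assert (hspeed : forall i, (i < n)%nat -> comp_speed gam i = v i).
  { intros i hi. unfold comp_speed, gam. rewrite d3_polar_ray by (auto; lra).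
    replace (0 - 1) with (- (1)) by ring. rewrite Rabs_Ropp, Rabs_R1; ring. }
  split; auto. exists gam. split; [|split].
  - split; [now apply polar_ray_is_ray|]. intros Rr eps hR he.
    assert (Lc : forall i, (i < n)%nat -> is_lim_seq (fun k => c (phi k) i / fst (Tg (phi k))) (v i)).
    { intros i hi. apply (is_lim_seq_ext (fun k => v i + (c (phi k) i / fst (Tg (phi k)) - v i)));
        [intros; ring|].
      replace (Finite (v i)) with (Finite (v i + 0)) by (f_equal; ring).
      apply is_lim_seq_plus'; [apply is_lim_seq_const|].
      apply is_lim_seq_abs_0.
      apply (is_lim_seq_squeeze0 _ phi (m / 2)); auto. intros k; split; [apply Rabs_pos | auto]. }
    assert (LT : is_lim_seq (fun k => vnorm n (fun i => c (phi k) i / fst (Tg (phi k)))) 1).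
    { rewrite <- hv1. now apply (is_lim_seq_vnorm n (fun k i => c (phi k) i / fst (Tg (phi k)))). }
    assert (eT : forall k, vnorm n (fun i => c (phi k) i / fst (Tg (phi k)))
                           = dX n base (x (phi k)) / fst (Tg (phi k))).
    { intros k. destruct (hTg (phi k)) as (_ & h2 & _ & _).
      rewrite (vnorm_ext n _ (fun i => / fst (Tg (phi k)) * c (phi k) i)) by (intros; unfold Rdiv; ring).
      rewrite vnorm_scal, Rabs_pos_eq by (left; now apply Rinv_0_lt_compat).
      change (vnorm n (c (phi k))) with (dX n base (x (phi k))). unfold Rdiv; ring. }
    assert (hTpos : forall k, 0 < dX n base (x (phi k))).
    { intros k. apply (vnorm_gt0 n (fun i => d3 o3 (x (phi k) i)) 0); [lia|].
      assert (j := hc0 (phi k) O ltac:(lia)). unfold c in j; lra. }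
    assert (Lr : forall i, (i < n)%nat -> is_lim_seq (fun k => c (phi k) i / dX n base (x (phi k))) (v i)).
    { intros i hi.
      apply (is_lim_seq_ext (fun k => (c (phi k) i / fst (Tg (phi k))) /
          vnorm n (fun i => c (phi k) i / fst (Tg (phi k))))).
      - intros k. rewrite eT. destruct (hTg (phi k)) as (_ & h2 & _ & _). specialize (hTpos k).
        field; lra.
      - replace (Finite (v i)) with (Finite (v i / 1)) by (f_equal; field).
        apply is_lim_seq_div'; auto; lra. }
    (* The sum required by [cone_nbhd_of_close]. Radii tend to [Rr * v i] and directions to the unit
       vector [U], so each term tends to a multiple of [cosh^2 - sinh^2 - 1 = 0]. *)
    set (dt := fun (k i : nat) =>
      let a := Rr * (d3 o3 (x (phi k) i) / dX n base (x (phi k))) in let s := sinh (d3 o3 (x (phi k) i)) in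
      8 * (cosh a * cosh (Rr * v i) - sinh a * sinh (Rr * v i) *
         (pe1 (x (phi k) i) / s * U1 i + pe2 (x (phi k) i) / s * U2 i + pe3 (x (phi k) i) / s * U3 i) - 1)).
    assert (Ld : is_lim_seq (fun k => sumR n (dt k)) 0).
    { replace 0 with (sumR n (fun i => 8 * (cosh (Rr * v i) * cosh (Rr * v i)
         - sinh (Rr * v i) * sinh (Rr * v i) * (U1 i * U1 i + U2 i * U2 i + U3 i * U3 i) - 1))).
      - apply is_lim_seq_sumR. intros i hi. unfold dt; cbv zeta.
        apply is_lim_seq_mult'; [apply is_lim_seq_const|].
        apply is_lim_seq_minus'; [|apply is_lim_seq_const].
        assert (La : is_lim_seq (fun k => Rr * (d3 o3 (x (phi k) i) / dX n base (x (phi k)))) (Rr * v i)).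
        { apply is_lim_seq_mult'; [apply is_lim_seq_const | now apply Lr]. }
        apply is_lim_seq_minus'.
        + apply is_lim_seq_mult'; [now apply is_lim_seq_cosh | apply is_lim_seq_const].
        + apply is_lim_seq_mult'.
          * apply is_lim_seq_mult'; [now apply is_lim_seq_sinh | apply is_lim_seq_const].
          * apply is_lim_seq_plus'; [apply is_lim_seq_plus'|];
            (apply is_lim_seq_mult'; [|apply is_lim_seq_const]); [now apply L1 | now apply L2 | now apply L3].
      - rewrite (sumR_ext n _ (fun _ => 0)).
        + rewrite sumR_const; ring.
        + intros i hi. rewrite (hU i hi), cosh2_sinh2; ring. }
    apply is_lim_seq_spec in Ld. destruct (Ld (mkposreal (eps * eps) ltac:(nra))) as [K hK].
    simpl in hK.
    destruct (nfloor_ex (2 * Rr / m)) as (K2 & _ & hK2).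
    { apply Rmult_le_pos; [lra | left; now apply Rinv_0_lt_compat]. }
    (* Beyond [K] the sum is small; beyond [K2 + 1] one has [2 * Rr / m < T], so the orbit point is
       farther than [Rr]. *)
    set (k := (K + K2 + 1)%nat). exists (snd (Tg (phi k))). split; [apply hTg|].
    apply cone_nbhd_of_close; auto.
    + apply (hx (phi k)).
    + intros i hi. apply (hc0 (phi k) i hi).
    + change (Rr < dX n base (x (phi k))).
      assert (j1 : c (phi k) O <= dX n base (x (phi k))).
      { eapply Rle_trans; [apply Rle_abs|].
        apply (vnorm_coord n (fun i => d3 o3 (x (phi k) i)) 0); lia. }
      assert (j2 := hcl (phi k) O ltac:(lia)). destruct (hTg (phi k)) as (h1 & _).
      assert (j3 : INR K2 + 1 <= INR (phi k)).
      { rewrite <- S_INR. apply le_INR. assert (j := subseq_ge phi hphi k). unfold k in *; lia. }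
      assert (j4 : 2 * Rr / m < fst (Tg (phi k))) by lra.
      apply Rmult_lt_compat_r with (r := m / 2) in j4; [|lra].
      replace (2 * Rr / m * (m / 2)) with Rr in j4 by (field; lra). lra.
    + specialize (hK k ltac:(unfold k; lia)). apply Rabs_lt_between in hK.
      rewrite Rminus_0_r in hK. apply hK.
  - intros i hi. exists 1; split; [lra|]. unfold gam. rewrite polar_ray_base. intro e.
    assert (h := d3_o3_polar_ray v U1 U2 U3 1 i (hU i hi) ltac:(lra) (hv0 i hi)).
    rewrite e in h. assert (j := hv i hi).
    rewrite (d3_eq_of_cosh o3 (base i) 0) in h; [lra| apply inH3_o3 | apply inH3_o3 | lra |].
    rewrite cosh_0. unfold hB, base, o3, cnorm2; simpl; field.
  - exists W; split; auto. intros i hi. rewrite hspeed by auto. unfold v; field; lra.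
Qed.

(** * The limit cone *)

(** Adding [p / (k + 1)] with [p] a positive vector of the cone moves a vector with zero entries
    into the positive part without leaving the cone. *)
Lemma in_proj_closure_of_asym q r Gam v c : (1 <= q + r)%nat -> is_subgroup q r Gam ->
  factor_nonelementary (q + r) Gam -> nonzero_vec (q + r) v -> c <> 0 ->
  asym_cone (q + r) Gam (fun i => c * v i) ->
  in_proj_closure (q + r) (proj_limit_set q r Gam) v.
Proof.
  intros hn hG hF (i0 & hi0 & hvi0) hc hK eps he. set (n := (q + r)%nat) in *.
  destruct (asym_cone_positive_vector n Gam hF) as (p & hp & hpos).
  set (w := fun k i => c * v i + / (INR k + 1) * p i).
  assert (hinv : forall k, 0 < / (INR k + 1)).
  { intros k; apply Rinv_0_lt_compat; assert (j := pos_INR k); lra. }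
  assert (hw : forall k, proj_limit_set q r Gam (w k)).
  { intros k. apply proj_limit_set_of_asym; auto.
    - intros i hi. assert (j := asym_cone_nonneg n Gam _ i hF hK hi). cbv beta in j.
      assert (0 < / (INR k + 1) * p i) by (apply Rmult_lt_0_compat; auto). unfold w; lra.
    - apply asym_cone_add; auto. apply asym_cone_is_cone; auto; [apply hG | left; auto]. }
  assert (hV : 0 < vnorm n v) by (apply (vnorm_gt0 n v i0); auto).
  set (u := fun i => c * v i / vnorm n (fun i => c * v i)).
  assert (hlim : is_lim_seq (fun k => vdist n (fun i => w k i / vnorm n (w k)) u) 0).
  { replace 0 with (vnorm n (fun i => u i - u i)).
    - apply (is_lim_seq_vnorm n (fun k i => w k i / vnorm n (w k) - u i)). intros i hi.
      assert (hwl : forall i, is_lim_seq (fun k => w k i) (c * v i)).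
      { intros j. replace (Finite (c * v j)) with (Finite (c * v j + 0 * p j)) by (f_equal; ring).
        apply is_lim_seq_plus'; [apply is_lim_seq_const|].
        apply is_lim_seq_mult'; [apply is_lim_seq_inv_nat | apply is_lim_seq_const]. }
      apply is_lim_seq_minus'; [|apply is_lim_seq_const].
      apply is_lim_seq_div'; auto.
      + now apply is_lim_seq_vnorm.
      + rewrite vnorm_scal. apply Rmult_integral_contrapositive; split; [now apply Rabs_no_R0 | lra].
    - rewrite (vnorm_ext n _ (fun i => 0 * u i)) by (intros; ring).
      rewrite vnorm_scal, Rabs_R0; ring. }
  apply is_lim_seq_spec in hlim. destruct (hlim (mkposreal eps he)) as [K hKK].
  specialize (hKK K (Nat.le_refl K)). simpl in hKK. rewrite Rminus_0_r in hKK.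
  apply Rabs_lt_between in hKK.
  exists (w K); split; [apply hw|]. split.
  - exists i0; split; auto. assert (j := proj1 (hw K) i0 hi0). lra.
  (* [v] represents its projective class up to sign, and the sign of [c] selects the term of the
     minimum in [proj_dist]. *)
  - destruct (Rlt_dec 0 c) as [hcp|hcn].
    + eapply Rle_lt_trans; [apply Rmin_l|].
      replace (vdist n (fun i => w K i / vnorm n (w K)) (fun i => v i / vnorm n v))
        with (vdist n (fun i => w K i / vnorm n (w K)) u); [apply hKK|].
      apply vnorm_ext. intros i hi. unfold u. rewrite vnorm_scal, Rabs_pos_eq by lra.
      f_equal; field; lra.
    + eapply Rle_lt_trans; [apply Rmin_r|].
      replace (vdist n (fun i => w K i / vnorm n (w K)) (fun i => - v i / vnorm n v))
        with (vdist n (fun i => w K i / vnorm n (w K)) u); [apply hKK|].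
      apply vnorm_ext. intros i hi. unfold u. rewrite vnorm_scal, Rabs_left by lra.
      f_equal; field; lra.
Qed.

(** Closedness replaces the extraction of a limit: were neither unit representative of [v] in the
    cone, both would have positive distance from it, yet normalised points of the projective limit
    set lie in the cone and come arbitrarily close to one of the two. *)
Lemma asym_of_in_proj_closure q r Gam v : is_subgroup q r Gam -> nonzero_vec (q + r) v ->
  in_proj_closure (q + r) (proj_limit_set q r Gam) v ->
  exists c, c <> 0 /\ asym_cone (q + r) Gam (fun i => c * v i).
Proof.
  intros hG (i0 & hi0 & hvi0) hcl. set (n := (q + r)%nat) in *.
  assert (hV : 0 < vnorm n v) by (apply (vnorm_gt0 n v i0); auto).
  apply NNPP; intro hno.
  assert (far : forall u c, c <> 0 -> (forall i, (i < n)%nat -> u i = c * v i) ->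
     exists e, 0 < e /\ forall w, asym_cone n Gam w -> e <= vdist n w u).
  { intros u c hc hu. apply NNPP; intro hn. apply hno. exists c; split; auto.
    apply (asym_cone_ext n Gam u); auto. apply asym_cone_closed. intros e he.
    apply NNPP; intro hw; apply hn. exists e; split; auto. intros w hwc.
    destruct (Rle_dec e (vdist n w u)); auto. exfalso; apply hw; exists w; split; auto; lra. }
  destruct (far (fun i => v i / vnorm n v) (/ vnorm n v)) as (e1 & he1 & hf1).
  { apply Rinv_neq_0_compat; lra. } { intros; unfold Rdiv; ring. }
  destruct (far (fun i => - v i / vnorm n v) (- / vnorm n v)) as (e2 & he2 & hf2).
  { apply Ropp_neq_0_compat, Rinv_neq_0_compat; lra. } { intros; unfold Rdiv; ring. }
  destruct (hcl (Rmin e1 e2)) as (w & hw & _ & hd); [now apply Rmin_glb_lt|].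
  assert (hwK : asym_cone n Gam (fun i => w i / vnorm n w)).
  { apply (asym_cone_ext n Gam (fun i => / vnorm n w * w i)); [intros; unfold Rdiv; ring|].
    apply asym_cone_is_cone; [apply hG | now apply asym_of_proj_limit_set|].
    left; apply Rinv_0_lt_compat, (vnorm_gt0 n w i0); auto.
    assert (j := proj1 hw i0 hi0); lra. }
  assert (h1 := hf1 _ hwK). assert (h2 := hf2 _ hwK).
  assert (j1 := Rmin_l e1 e2). assert (j2 := Rmin_r e1 e2).
  unfold proj_dist in hd.
  assert (Rmin e1 e2 <= Rmin (vdist n (fun i => w i / vnorm n w) (fun i => v i / vnorm n v))
       (vdist n (fun i => w i / vnorm n w) (fun i => - v i / vnorm n v))); [|fold n in hd; lra].
  apply Rmin_glb; lra.
Qed.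

Theorem theoremA (q r : nat) (Gam : (nat -> mat2) -> Prop) :
  (2 <= q + r)%nat ->
  is_subgroup q r Gam ->
  nonelementary q r Gam ->
  (* (1) convexity of the projective limit set *)
  (forall x y lam,
     proj_limit_set q r Gam x -> proj_limit_set q r Gam y -> 0 < lam ->
     proj_limit_set q r Gam (fun i => x i + lam * y i)) /\
  (* (2) closure of P_Gamma in RP^{q+r-1} = image of the limit cone *)
  (forall v, nonzero_vec (q + r) v ->
     (in_proj_closure (q + r) (proj_limit_set q r Gam) v <->
      exists c, c <> 0 /\ limit_cone q r Gam (fun i => c * v i))) /\
  (* (3) the limit cone is convex *)
  (forall u v, limit_cone q r Gam u -> limit_cone q r Gam v ->
     forall s, 0 <= s <= 1 -> limit_cone q r Gam (fun i => s * u i + (1 - s) * v i)).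
Proof.
  intros hn hG hne. assert (hF := factor_nonelementary_of q r Gam hG hne).
  assert (hcone : is_cone (asym_cone (q + r) Gam)) by (apply asym_cone_is_cone, hG).
  split; [|split].
  - intros x y lam hx hy hl. apply proj_limit_set_of_asym; [lia | auto | |].
    + intros i hi. assert (j := proj1 hx i hi). assert (j' := proj1 hy i hi).
      assert (0 < lam * y i) by (apply Rmult_lt_0_compat; auto). lra.
    + apply asym_cone_add; auto; [now apply asym_of_proj_limit_set|].
      apply hcone; [now apply asym_of_proj_limit_set | lra].
  - intros v hv; split.
    + intros h. destruct (asym_of_in_proj_closure q r Gam v hG hv h) as (c & hc & hK).
      exists c; split; auto. now apply limit_cone_of_asym.
    + intros (c & hc & hK). apply (in_proj_closure_of_asym q r Gam v c); auto; [lia|].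
      now apply asym_of_limit_cone.
  - intros u v hu hv s hs. apply limit_cone_of_asym; auto.
    apply asym_cone_add; auto; apply hcone; try lra; now apply asym_of_limit_cone.
Qed.
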